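(* There exists a germ $f(z)=e^{2\pi i\alpha}z+O(z^2)$ of holomorphic diffeomorphism fixing $0\in\mathbb{C}$, with $\alpha\in\mathbb{R}\setminus\mathbb{Q}$, which is non-linearizable and which has a hedgehog $K$ of positive two-dimensional Lebesgue measure.
   Context: A germ $f(z)=e^{2\pi i\alpha}z+O(z^2)$ with $\alpha\in\mathbb{R}\setminus\mathbb{Q}$ is called linearizable if it is holomorphically conjugate near $0$ to the rotation $R_\alpha(z)=e^{2\pi i\alpha}z$, and non-linearizable otherwise. By a theorem of Perez-Marco, if $f$ is univalent on a neighbourhood of the closure of a Jordan domain $U\ni 0$, there exist compact, connected, full sets $K\subset\overline{U}$ with $0\in K$, $K\cap\partial U\neq\emptyset$, and $f(K)=K=f^{-1}(K)$ (Siegel compacta); when $f$ is non-linearizable such an invariant compact set $K\neq\{0\}$ is called a hedgehog of $f$. Area means Lebesgue measure on $\mathbb{C}$. *)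

(* Defs.v *)
(* The complex plane is modelled as
   R[i] (mathcomp-real-closed) over an arbitrary R : realType, viewed as a
   numClosedFieldType so that MathComp-Analysis gives it its usual
   (normed, metric) topology and complex differentiability. *)
From HB Require Import structures.
From mathcomp Require Import all_boot all_order all_algebra.
From mathcomp Require Import all_classical all_reals all_analysis.
From mathcomp Require Import complex.
Import Order.TTheory GRing.Theory Num.Theory numFieldNormedType.Exports.

Set Implicit Arguments.
Unset Strict Implicit.
Unset Printing Implicit Defensive.

Local Open Scope ring_scope.
Local Open Scope classical_set_scope.

Definition Cx (R : realType) : numClosedFieldType := R[i].

Definition rotc (R : realType) (a : R) : Cx R :=
  (Complex (cos (2 * pi * a)) (sin (2 * pi * a)) : R[i]).

Definition holo_on (R : realType) (f : Cx R -> Cx R) (W : set (Cx R)) : Prop :=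
  forall z, W z -> derivable f z 1.

Definition inj_on (R : realType) (f : Cx R -> Cx R) (W : set (Cx R)) : Prop :=
  forall x y, W x -> W y -> f x = f y -> x = y.

Definition linearizable (R : realType) (f : Cx R -> Cx R) (a : R) : Prop :=
  exists (V : set (Cx R)) (phi : Cx R -> Cx R),
    [/\ open V, V 0, holo_on phi V & inj_on phi V] /\
    phi 0 = 0 /\ \forall z \near (0 : Cx R), phi (f z) = rotc a * phi z.

Definition jordan_curve (R : realType) (g : R -> Cx R) : Prop :=
  [/\ continuous g, (forall t, g (t + 1) = g t) &
      (forall s t, 0 <= s < 1 -> 0 <= t < 1 -> g s = g t -> s = t)].

Definition jordan_domain (R : realType) (U : set (Cx R)) : Prop :=
  exists g : R -> Cx R, jordan_curve g /\
    exists z0 : Cx R, [/\ ~ range g z0,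
      U = connected_component (~` range g) z0 &
      [bounded x | x in U]].

(* Siegel compactum of f relative to the Jordan domain U, where f is defined
   (univalent) on W, a neighbourhood of the closure of U: K is compact,
   connected, full (connected complement), 0 in K, K inside closure U,
   K meets the boundary of U, f(K) = K and f^{-1}(K) = K. *)
Definition siegel_compactum (R : realType) (f : Cx R -> Cx R)
    (W U K : set (Cx R)) : Prop :=
  [/\ compact K, connected K, connected (~` K) & K 0] /\
  [/\ K `<=` closure U,
      K `&` (closure U `\` interior U) !=set0,
      f @` K = K & [set z | W z /\ K (f z)] = K].

Definition hedgehog (R : realType) (f : Cx R -> Cx R) (a : R)
    (W U K : set (Cx R)) : Prop :=
  [/\ ~ linearizable f a, siegel_compactum f W U K & K <> [set 0]].

Definition realify (R : realType) (K : set (Cx R))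
  : set (measurableTypeR R * measurableTypeR R) :=
  [set p | K (Complex p.1 p.2 : R[i])].

Definition area (R : realType) (K : set (Cx R)) : \bar R :=
  ((@lebesgue_measure R) \x (@lebesgue_measure R))%E (realify K).

(* Main.v *)
(* The germ is a limit of lifts of rational rotations. Given a polynomial [h] with
   [h 0 = 0] and no critical point on [|z| <= 4], and a dyadic angle [a], let [f] be
   the lift of the rotation of angle [a] through [h], so that [h \o f = e^(2 pi i a) h],
   and let [K] be the image of the closed unit disc under a branch [Psi] of the inverse
   of [h]. Replace [h] by [g \o h], where the polynomial [g] commutes with the rotations
   of order [q] ([q] the denominator of [a]) and has no critical point on a large disc:
   [f] stays a lift of the same rotation, so a small change of angle moves [f] very
   little. Take for [g] an approximate inverse of the conformal map of the disc onto
   the disc minus [q] radial slits, which start near [0] and end at the unit circle.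
   Slits have no area, so the new [K] lies inside the old one with almost the same
   area, but [Psi] now sends some points of the unit circle close to [0] and others
   to distance more than [1/2], and under the new angle they share an orbit.

   In the limit, the intersection of the sets [K], with its holes filled in, is an
   invariant compactum of area at least [7/8], the angle is irrational because it is
   approximated too well by dyadic numbers, and there are orbits which start arbitrarily
   close to [0] and reach modulus [1/2]; so [f] is not linearizable. *)
Require Import Defs.
From HB Require Import structures.
From mathcomp Require Import all_boot all_order all_algebra.
From mathcomp Require Import all_classical all_reals all_analysis.
From mathcomp Require Import complex ring lra zify.
Import Order.TTheory GRing.Theory Num.Theory numFieldNormedType.Exports.
Local Open Scope ring_scope.
Local Open Scope classical_set_scope.
Set Implicit Arguments.
Unset Strict Implicit.
Unset Printing Implicit Defensive.

(** The obstacle is to keep one domain for all the maps. The sets [sK] shrink, so nothing can be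
    transported through [sPsi] on a fixed neighbourhood of [0]; the polynomial [sh] is what
    survives. As it has no critical point on a disc of fixed radius, its lift can be perturbed with
    the angle on all of [nm z < 2], with value and derivative under control. The inverse of the slit
    map is undefined across the slits; hence the approximate inverse [g], whose derivative must
    approximate [1 / slit'] on the image of a slightly smaller disc and yet vanish nowhere on a much
    larger disc. Such zero-free polynomials exist because [1 / slit'] is a product of functions with
    values in the right half-plane, each of which can be deformed to [1] without meeting [0]. The
    errors satisfy [e n.+1 = e n / (q * 2 ^ k n)], with [q] the new denominator: the factor [q]
    makes the limit angle irrational, and [2 ^ k n] lets [k n] iterates of the limit map follow
    those of stage [n.+1]. *)

(** * Norm and coordinates *)

Section Norm.
Variable R : realType.
Local Notation C := (Cx R).
Implicit Types (x y z : C) (a b e : R).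

(** Real-valued, whereas the norm of [Cx R] takes its values in [Cx R] itself; estimates thus stay
    over [R]. *)
Definition nm z : R := ComplexField.Normc.normc (z : R[i]).
Definition re z : R := complex.Re (z : R[i]).
Definition im z : R := complex.Im (z : R[i]).
Definition rc a : C := (Complex a 0 : R[i]).

Lemma nm_ge0 z : 0 <= nm z.
Proof. by case: z => a b; rewrite /nm /= sqrtr_ge0. Qed.
Lemma nm0 : nm 0 = 0. Proof. exact: ComplexField.Normc.normc0. Qed.
Lemma nm1 : nm 1 = 1. Proof. exact: ComplexField.Normc.normc1. Qed.
Lemma nmM x y : nm (x * y) = nm x * nm y.
Proof. exact: ComplexField.Normc.normcM. Qed.
Lemma nmN x : nm (- x) = nm x.
Proof. by case: x => a b; rewrite /nm /= !sqrrN. Qed.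
Lemma nmV x : nm x^-1 = (nm x)^-1.
Proof. exact: ComplexField.Normc.normcV. Qed.
Lemma nm_div x y : nm (x / y) = nm x / nm y.
Proof. by rewrite nmM nmV. Qed.
Lemma nmX x n : nm (x ^+ n) = nm x ^+ n.
Proof. by elim: n => [|n IH]; rewrite ?expr0 ?nm1// !exprS nmM IH. Qed.
Lemma nm_eq0 x : nm x = 0 -> x = 0.
Proof. exact: ComplexField.Normc.eq0_normc. Qed.
Lemma nm_gt0 x : x != 0 -> 0 < nm x.
Proof.
move=> x0; rewrite lt_neqAle nm_ge0 andbT; apply: contra x0 => /eqP h.
by apply/eqP/nm_eq0.
Qed.
Lemma nm_neq0 x : 0 < nm x -> x != 0.
Proof. by apply: contraTneq => ->; rewrite nm0 ltxx. Qed.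
Lemma nmD x y : nm (x + y) <= nm x + nm y.
Proof. exact: (@le_normcD R x y). Qed.
Lemma nmBC x y : nm (x - y) = nm (y - x).
Proof. by rewrite -opprB nmN. Qed.
Lemma nmB x y : nm (x - y) <= nm x + nm y.
Proof. by rewrite -(nmN y); apply: nmD. Qed.
Lemma nm_tri z x y : nm (x - y) <= nm (x - z) + nm (z - y).
Proof. by apply: le_trans (nmD _ _); rewrite addrA subrK. Qed.
Lemma nmBge x y : nm x - nm y <= nm (x - y).
Proof. by rewrite lerBlDr; apply: le_trans (nmD _ _); rewrite subrK. Qed.
Lemma nm_rc a : nm (rc a) = `|a|.
Proof. by rewrite /nm /= expr0n /= addr0 sqrtr_sqr. Qed.
Lemma nm_sqr z : nm z ^+ 2 = re z ^+ 2 + im z ^+ 2.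
Proof. by case: z => a b; rewrite /nm /= sqr_sqrtr// addr_ge0// sqr_ge0. Qed.
Lemma normE z : `|z| = rc (nm z).
Proof. by case: z => a b. Qed.
Lemma ltrc a b : (rc a < rc b :> C) = (a < b).
Proof. by rewrite ltcE /= eqxx. Qed.
Lemma lerc a b : (rc a <= rc b :> C) = (a <= b).
Proof. by rewrite lecE /= eqxx. Qed.
Lemma rc0 : rc 0 = 0. Proof. by []. Qed.
Lemma rc1 : rc 1 = 1. Proof. by []. Qed.
Lemma rcD a b : rc (a + b) = rc a + rc b.
Proof. exact: (rmorphD (real_complex R)). Qed.
Lemma rcM a b : rc (a * b) = rc a * rc b.
Proof. exact: (rmorphM (real_complex R)). Qed.
Lemma rcN a : rc (- a) = - rc a.
Proof. exact: (rmorphN (real_complex R)). Qed.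
Lemma rcB a b : rc (a - b) = rc a - rc b.
Proof. exact: (rmorphB (real_complex R)). Qed.
Lemma rcV a : rc (a^-1) = (rc a)^-1.
Proof. exact: (fmorphV (real_complex R)). Qed.
Lemma rcX a n : rc (a ^+ n) = rc a ^+ n.
Proof. exact: (rmorphXn (real_complex R)). Qed.
Lemma rcn n : rc n%:R = n%:R.
Proof. exact: (rmorph_nat (real_complex R)). Qed.
Lemma rc_inj : injective rc.
Proof. by move=> a b []. Qed.
Lemma nm_nat n : nm (n%:R) = n%:R.
Proof. by rewrite -rcn nm_rc ger0_norm. Qed.

Lemma re_rc a : re (rc a) = a. Proof. by []. Qed.
Lemma im_rc a : im (rc a) = 0. Proof. by []. Qed.
Lemma reD x y : re (x + y) = re x + re y. Proof. by case: x y => ? ? []. Qed.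
Lemma imD x y : im (x + y) = im x + im y. Proof. by case: x y => ? ? []. Qed.
Lemma reN x : re (- x) = - re x. Proof. by case: x. Qed.
Lemma imN x : im (- x) = - im x. Proof. by case: x. Qed.
Lemma reB x y : re (x - y) = re x - re y. Proof. by rewrite reD reN. Qed.
Lemma imB x y : im (x - y) = im x - im y. Proof. by rewrite imD imN. Qed.
Lemma reM x y : re (x * y) = re x * re y - im x * im y.
Proof. by case: x y => ? ? []. Qed.
Lemma imM x y : im (x * y) = re x * im y + im x * re y.
Proof. by case: x y => ? ? []. Qed.
Lemma re1 : re 1 = 1. Proof. by []. Qed.
Lemma im1 : im 1 = 0. Proof. by []. Qed.
Lemma re0 : re 0 = 0. Proof. by []. Qed.
Lemma ceq x y : re x = re y -> im x = im y -> x = y.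
Proof. by case: x y => ? ? [] ? ? /= -> ->. Qed.
Lemma le_re z : `|re z| <= nm z.
Proof.
rewrite -(ler_pXn2r (n:=2)) ?nnegrE ?nm_ge0 ?normr_ge0// real_normK ?num_real//.
by rewrite nm_sqr lerDl sqr_ge0.
Qed.
Lemma le_im z : `|im z| <= nm z.
Proof.
rewrite -(ler_pXn2r (n:=2)) ?nnegrE ?nm_ge0 ?normr_ge0// real_normK ?num_real//.
by rewrite nm_sqr lerDr sqr_ge0.
Qed.
Lemma re_le z : re z <= nm z.
Proof. by apply: le_trans (le_re z); rewrite ler_norm. Qed.
Lemma nm_le z : nm z <= `|re z| + `|im z|.
Proof.
rewrite -(ler_pXn2r (n:=2)) ?nnegrE ?nm_ge0 ?addr_ge0 ?normr_ge0//.
rewrite nm_sqr sqrrD !real_normK ?num_real// -addrA lerD2l lerDr.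
by rewrite mulrn_wge0// mulr_ge0.
Qed.

Lemma nm_lt_sqr x y : (nm x < nm y) = (re x ^+ 2 + im x ^+ 2 < re y ^+ 2 + im y ^+ 2).
Proof. by rewrite -!nm_sqr ltr_pXn2r// nnegrE nm_ge0. Qed.

Lemma nm_small x : (forall e, 0 < e -> nm x <= e) -> x = 0.
Proof.
move=> h; apply: nm_eq0; apply/eqP; rewrite eq_le nm_ge0 andbT.
by apply/ler_addgt0Pl => e e0; rewrite addr0 h.
Qed.

(* Interval nesting in both coordinates: the budget [2 * e n] bounds the tail. *)
Lemma nested_lim (u : nat -> R) (e : nat -> R) :
  (forall n, 0 <= e n) -> (forall n, 2 * e n.+1 <= e n) ->
  (forall n, `|u n.+1 - u n| <= e n) ->
  exists l, forall n, `|l - u n| <= 2 * e n.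
Proof.
move=> e0 e2 ue.
have lo n k : u n - 2 * e n <= u (n + k)%N - 2 * e (n + k)%N.
  elim: k => [|k IH]; first by rewrite addn0.
  rewrite addnS; apply: (le_trans IH).
  move: (ue (n + k)%N) (e2 (n + k)%N); rewrite ler_norml => /andP[]; lra.
have hi n k : u (n + k)%N + 2 * e (n + k)%N <= u n + 2 * e n.
  elim: k => [|k IH]; first by rewrite addn0.
  rewrite addnS; apply: le_trans IH.
  move: (ue (n + k)%N) (e2 (n + k)%N); rewrite ler_norml => /andP[]; lra.
have lohi n m : u n - 2 * e n <= u m + 2 * e m.
  case: (leqP n m) => [/subnK|/ltnW/subnK] h.
    have := lo n (m - n)%N; rewrite addnC h.
    move: (e0 m); lra.
  have := hi m (n - m)%N; rewrite addnC h.
  move: (e0 n); lra.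
pose A := [set u n - 2 * e n | n in [set: nat]].
exists (sup A) => n; rewrite ler_norml; apply/andP; split.
  have : u n - 2 * e n <= sup A.
    apply: ub_le_sup; last by exists n.
    by exists (u 0%N + 2 * e 0%N) => _ [m _ <-]; exact: lohi.
  lra.
have : sup A <= u n + 2 * e n.
  apply: ge_sup; first by exists (u 0%N - 2 * e 0%N); exists 0%N.
  by move=> _ [m _ <-]; exact: lohi.
lra.
Qed.

Lemma nested_limC (u : nat -> C) (e : nat -> R) :
  (forall n, 0 <= e n) -> (forall n, 2 * e n.+1 <= e n) ->
  (forall n, nm (u n.+1 - u n) <= e n) ->
  exists l, forall n, nm (l - u n) <= 2 * e n.
Proof.
move=> e0 e2 ue.
have [a ha] : exists a, forall n, `|a - re (u n)| <= 2 * e n.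
  apply: nested_lim => // n; rewrite -reB; exact: le_trans (le_re _) (ue n).
have [b hb] : exists b, forall n, `|b - im (u n)| <= 2 * e n.
  apply: nested_lim => // n; rewrite -imB; exact: le_trans (le_im _) (ue n).
pose l : C := (Complex a b : R[i]).
(* Separate coordinates only give [4 * e n]; [tail] with [k] large brings the bound back to
   [2 * e n]. *)
have h4 n : nm (l - u n) <= 4 * e n.
  apply: (le_trans (nm_le _)); rewrite reB imB.
  move: (ha n) (hb n); rewrite /l /re /im /=; lra.
have tail n k : nm (u (n + k)%N - u n) <= 2 * e n - 2 * e (n + k)%N.
  elim: k => [|k IH]; first by rewrite addn0 !subrr nm0.
  rewrite addnS; apply: (le_trans (nm_tri (u (n + k)%N) _ _)).
  move: (ue (n + k)%N) (e2 (n + k)%N); lra.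
exists l => n; apply/ler_addgt0Pl => d d0.
have small k : e (n + k)%N <= e n / 2 ^+ k.
  elim: k => [|k IH]; first by rewrite addn0 expr0 divr1.
  rewrite addnS exprS invfM mulrCA.
  move: (e2 (n + k)%N) IH; set x := _ / 2 ^+ k; lra.
have [k hk] : exists k, 4 * (e n / 2 ^+ k) <= d.
  have [k hk] : exists k, 4 * e n / d < k%:R.
    exists (Num.truncn (4 * e n / d)).+1; apply: truncnS_gt.
  exists k; rewrite mulrA ler_pdivrMr ?exprn_gt0//.
  have : k%:R <= 2 ^+ k :> R.
    by rewrite -natrX ler_nat; apply/ltnW/ltn_expl.
  rewrite ltr_pdivrMr// in hk.
  move: hk d0; set x := 2 ^+ k; set y := k%:R; nra.
apply: (le_trans (nm_tri (u (n + k)%N) _ _)).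
move: (h4 (n+k)%N) (tail n k) (small k) (e0 (n+k)%N); lra.
Qed.

(** The contraction principle: the iterates from [c] have successive distances at most [r / 2 ^ n].
    It inverts polynomials locally and maps close to the identity. *)
Lemma half_fixpoint (G : C -> C) (c : C) (r : R) : 0 <= r ->
  (forall x, nm (x - c) <= r -> nm (G x - c) <= r) ->
  (forall x y, nm (x - c) <= r -> nm (y - c) <= r ->
     nm (G x - G y) <= nm (x - y) / 2) ->
  exists x, nm (x - c) <= r /\ G x = x.
Proof.
move=> r0 G1 G2.
pose u n := iter n G c.
have u1 n : nm (u n - c) <= r by elim: n => [|n IH] /=; rewrite ?subrr ?nm0 ?G1.
pose e n := r / 2 ^+ n.
have e2 n : 2 * e n.+1 = e n.
  by rewrite /e exprS; field; rewrite expf_neq0.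
have ue n : nm (u n.+1 - u n) <= e n.
  elim: n => [|n IH]; first by rewrite /e expr0 divr1; exact: (u1 1%N).
  have := G2 _ _ (u1 n.+1) (u1 n); rewrite -!iterS.
  rewrite -/(u n.+2) -/(u n.+1) -(e2 n) in IH *; lra.
have e0 n : 0 <= e n by rewrite /e divr_ge0 ?exprn_ge0.
have [|x hx] := @nested_limC u e e0 _ ue; first by move=> n; rewrite e2.
have esm d : 0 < d -> exists n, e n <= d.
  move=> d0; exists (Num.truncn (r / d)).+1; rewrite /e.
  rewrite ler_pdivrMr ?exprn_gt0// mulrC -ler_pdivrMr//.
  apply: (le_trans (ltW (truncnS_gt _))).
  by rewrite -natrX ler_nat; apply/ltnW/ltn_expl.
have xr : nm (x - c) <= r.
  apply/ler_addgt0Pl => d d0; have [n hn] := esm (d / 2) ltac:(lra).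
  apply: (le_trans (nm_tri (u n) _ _)); move: (hx n) (u1 n); lra.
exists x; split=> //; apply/eqP; rewrite -subr_eq0; apply/eqP/nm_small => d d0.
have [n hn] := esm (d / 4) ltac:(lra).
apply: (le_trans (nm_tri (u n.+1) _ _)).
have := G2 _ _ xr (u1 n); rewrite -iterS -/(u n.+1).
move: (hx n) (hx n.+1) (e2 n); rewrite (nmBC (u n.+1)); lra.
Qed.

End Norm.

(** * Complex derivatives *)

(** General in the field, to serve both for real functions along a segment and for complex
    functions. *)
Lemma is_derive_eps (F : numFieldType) (f : F -> F) (z l : F) :
  (forall e, 0 < e -> exists2 d, 0 < d & forall x, `|x - z| < d ->
     `|f x - f z - l * (x - z)| <= e * `|x - z|) ->
  is_derive z 1 f l.
Proof.
move=> h.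
have cv : (fun t => t^-1 *: (f (t *: 1 + z) - f z)) @ 0^' --> (l : F).
  apply/cvgrPdist_le => e e0.
  have [d d0 hd] := h e e0.
  rewrite near_withinE; exists d => //= t /=; rewrite sub0r normrN => td t0.
  have := hd (t *: 1 + z); rewrite addrK [t *: 1]mulr1 => /(_ td) hh.
  rewrite distrC.
  have -> : t^-1 *: (f (t + z) - f z) - l = t^-1 * (f (t + z) - f z - l * t).
    rewrite [_ *: _]/(_ * _) [RHS]mulrBr; congr (_ - _).
    by rewrite mulrCA mulVf// mulr1.
  rewrite normrM normfV ler_pdivrMl ?normr_gt0//.
  by rewrite [_ * e]mulrC.
apply: DeriveDef; first by apply/cvg_ex; exists l.
exact: (cvg_lim (@norm_hausdorff _ F^o) cv).
Qed.

Section Deriv.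
Variable R : realType.
Local Notation C := (Cx R).
Implicit Types (x y z l : C) (f g : C -> C) (e d : R).

(** The complex derivative with real [e] and [d]; [is_derive_hasd] converts it to the notion of the
    theorem. *)
Definition hasd f z l := forall e, 0 < e -> exists2 d, 0 < d &
  forall x, nm (x - z) < d -> nm (f x - f z - l * (x - z)) <= e * nm (x - z).

Lemma hasd_cst z c : hasd (fun=> c) z 0.
Proof.
move=> e e0; exists 1 => // x _; rewrite subrr mul0r subrr nm0.
by rewrite mulr_ge0 ?nm_ge0 ?ltW.
Qed.

Lemma hasd_id z : hasd id z 1.
Proof.
move=> e e0; exists 1 => // x _; rewrite mul1r subrr nm0.
by rewrite mulr_ge0 ?nm_ge0 ?ltW.
Qed.

Lemma hasd_lip f z l : hasd f z l -> exists2 d, 0 < d &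
  forall x, nm (x - z) < d -> nm (f x - f z) <= (nm l + 1) * nm (x - z).
Proof.
move=> /(_ 1 ltr01)[d d0 h]; exists d => // x /h hx.
have := nmD (f x - f z - l * (x - z)) (l * (x - z)); rewrite subrK nmM.
move: hx; lra.
Qed.

Lemma hasd_cont f z l : hasd f z l -> forall e, 0 < e -> exists2 d, 0 < d &
  forall x, nm (x - z) < d -> nm (f x - f z) <= e.
Proof.
move=> /hasd_lip[d d0 h] e e0; have p := nm_ge0 l.
exists (Num.min d (e / (nm l + 1))); first by rewrite lt_min d0 divr_gt0//; lra.
move=> x; rewrite lt_min => /andP[/h hx].
rewrite ltr_pdivlMr; last lra.
by rewrite mulrC => /ltW; apply: le_trans.
Qed.

Lemma hasd_ext f g z l d : 0 < d -> (forall x, nm (x - z) < d -> f x = g x) ->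
  hasd f z l -> hasd g z l.
Proof.
move=> d0 fg h e /h[d' d'0 hd]; exists (Num.min d d'); first by rewrite lt_min d0.
move=> x; rewrite lt_min => /andP[/fg <- /hd].
by rewrite -(fg z) // subrr nm0.
Qed.

Lemma hasdD f g z l m : hasd f z l -> hasd g z m ->
  hasd (fun x => f x + g x) z (l + m).
Proof.
move=> hf hg e e0.
have [d1 d10 h1] := hf _ (divr_gt0 e0 (ltr0Sn R 1)).
have [d2 d20 h2] := hg _ (divr_gt0 e0 (ltr0Sn R 1)).
exists (Num.min d1 d2); first by rewrite lt_min d10.
move=> x; rewrite lt_min => /andP[/h1 {}h1 /h2 {}h2].
have -> : f x + g x - (f z + g z) - (l + m) * (x - z) =
  (f x - f z - l * (x - z)) + (g x - g z - m * (x - z)) by ring.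
apply: (le_trans (nmD _ _)); lra.
Qed.

Lemma hasdM f g z l m : hasd f z l -> hasd g z m ->
  hasd (fun x => f x * g x) z (l * g z + f z * m).
Proof.
move=> hf hg e e0.
pose M := nm (g z) + nm (f z) + nm l + 1.
have pg := nm_ge0 (g z); have pf := nm_ge0 (f z); have pl := nm_ge0 l.
have M0 : 0 < M by rewrite /M; lra.
have e3 : 0 < e / (3 * M) by rewrite divr_gt0// mulr_gt0.
have [d1 d10 h1] := hf _ e3.
have [d2 d20 h2] := hg _ e3.
have [d3 d30 h3] := hasd_cont hg e3.
have [d4 d40 h4] := hasd_lip hf.
exists (Num.min (Num.min d1 d2) (Num.min d3 d4)); first by rewrite !lt_min d10 d20 d30.
move=> x; rewrite !lt_min => /andP[/andP[/h1 {}h1 /h2 {}h2] /andP[/h3 {}h3 /h4 {}h4]].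
have -> : f x * g x - f z * g z - (l * g z + f z * m) * (x - z) =
  (f x - f z) * (g x - g z) + ((f x - f z - l * (x - z)) * g z
   + f z * (g x - g z - m * (x - z))) by ring.
apply: (le_trans (nmD _ _)).
apply: (le_trans (lerD (lexx _) (nmD _ _))).
rewrite !nmM.
have px := nm_ge0 (x - z).
have ke : e = 3 * M * (e / (3 * M)) by field; rewrite lt0r_neq0.
move: e3 ke h1 h2 h3 h4; set k := e / _ => k0 -> h1 h2 h3 h4.
have a1 : nm (f x - f z) * nm (g x - g z) <= M * nm (x - z) * k.
  apply: ler_pM; rewrite ?nm_ge0//; apply: (le_trans h4).
  by rewrite ler_wpM2r// /M; lra.
have a2 : nm (f x - f z - l * (x - z)) * nm (g z) <= k * nm (x - z) * M.
  by apply: ler_pM; rewrite ?nm_ge0// /M; lra.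
have a3 : nm (f z) * nm (g x - g z - m * (x - z)) <= M * (k * nm (x - z)).
  by apply: ler_pM; rewrite ?nm_ge0// /M; lra.
move: a1 a2 a3; nra.
Qed.

Lemma hasd_comp f g z l m : hasd f z l -> hasd g (f z) m ->
  hasd (fun x => g (f x)) z (m * l).
Proof.
move=> hf hg e e0.
have pm := nm_ge0 m; have pl := nm_ge0 l.
have k1 : 0 < e / (2 * (nm m + 1)) by rewrite divr_gt0//; lra.
have k2 : 0 < e / (2 * (nm l + 1)) by rewrite divr_gt0//; lra.
have [d1 d10 h1] := hf _ k1.
have [d2 d20 h2] := hasd_lip hf.
have [d3 d30 h3] := hg _ k2.
have [d4 d40 h4] := hasd_cont hf (divr_gt0 d30 (ltr0Sn R 1)).
exists (Num.min (Num.min d1 d2) d4); first by rewrite !lt_min d10 d20.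
move=> x; rewrite !lt_min => /andP[/andP[/h1 {}h1 /h2 {}h2] /h4 {}h4].
have {}h3 : nm (g (f x) - g (f z) - m * (f x - f z)) <= e / (2 * (nm l + 1)) * nm (f x - f z).
  apply: h3; lra.
have -> : g (f x) - g (f z) - m * l * (x - z) =
  (g (f x) - g (f z) - m * (f x - f z)) + m * (f x - f z - l * (x - z)) by ring.
apply: (le_trans (nmD _ _)); rewrite nmM.
have px := nm_ge0 (x - z).
have a1 : e / (2 * (nm l + 1)) * nm (f x - f z) <= e / 2 * nm (x - z).
  apply: (le_trans (ler_wpM2l (ltW k2) h2)).
  have -> // : e / (2 * (nm l + 1)) * ((nm l + 1) * nm (x - z)) = e / 2 * nm (x - z).
  by field; apply: lt0r_neq0; lra.
have a2 : nm m * nm (f x - f z - l * (x - z)) <= e / 2 * nm (x - z).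
  apply: (le_trans (ler_wpM2l pm h1)).
  have -> : e / 2 * nm (x - z) = (nm m + 1) * (e / (2 * (nm m + 1)) * nm (x - z)).
    by field; apply: lt0r_neq0; lra.
  apply: ler_wpM2r; last lra.
  by rewrite mulr_ge0// ltW.
lra.
Qed.

Lemma hasdN f z l : hasd f z l -> hasd (fun x => - f x) z (- l).
Proof.
move=> h e /h[d d0 hd]; exists d => // x /hd.
rewrite -nmN; congr (nm _ <= _); ring.
Qed.

Lemma hasdB f g z l m : hasd f z l -> hasd g z m ->
  hasd (fun x => f x - g x) z (l - m).
Proof. by move=> hf /hasdN; apply: hasdD. Qed.

Lemma hasdMl f z l c : hasd f z l -> hasd (fun x => c * f x) z (c * l).
Proof.
move=> h; have := hasdM (hasd_cst z c) h.
by rewrite mul0r add0r.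
Qed.

(* A continuous local inverse branch of a function with nonzero derivative is
   differentiable; the continuity hypothesis is the [eps]-[delta] one. *)
Lemma hasd_branch f h z l m :
  (forall e, 0 < e -> exists2 d, 0 < d &
     forall x, nm (x - z) < d -> nm (f x - f z) <= e) ->
  hasd h (f z) m -> m != 0 -> hasd (fun x => h (f x)) z l -> hasd f z (l / m).
Proof.
move=> fc hh m0 hf e e0.
have pm := nm_gt0 m0.
have [d1 d10 h1] := hh _ (divr_gt0 pm (ltr0Sn R 1)).
have [d2 d20 h2] := fc _ (divr_gt0 d10 (ltr0Sn R 1)).
have [d3 d30 h3] := hasd_lip hf.
have pl := nm_ge0 l.
pose K := 2 * (nm l + 1) / nm m.
have K0 : 0 < K by rewrite divr_gt0//; lra.
(* The expansion of [h] at [f z] first yields a Lipschitz bound for [f] at [z]; only then is its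
   remainder small against [nm (x - z)]. *)
have lipf x : nm (x - z) < Num.min d2 d3 -> nm (f x - f z) <= K * nm (x - z).
  rewrite lt_min => /andP[/h2 a /h3 b].
  have {}a : nm (f x - f z) < d1 by lra.
  have := h1 _ a; set A := h (f x) - h (f z) in b *.
  have := nmBge (m * (f x - f z)) A; rewrite nmM (nmBC _ A).
  move=> h1' h2'; rewrite /K mulrAC ler_pdivlMr//; move: b h1' h2'; lra.
have k1 : 0 < e * nm m / (2 * K).
  by apply: divr_gt0; apply: mulr_gt0.
have [d4 d40 h4] := hh _ k1.
have [d5 d50 h5] := hf _ (divr_gt0 (mulr_gt0 e0 pm) (ltr0Sn R 1)).
have [d6 d60 h6] := fc _ (divr_gt0 d40 (ltr0Sn R 1)).
exists (Num.min (Num.min d2 d3) (Num.min d5 d6)); first by rewrite !lt_min d20 d30 d50.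
move=> x; rewrite lt_min => /andP[/lipf {}lipf]; rewrite lt_min => /andP[/h5 {}h5 /h6 {}h6].
have {}h4 : nm (h (f x) - h (f z) - m * (f x - f z)) <= e * nm m / (2 * K) * nm (f x - f z).
  by apply: h4; lra.
have -> : f x - f z - l / m * (x - z) =
  ((h (f x) - h (f z) - l * (x - z)) - (h (f x) - h (f z) - m * (f x - f z))) / m.
  by field.
rewrite nm_div ler_pdivrMr//.
apply: (le_trans (nmB _ _)).
have : e * nm m / (2 * K) * nm (f x - f z) <= e * nm m / 2 * nm (x - z).
  apply: (le_trans (ler_wpM2l (ltW k1) lipf)).
  have -> // : e * nm m / (2 * K) * (K * nm (x - z)) = e * nm m / 2 * nm (x - z).
  by field; rewrite lt0r_neq0.
move: h5 h4; lra.
Qed.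

Lemma hasd_inv z : z != 0 -> hasd (fun x => x^-1) z (- (z ^+ 2)^-1).
Proof.
move=> z0 e e0; have pz := nm_gt0 z0.
exists (Num.min (nm z / 2) (e * nm z ^+ 3 / 2)).
  by rewrite lt_min !(divr_gt0, mulr_gt0, exprn_gt0).
move=> x; rewrite lt_min => /andP[a b].
have px : nm z / 2 <= nm x.
  have := nmBge z (z - x); have -> : z - (z - x) = x by ring.
  rewrite nmBC; lra.
have x0 : x != 0 by apply: nm_neq0; lra.
have -> : x^-1 - z^-1 - - (z ^+ 2)^-1 * (x - z) = (x - z) * ((x - z) / (x * z ^+ 2)).
  by field; rewrite x0 z0.
rewrite nmM mulrC ler_wpM2r ?nm_ge0// nm_div nmM nmX.
have p2 : 0 < nm x * nm z ^+ 2 by rewrite mulr_gt0 ?exprn_gt0//; lra.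
rewrite ler_pdivrMr//; apply: (le_trans (ltW b)).
rewrite -mulrA ler_wpM2l ?(ltW e0)//.
by rewrite [_ ^+ 3]exprS mulrAC (ler_wpM2r (sqr_ge0 (nm z)) px).
Qed.

Lemma hasdV f z l : f z != 0 -> hasd f z l ->
  hasd (fun x => (f x)^-1) z (- l / f z ^+ 2).
Proof.
move=> f0 h; have := hasd_comp h (hasd_inv f0).
by rewrite !mulNr mulrC.
Qed.

Lemma hasd_div f g z l m : g z != 0 -> hasd f z l -> hasd g z m ->
  hasd (fun x => f x / g x) z ((l * g z - f z * m) / g z ^+ 2).
Proof.
move=> g0 hf hg; have := hasdM hf (hasdV g0 hg).
congr hasd; by field.
Qed.

Lemma hasd_poly (p : {poly C}) z : hasd (fun x => p.[x]) z p^`().[z].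
Proof.
elim/poly_ind: p => [|p c IH].
  rewrite deriv0 horner0; apply: (hasd_ext (f := fun=> 0) ltr01); last exact: hasd_cst.
  by move=> x _; rewrite horner0.
apply: (hasd_ext (f := fun x => p.[x] * x + c) ltr01).
  by move=> x _; rewrite hornerMXaddC.
have := hasdD (hasdM IH (hasd_id z)) (hasd_cst z c).
congr hasd; rewrite derivMXaddC !hornerE /=; ring.
Qed.

Lemma hasd_exp z n : hasd (fun x => x ^+ n) z (z ^+ n.-1 *+ n).
Proof.
have := hasd_poly 'X^n z; rewrite derivXn hornerMn hornerXn.
by apply: hasd_ext ltr01 _ => x _; rewrite hornerXn.
Qed.

Lemma is_derive_hasd f z l : hasd f z l -> is_derive z (1 : C) f l.
Proof.
move=> h; apply: is_derive_eps => e e0.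
have ee : e = rc (re e).
  apply: ceq => //; have := e0; rewrite ltcE /= => /andP[/eqP he _].
  by rewrite /im he.
rewrite ee in e0 *; rewrite -rc0 ltrc in e0.
have [d d0 hd] := h _ e0.
exists (rc d); first by rewrite -rc0 ltrc.
by move=> x; rewrite !normE ltrc => /hd; rewrite -rcM lerc.
Qed.

Definition seg x y (t : R) : C := x + rc t * (y - x).

Lemma mvt f (f' : C -> C) x y (B : R) :
  (forall t : R, 0 <= t <= 1 -> hasd f (seg x y t) (f' (seg x y t)) /\ nm (f' (seg x y t)) <= B) ->
  nm (f y - f x) <= B * nm (y - x).
Proof.
move=> H.
have [->|fxy] := eqVneq (f y) (f x).
  rewrite subrr nm0 mulr_ge0 ?nm_ge0//.
  have [_] := H 0 ltac:(by rewrite lexx ler01).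
  by apply: le_trans; rewrite nm_ge0.
pose w := f y - f x.
have w0 : 0 < nm w by apply: nm_gt0; rewrite subr_eq0.
(* The conjugate of [w] over its modulus: [cw * w] is the real number [nm w], so the real mean value
   theorem for [re (cw * f)] is enough. *)
pose cw : C := (Complex (re w / nm w) (- im w / nm w) : R[i]).
have cw1 : nm cw = 1.
  apply/eqP; rewrite -(@eqrXn2 _ 2) ?nm_ge0// nm_sqr expr1n; apply/eqP.
  rewrite /cw /re /im /= -/(re w) -/(im w) !exprMn sqrrN -mulrDl -nm_sqr exprVn.
  by rewrite divff// expf_neq0// lt0r_neq0.
pose g t := re (cw * f (seg x y t)).
have dg (t : R) : 0 <= t <= 1 -> is_derive t 1 g (re (cw * (f' (seg x y t) * (y - x)))).
  move=> /H [hd _]; apply: is_derive_eps => e e0.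
  have [d d0 hh] := hd _ (divr_gt0 e0 (ltr_pwDl ltr01 (nm_ge0 (y - x)))).
  have pp := nm_ge0 (y - x).
  exists (d / (1 + nm (y - x))); first by rewrite divr_gt0//; lra.
  move=> s; rewrite ltr_pdivlMr; last lra.
  move=> hs.
  have es : seg x y s - seg x y t = rc (s - t) * (y - x).
    by rewrite /seg rcB; ring.
  have {}hh : nm (f (seg x y s) - f (seg x y t) - f' (seg x y t) * (rc (s - t) * (y - x)))
      <= e / (1 + nm (y - x)) * (`|s - t| * nm (y - x)).
    have := hh (seg x y s); rewrite es nmM nm_rc; apply.
    apply: le_lt_trans hs; rewrite ler_wpM2l ?normr_ge0//; lra.
  have -> : g s - g t - re (cw * (f' (seg x y t) * (y - x))) * (s - t) =
     re (cw * (f (seg x y s) - f (seg x y t) - f' (seg x y t) * (rc (s - t) * (y - x)))).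
    rewrite /g -(re_rc (s - t)) -[re _ * re (rc _)]subr0.
    have <- : im (cw * (f' (seg x y t) * (y - x))) * im (rc (s - t)) = 0 by rewrite im_rc mulr0.
    rewrite -reM -!reB; congr re; rewrite !re_rc; ring.
  apply: (le_trans (le_re _)); rewrite nmM cw1 mul1r; apply: (le_trans hh).
  rewrite mulrCA [leRHS]mulrC ler_wpM2l ?normr_ge0//.
  rewrite mulrAC ler_pdivrMr; last lra.
  move: e0; nra.
have cg : {within `[0, 1], continuous g}.
  apply: derivable_within_continuous => t; rewrite in_itv /= => ht.
  by have [] := dg t ht.
have [t ht] := @MVT_segment R g (fun t => re (cw * (f' (seg x y t) * (y - x)))) 0 1 ler01
  (fun t ht => dg t ltac:(by move: ht; rewrite in_itv /= => /andP[/ltW -> /ltW ->])) cg.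
rewrite in_itv /= in ht.
have [_ hB] := H t ht.
rewrite subr0 mulr1 /g -reB -mulrBr.
have -> : seg x y 1 = y by rewrite /seg rc1 mul1r addrC subrK.
have -> : seg x y 0 = x by rewrite /seg rc0 mul0r addr0.
rewrite -/w => E.
have -> : nm w = re (cw * w).
  rewrite reM /cw /re /im /= -/(re w) -/(im w) mulrAC [_ * im w]mulrAC -mulrBl.
  rewrite mulNr opprK -!expr2 -nm_sqr expr2 mulfK// lt0r_neq0//.
rewrite E; apply: (le_trans (re_le _)); rewrite !nmM cw1 mul1r.
by rewrite ler_wpM2r ?nm_ge0.
Qed.

Lemma seg_ball c x y r t : 0 <= t <= 1 -> nm (x - c) <= r -> nm (y - c) <= r ->
  nm (seg x y t - c) <= r.
Proof.
move=> /andP[t0 t1] hx hy.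
have -> : seg x y t - c = rc (1 - t) * (x - c) + rc t * (y - c).
  by rewrite /seg rcB rc1; ring.
apply: (le_trans (nmD _ _)); rewrite !nmM !nm_rc !ger0_norm ?subr_ge0//.
have : (1 - t) * nm (x - c) <= (1 - t) * r by rewrite ler_wpM2l ?subr_ge0.
have : t * nm (y - c) <= t * r by rewrite ler_wpM2l.
lra.
Qed.

Lemma mvt_ball f f' c r B x y :
  (forall z, nm (z - c) <= r -> hasd f z (f' z) /\ nm (f' z) <= B) ->
  nm (x - c) <= r -> nm (y - c) <= r -> nm (f x - f y) <= B * nm (x - y).
Proof.
move=> H hx hy; apply: (mvt (f' := f')) => t ht.
exact/H/seg_ball.
Qed.

Lemma poly_bounded (p : {poly C}) (r : R) :
  exists2 B, 0 < B & forall z, nm z <= r -> nm p.[z] <= B.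
Proof.
elim/poly_ind: p => [|p c [B B0 IH]].
  by exists 1 => // z _; rewrite horner0 nm0 ler01.
have pr := normr_ge0 r; have pc := nm_ge0 c.
exists (B * `|r| + nm c + 1).
  by have := mulr_ge0 (ltW B0) pr; lra.
move=> z hz; rewrite hornerMXaddC; apply: (le_trans (nmD _ _)); rewrite nmM.
have : nm p.[z] * nm z <= B * `|r|.
  by apply: ler_pM; rewrite ?nm_ge0 ?IH//; apply: le_trans hz (ler_norm _).
lra.
Qed.

End Deriv.

(** * Approximation by polynomials without zeros *)

Section Approx.
Variable R : realType.
Local Notation C := (Cx R).

Lemma pow_small (th e : R) : 0 <= th < 1 -> 0 < e -> exists n, th ^+ n <= e.
Proof.
move=> /andP[t0 t1] e0.
have := @cvg_expr R th; rewrite ger0_norm// => /(_ t1).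
move=> /cvgrPdist_le /(_ e e0) [N _ hN]; exists N.
by have := hN N (leqnn N); rewrite /= sub0r normrN ger0_norm ?exprn_ge0.
Qed.

Lemma nat_big (x : R) : exists2 n, (0 < n)%N & x <= n%:R.
Proof.
exists (Num.truncn x).+1 => //; exact/ltW/truncnS_gt.
Qed.

(** Induction on [k]. With [w = P / N] and [k = N] the bound is [nm P ^ 2], free of [N]. *)
Lemma exp1_bound (w : C) (k : nat) : k%:R * nm w <= 1 ->
  nm ((1 + w) ^+ k - (1 + k%:R * w)) <= k%:R ^+ 2 * nm w ^+ 2.
Proof.
have w0 := nm_ge0 w.
elim: k => [|k IH] hk.
  by rewrite !mul0r expr0 addr0 subrr nm0 expr0n /= mul0r.
have k0 : 0 <= k%:R :> R by [].
rewrite -natr1 in hk *.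
have {}IH := IH ltac:(by move: hk; nra).
have -> : (1 + w) ^+ k.+1 - (1 + (k.+1)%:R * w) =
   ((1 + w) ^+ k - (1 + k%:R * w)) * (1 + w) + k%:R * w ^+ 2.
  by rewrite exprS -natr1; ring.
apply: (le_trans (nmD _ _)); rewrite nmM [X in _ + X]nmM nmX nm_nat.
have h1 : nm (1 + w) <= 1 + nm w by apply: (le_trans (nmD _ _)); rewrite nm1.
have h2 := ler_pM (nm_ge0 _) (nm_ge0 _) IH h1.
have h3 : k%:R * nm w <= 1 by move: hk; nra.
apply: (le_trans (lerD h2 (lexx _))).
have h4 : 0 <= k%:R * nm w ^+ 2 by rewrite mulr_ge0 ?exprn_ge0.
move: (ler_wpM2l h4 h3); nra.
Qed.

(** The two squares differ by an inner product of [b] and [s]; its positivity makes the convergence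
    factor of [apx_sqrt] less than 1. *)
Lemma nm_sqr_reflect (b s : C) (t : R) :
  nm (b - rc t * s) ^+ 2 =
  nm (b + rc t * s) ^+ 2 - 4 * t * (re b * re s + im b * im s).
Proof. rewrite !nm_sqr !reB !imB !reD !imD reM imM re_rc im_rc; ring. Qed.

(** Here [x = (sk - s) / (sk + s)], and [x'] is the same quotient after one iteration; the relation
    is written without dividing by [1 - x']. *)
Lemma sqrt_step (t s x : C) : 1 - x != 0 ->
  1 - t * (s * (1 + x) / (1 - x)) + t * s != 0 ->
  let sk := s * (1 + x) / (1 - x) in
  let x' := x * ((1 - t * sk - t * s) / (1 - t * sk + t * s)) in
  (sk + t * (s ^+ 2 - sk ^+ 2)) * (1 - x') = s * (1 + x').
Proof.
move=> x1 hb /=.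
have k0 : 1 - t * (s * (1 + x) / (1 - x)) + t * s =
   ((1 - x) - t * (s * (1 + x)) + t * s * (1 - x)) / (1 - x) by field.
have k : (1 - x) - t * (s * (1 + x)) + t * s * (1 - x) != 0.
  by apply: contraNneq hb => k; rewrite k0 k mul0r.
field.
rewrite x1 /=; apply: contraNneq k => k; rewrite -k; apply/eqP; ring.
Qed.

Variables (X : C -> Prop) (w : C -> C) (W : R).
Hypothesis wW : forall u, X u -> nm (w u) <= W.

(** The polynomial is evaluated at [w u], not at [u]: with [w = slit_pow], functions of the source
    variable are approximated by polynomials in the target variable. *)
Definition apx (a : C -> C) := forall e : R, 0 < e -> exists P : {poly C},
  forall u, X u -> nm (P.[w u] - a u) <= e.

Lemma apx_ext a b : (forall u, X u -> a u = b u) -> apx a -> apx b.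
Proof. by move=> ab h e /h[P hP]; exists P => u Xu; rewrite -ab// hP. Qed.

Lemma apx_bounded a : apx a -> exists2 B, 0 < B & forall u, X u -> nm (a u) <= B.
Proof.
move=> /(_ 1 ltr01)[P hP]; have [B B0 hB] := poly_bounded P W.
exists (B + 1); first lra.
move=> u Xu; have := hB _ (wW Xu); have := hP _ Xu.
have := nmBge (a u) P.[w u]; rewrite nmBC; lra.
Qed.

Lemma apx_cst c : apx (fun=> c).
Proof.
by move=> e e0; exists c%:P => u _; rewrite hornerC subrr nm0 ltW.
Qed.

Lemma apx_base : apx w.
Proof.
by move=> e e0; exists 'X => u _; rewrite hornerX subrr nm0 ltW.
Qed.

Lemma apxD a b : apx a -> apx b -> apx (fun u => a u + b u).
Proof.
move=> ha hb e e0; have e2 : 0 < e / 2 by lra.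
have [P hP] := ha _ e2; have [Q hQ] := hb _ e2.
exists (P + Q) => u Xu; rewrite hornerD.
have -> : P.[w u] + Q.[w u] - (a u + b u) = (P.[w u] - a u) + (Q.[w u] - b u) by ring.
apply: (le_trans (nmD _ _)); move: (hP _ Xu) (hQ _ Xu); lra.
Qed.

Lemma apxM a b : apx a -> apx b -> apx (fun u => a u * b u).
Proof.
move=> ha hb e e0.
have [A A0 hA] := apx_bounded ha; have [B B0 hB] := apx_bounded hb.
have e2 : 0 < e / (2 * B) by rewrite divr_gt0// mulr_gt0.
have [P hP] := ha _ e2.
have e3 : 0 < e / (2 * (A + e / (2 * B))) by rewrite divr_gt0// mulr_gt0// addr_gt0.
have [Q hQ] := hb _ e3.
exists (P * Q) => u Xu; rewrite hornerM.
have -> : P.[w u] * Q.[w u] - a u * b u =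
   (P.[w u] - a u) * b u + P.[w u] * (Q.[w u] - b u) by ring.
apply: (le_trans (nmD _ _)); rewrite !nmM.
have h1 := ler_pM (nm_ge0 _) (nm_ge0 _) (hP _ Xu) (hB _ Xu).
have h2 : nm P.[w u] <= A + e / (2 * B).
  have := nmBge P.[w u] (a u); move: (hP _ Xu) (hA _ Xu); lra.
have h3 := ler_pM (nm_ge0 _) (nm_ge0 _) h2 (hQ _ Xu).
apply: (le_trans (lerD h1 h3)).
have -> : e / (2 * B) * B = e / 2 by field; rewrite lt0r_neq0.
have p : 0 < A + e / (2 * B) by rewrite addr_gt0.
move: p; set k := A + _ => p.
have -> : k * (e / (2 * k)) = e / 2 by field; rewrite lt0r_neq0.
lra.
Qed.

Lemma apxB a b : apx a -> apx b -> apx (fun u => a u - b u).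
Proof.
move=> ha hb; apply: (apx_ext (a := fun u => a u + (-1) * b u)).
  by move=> u _; rewrite mulN1r.
by apply: apxD => //; apply: apxM => //; exact: apx_cst.
Qed.

Lemma apx_lim a : (forall e : R, 0 < e -> exists2 b, apx b & forall u, X u -> nm (b u - a u) <= e) ->
  apx a.
Proof.
move=> h e e0; have e2 : 0 < e / 2 by lra.
have [b hb hab] := h _ e2; have [P hP] := hb _ e2.
exists P => u Xu; apply: (le_trans (nm_tri (b u) _ _)).
move: (hP _ Xu) (hab _ Xu); lra.
Qed.

(* Neumann series: [1 - tau a] is a uniform contraction for small [tau]. *)
Lemma apx_inv a (m : R) : 0 < m -> (forall u, X u -> m <= re (a u)) -> apx a ->
  apx (fun u => (a u)^-1).
Proof.
move=> m0 ham ha; have [B B0 hB] := apx_bounded ha.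
have [[u0 Xu0]|nX] := pselect (exists u, X u); last first.
  by move=> e _; exists 0 => u Xu; case: nX; exists u.
have mB : m <= B by apply: le_trans (ham _ Xu0) (le_trans (re_le _) (hB _ Xu0)).
pose tau := m / B ^+ 2; pose th := 1 - m ^+ 2 / (2 * B ^+ 2).
have B20 : 0 < B ^+ 2 by rewrite exprn_gt0.
have tau0 : 0 < tau by rewrite divr_gt0.
have th01 : 0 <= th < 1.
  have k1 : 0 < m ^+ 2 / (2 * B ^+ 2).
    by apply: divr_gt0; rewrite ?exprn_gt0// mulr_gt0.
  have k2 : m ^+ 2 / (2 * B ^+ 2) <= 1.
    by rewrite ler_pdivrMr ?mulr_gt0// mul1r; move: mB m0; nra.
  by rewrite /th; apply/andP; split; lra.
have hth u : X u -> nm (1 - rc tau * a u) <= th.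
  move=> Xu; rewrite -(ler_pXn2r (n := 2)) ?nnegrE ?nm_ge0//; last by case/andP: th01.
  rewrite nm_sqr reB imB reM imM re1 im1 re_rc im_rc !mul0r subr0 addr0 add0r.
  have := nm_sqr (a u); have h1 := ham _ Xu.
  have : nm (a u) ^+ 2 <= B ^+ 2 by rewrite ler_pXn2r ?nnegrE ?nm_ge0 ?hB// ltW.
  move=> h2 h3; rewrite h3 in h2.
  have e1 : tau * B ^+ 2 = m by rewrite /tau divfK// lt0r_neq0.
  have e2 : th = 1 - tau * m / 2.
    by rewrite /th /tau; field; rewrite lt0r_neq0.
  have h4 : 0 <= tau * m by rewrite mulr_ge0 ?ltW.
  have h5 := ler_wpM2l (ltW tau0) h2.
  rewrite e1 in h5.
  have h6 := ler_wpM2l (ltW tau0) h5.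
  have h7 := ler_wpM2l (ltW tau0) h1.
  rewrite e2; move: h4 h6 h7; nra.
pose p n := iter n (fun (f : C -> C) u => rc tau + (1 - rc tau * a u) * f u) (fun=> 0).
have hp n : apx (p n).
  elim: n => [|n IH]; first exact: apx_cst.
  apply: apxD; first exact: apx_cst.
  apply: apxM => //; apply: apxB; first exact: apx_cst.
  by apply: apxM => //; exact: apx_cst.
have ep n u : X u -> nm (p n u - (a u)^-1) <= th ^+ n / m.
  move=> Xu.
  have am : m <= nm (a u) by apply: le_trans (ham _ Xu) (re_le _).
  have a0 : a u != 0 by apply: nm_neq0; apply: lt_le_trans am.
  elim: n => [|n IH].
    by rewrite /p /= sub0r nmN nmV expr0 mul1r lef_pV2 ?posrE//; apply: lt_le_trans am.
  have -> : p n.+1 u - (a u)^-1 = (1 - rc tau * a u) * (p n u - (a u)^-1).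
    by rewrite /p iterS /=; field.
  rewrite nmM exprS -mulrA; apply: ler_pM; rewrite ?nm_ge0//; exact: hth.
apply: apx_lim => e e0.
have [n hn] := pow_small th01 (mulr_gt0 e0 m0).
exists (p n) => // u Xu; apply: (le_trans (ep n u Xu)).
by rewrite ler_pdivrMr.
Qed.

(* The iteration [s_(k+1) = s_k + tau (c - s_k^2)], started at [1], multiplies
   [(s_k - s)/(s_k + s)] by [(1 - tau s_k - tau s)/(1 - tau s_k + tau s)], whose
   modulus is uniformly less than [1] when [re s] is bounded below. *)
Lemma apx_sqrt c s (m : R) : 0 < m -> (forall u, X u -> m <= re (s u)) ->
  (forall u, X u -> s u ^+ 2 = c u) -> apx c -> apx s.
Proof.
move=> m0 hm hs hc; have [B B0 hB] := apx_bounded hc.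
pose M := B + 1 + m.
have M0 : 0 < M by rewrite /M; lra.
have hM u : X u -> nm (s u) <= M.
  move=> Xu; have := hB _ Xu; rewrite -hs// nmX => h.
  rewrite /M; move: (nm_ge0 (s u)) h m0 B0; nra.
have mM : m <= M by rewrite /M; lra.
pose th0 := 1 - 2 * m / (1 + M) ^+ 2.
have D0 : 0 < (1 + M) ^+ 2 by rewrite exprn_gt0//; lra.
have th0m : (1 - th0) * (1 + M) ^+ 2 = 2 * m.
  rewrite /th0 opprB addrC subrK divfK// lt0r_neq0//.
have th01 : th0 < 1.
  by rewrite /th0 ltrBlDr ltrDl; apply: divr_gt0 => //; apply: mulr_gt0.
have th00 : 0 <= th0.
  rewrite /th0 subr_ge0 ler_pdivrMr// mul1r; move: mM m0; nra.
have hx0 u : X u -> nm ((1 - s u) / (1 + s u)) <= th0.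
  move=> Xu; have h1 := hm _ Xu; have h2 := hM _ Xu.
  have hre : 1 <= nm (1 + s u).
    by apply: le_trans (re_le _); rewrite reD re1; lra.
  rewrite nm_div ler_pdivrMr; last lra.
  rewrite -(ler_pXn2r (n := 2)) ?nnegrE ?mulr_ge0 ?nm_ge0//.
  rewrite exprMn !nm_sqr reB imB reD imD re1 im1.
  have h3 : nm (1 + s u) ^+ 2 <= (1 + M) ^+ 2.
    rewrite ler_pXn2r ?nnegrE ?nm_ge0//; last lra.
    by apply: (le_trans (nmD _ _)); rewrite nm1; lra.
  rewrite nm_sqr reD imD re1 im1 in h3.
  move: h3; set A := (1 + re (s u)) ^+ 2 + _ => h3.
  have -> : (1 - re (s u)) ^+ 2 + (0 - im (s u)) ^+ 2 = A - 4 * re (s u).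
    by rewrite /A; ring.
  have A0 : 0 <= A by rewrite addr_ge0 ?sqr_ge0.
  have h4 : (1 - th0) * A <= 2 * m.
    by rewrite -th0m ler_wpM2l// subr_ge0 ltW.
  move: h4 h1 A0 th00 th01; nra.
pose M' := 2 * M / (1 - th0).
have t10 : 0 < 1 - th0 by lra.
have M'0 : 0 < M' by rewrite divr_gt0// mulr_gt0.
(* The first bound keeps the inner product of [1 - tau * s_k] and [s] above [m / 2], the second
   keeps [tau * (nm s_k + nm s)] at most [1]. *)
pose tau := Num.min (m / (2 * (M * M'))) (1 / (M + M')).
have MM : 0 < M * M' by rewrite mulr_gt0.
have tau0 : 0 < tau.
  by rewrite lt_min; apply/andP; split; apply: divr_gt0; rewrite // ?addr_gt0// mulr_gt0.
have tau1 : tau * (M * M') <= m / 2.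
  have : tau <= m / (2 * (M * M')) by rewrite ge_min lexx.
  have MM2 : 0 < 2 * (M * M') by rewrite mulr_gt0.
  rewrite (ler_pdivlMr _ _ MM2) mulrCA; lra.
have tau2 : tau * (M + M') <= 1.
  have : tau <= 1 / (M + M') by rewrite ge_min lexx orbT.
  by rewrite ler_pdivlMr ?addr_gt0.
pose th1 := 1 - tau * m / 4.
have tm : tau * m <= 1.
  have : 0 <= tau * (M + M' - m) by rewrite mulr_ge0 ?(ltW tau0)//; lra.
  move: tau2; lra.
have tm0 : 0 < tau * m by rewrite mulr_gt0.
have th101 : 0 <= th1 < 1 by rewrite /th1; apply/andP; split; lra.
pose p n := iter n (fun (f : C -> C) u => f u + rc tau * (c u - f u ^+ 2)) (fun=> 1).
have hp n : apx (p n).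
  elim: n => [|n IH]; first exact: apx_cst.
  apply: apxD => //; apply: apxM; first exact: apx_cst.
  by apply: apxB => //; apply: (apxM IH IH).
have inv n u : X u -> exists2 x, nm x <= th0 * th1 ^+ n &
    p n u * (1 - x) = s u * (1 + x).
  move=> Xu; have h1 := hm _ Xu; have h2 := hM _ Xu.
  elim: n => [|n [x hx ex]].
    exists ((1 - s u) / (1 + s u)); first by rewrite expr0 mulr1; exact: hx0.
    have s10 : 1 + s u != 0.
      apply/eqP => /(congr1 (@re R)); rewrite reD re1 re0; lra.
    by rewrite /p /=; field.
  have [th1n0 th1n1] : 0 <= th1 ^+ n /\ th1 ^+ n <= 1.
    by move/andP: th101 => [a /ltW b]; rewrite exprn_ge0// exprn_ile1.
  have xth : nm x <= th0.
    by apply: (le_trans hx); rewrite ler_piMr.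
  have x1 : 1 - th0 <= nm (1 - x).
    by have := nmBge 1 x; rewrite nm1; lra.
  have x10 : 1 - x != 0 by apply: nm_neq0; lra.
  have pM : nm (p n u) <= M'.
    have := congr1 (@nm R) ex; rewrite !nmM => E.
    have : nm (s u) * nm (1 + x) <= M * 2.
      apply: ler_pM; rewrite ?nm_ge0//; apply: (le_trans (nmD _ _)); rewrite nm1; lra.
    rewrite -E => h3; rewrite /M' ler_pdivlMr//.
    have := ler_wpM2l (nm_ge0 (p n u)) x1; lra.
  pose b := 1 - rc tau * p n u.
  have re_bs : m / 2 <= re b * re (s u) + im b * im (s u).
    have -> : re b * re (s u) + im b * im (s u) = re (s u)
       - tau * (re (p n u) * re (s u) + im (p n u) * im (s u)).
      by rewrite /b reB imB reM imM re1 im1 re_rc im_rc; ring.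
    have : re (p n u) * re (s u) + im (p n u) * im (s u) <= M' * M.
      have k1 : re (p n u) * re (s u) + im (p n u) * im (s u) =
        re (p n u * (Complex (re (s u)) (- im (s u)) : R[i])).
        by rewrite reM /= mulrN opprK.
      rewrite k1; apply: (le_trans (re_le _)); rewrite nmM.
      apply: ler_pM; rewrite ?nm_ge0//.
      suff -> : nm (Complex (re (s u)) (- im (s u)) : R[i]) = nm (s u) by [].
      by rewrite /nm /= sqrrN; case: (s u).
    move=> k2; have := ler_wpM2l (ltW tau0) k2; rewrite [M' * M]mulrC.
    move: tau1 h1; clear; lra.
  have bs2 : nm (b + rc tau * s u) <= 2.
    have k1 : nm (rc tau * p n u) <= tau * M'.
      by rewrite nmM nm_rc gtr0_norm// ler_wpM2l// ltW.
    have k2 : nm (rc tau * s u) <= tau * M.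
      by rewrite nmM nm_rc gtr0_norm// ler_wpM2l// ltW.
    apply: (le_trans (nmD _ _)); rewrite /b.
    have := nmB 1 (rc tau * p n u); rewrite nm1; lra.
  have bs_sq : nm (b - rc tau * s u) ^+ 2 = nm (b + rc tau * s u) ^+ 2
      - 4 * tau * (re b * re (s u) + im b * im (s u)).
    exact: nm_sqr_reflect.
  have bs0 : 0 < nm (b + rc tau * s u).
    rewrite -(ltr_pXn2r (n := 2)) ?nnegrE ?nm_ge0// expr0n /=.
    have := sqr_ge0 (nm (b - rc tau * s u)); rewrite bs_sq.
    have := ler_wpM2l (ltW tau0) re_bs; move: tm0; clear; lra.
  have bsn0 := nm_neq0 bs0.
  have ratio : nm (b - rc tau * s u) <= th1 * nm (b + rc tau * s u).
    have [th1a _] := andP th101.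
    rewrite -(ler_pXn2r (n := 2)) ?nnegrE ?mulr_ge0 ?nm_ge0// bs_sq exprMn.
    move: bs0 bs2; set N := nm (b + _) => bs0 bs2.
    have N4 : N ^+ 2 <= 4 by move: bs0 bs2; clear; nra.
    have k1 := ler_wpM2l (ltW tau0) re_bs.
    have -> : th1 ^+ 2 = 1 - tau * m / 2 + (tau * m) ^+ 2 / 16.
      by rewrite /th1; field.
    have k2 : tau * m * N ^+ 2 <= tau * m * 4 by rewrite ler_wpM2l// ltW.
    have k3 : 0 <= (tau * m) ^+ 2 / 16 * N ^+ 2.
      by apply: mulr_ge0; rewrite ?sqr_ge0//; apply: divr_ge0; rewrite ?sqr_ge0.
    move: k1 k2 k3; clear; lra.
  exists (x * ((b - rc tau * s u) / (b + rc tau * s u))).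
    rewrite nmM nm_div exprSr [leRHS]mulrA; apply: ler_pM; [exact: nm_ge0| |exact: hx|].
      by apply: divr_ge0; exact: nm_ge0.
    by rewrite ler_pdivrMr.
  have ep : p n u = s u * (1 + x) / (1 - x).
    by rewrite -ex mulfK.
  have -> : p n.+1 u = p n u + rc tau * (s u ^+ 2 - p n u ^+ 2) by rewrite hs.
  rewrite /b ep in bsn0 *; exact: sqrt_step.
apply: apx_lim => e e0.
have [n hn] := pow_small th101 (divr_gt0 (mulr_gt0 e0 t10) (mulr_gt0 (ltr0Sn R 1) M0)).
exists (p n) => // u Xu.
have [x hx ex] := inv n u Xu.
have xth : nm x <= th0.
  move/andP: th101 => [a /ltW b].
  by apply: (le_trans hx); rewrite ler_piMr// exprn_ile1.
have x1 : 1 - th0 <= nm (1 - x).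
  by have := nmBge 1 x; rewrite nm1; lra.
have x10 : 1 - x != 0 by apply: nm_neq0; lra.
have -> : p n u - s u = 2 * s u * x / (1 - x).
  have -> : p n u = s u * (1 + x) / (1 - x) by rewrite -ex mulfK.
  by field.
rewrite nm_div !nmM nm_nat ler_pdivrMr; last lra.
have hM1 := hM _ Xu.
have k1 : nm x <= th1 ^+ n.
  apply: (le_trans hx); rewrite ler_piMl ?exprn_ge0//; last exact: ltW.
  by case/andP: th101.
rewrite ler_pdivlMr ?mulr_gt0// in hn.
have k2 : nm (s u) * nm x <= M * th1 ^+ n.
  by apply: ler_pM; rewrite ?nm_ge0.
have k3 : e * (1 - th0) <= e * nm (1 - x) by rewrite ler_wpM2l// ltW.
move: hn k2 k3; clear; lra.
Qed.

(** The zero-free disc has any radius [r], unrelated to the bound [W] on [w]: this is how critical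
    points are kept far away. *)
Definition apxn (a : C -> C) := forall r e : R, 0 < e -> exists P : {poly C},
  (exists2 m, 0 < m & forall v, nm v <= r -> m <= nm P.[v]) /\
  forall u, X u -> nm (P.[w u] - a u) <= e.

Lemma apxn_apx a : apxn a -> apx a.
Proof. by move=> h e /(h 0)[P [_ hP]]; exists P. Qed.

Lemma apxn_ext a b : (forall u, X u -> a u = b u) -> apxn a -> apxn b.
Proof.
move=> ab h r e /(h r)[P [mP hP]]; exists P; split=> // u Xu.
by rewrite -ab// hP.
Qed.

Lemma apxnM a b : apxn a -> apxn b -> apxn (fun u => a u * b u).
Proof.
move=> ha hb r e e0.
have [A A0 hA] := apx_bounded (apxn_apx ha).
have [B B0 hB] := apx_bounded (apxn_apx hb).
have e2 : 0 < e / (2 * B) by rewrite divr_gt0// mulr_gt0.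
have [P [[m m0 mP] hP]] := ha r _ e2.
have p : 0 < A + e / (2 * B) by rewrite addr_gt0.
have e3 : 0 < e / (2 * (A + e / (2 * B))) by rewrite divr_gt0// mulr_gt0.
have [Q [[n n0 nQ] hQ]] := hb r _ e3.
exists (P * Q); split.
  exists (m * n); first by rewrite mulr_gt0.
  by move=> v hv; rewrite hornerM nmM ler_pM ?mP ?nQ// ltW.
move=> u Xu; rewrite hornerM.
have -> : P.[w u] * Q.[w u] - a u * b u =
   (P.[w u] - a u) * b u + P.[w u] * (Q.[w u] - b u) by ring.
apply: (le_trans (nmD _ _)); rewrite !nmM.
have h1 := ler_pM (nm_ge0 _) (nm_ge0 _) (hP _ Xu) (hB _ Xu).
have h2 : nm P.[w u] <= A + e / (2 * B).
  have := nmBge P.[w u] (a u); move: (hP _ Xu) (hA _ Xu); lra.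
have h3 := ler_pM (nm_ge0 _) (nm_ge0 _) h2 (hQ _ Xu).
apply: (le_trans (lerD h1 h3)).
have -> : e / (2 * B) * B = e / 2 by field; rewrite lt0r_neq0.
move: p; set k := A + _ => p.
have -> : k * (e / (2 * k)) = e / 2 by field; rewrite lt0r_neq0.
lra.
Qed.

(* [1 + x] is close to [(1 + P/N)^N], which has no zero on a given disc once
   [N] is large. *)
Lemma apx_near1 x (h r d : R) : 0 < h -> h <= 1 / 2 -> 0 < d -> apx x ->
  (forall u, X u -> nm (x u) <= h) ->
  exists P : {poly C}, (exists2 m, 0 < m & forall v, nm v <= r -> m <= nm P.[v]) /\
  forall u, X u -> nm (P.[w u] - (1 + x u)) <= 4 * h ^+ 2 + d.
Proof.
move=> h0 h1 d0 hx xh.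
have dd : 0 < Num.min d h by rewrite lt_min d0.
have [P hP] := hx _ dd.
have [B B0 hB] := poly_bounded P r.
have [N N0 hN] := nat_big (2 * B).
have Nr : 0 < N%:R :> R by rewrite ltr0n.
have NC : N%:R != 0 :> C by rewrite pnatr_eq0 -lt0n.
exists ((1 + (N%:R^-1)%:P * P) ^+ N); split.
  exists ((1 / 2) ^+ N); first by rewrite exprn_gt0//; lra.
  move=> v /hB hv; rewrite horner_exp !hornerE nmX.
  apply: lerXn2r; rewrite ?nnegrE ?nm_ge0 ?divr_ge0//.
  have := nmBge 1 (- (N%:R^-1 * P.[v])); rewrite opprK nm1 nmN nmM nmV nm_nat.
  have : N%:R^-1 * nm P.[v] <= 1 / 2.
    by rewrite ler_pdivrMl//; lra.
  lra.
move=> u Xu.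
have -> : ((1 + (N%:R^-1)%:P * P) ^+ N).[w u] = (1 + N%:R^-1 * P.[w u]) ^+ N.
  by rewrite horner_exp !hornerE.
have h2 := hP _ Xu; have h3 := xh _ Xu.
move: h2; rewrite le_min => /andP[h2 h4].
have hPu : nm P.[w u] <= 2 * h.
  have := nmBge P.[w u] (x u); lra.
have e1 : nm (N%:R^-1 * P.[w u]) = nm P.[w u] / N%:R.
  by rewrite nmM nmV nm_nat mulrC.
have b := @exp1_bound (N%:R^-1 * P.[w u]) N.
have e3 : N%:R * (nm P.[w u] / N%:R) = nm P.[w u].
  by field; rewrite lt0r_neq0.
have e4 : N%:R * (N%:R^-1 * P.[w u]) = P.[w u] by rewrite mulrA divff// mul1r.
rewrite e1 e3 e4 in b; have {}b := b ltac:(lra).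
have e2 : N%:R ^+ 2 * (nm P.[w u] / N%:R) ^+ 2 = nm P.[w u] ^+ 2.
  by field; rewrite lt0r_neq0.
rewrite e2 in b.
apply: (le_trans (nm_tri (1 + P.[w u]) _ _)).
have -> : 1 + P.[w u] - (1 + x u) = P.[w u] - x u by ring.
have p0 := nm_ge0 P.[w u].
have : nm P.[w u] ^+ 2 <= 4 * h ^+ 2 by move: hPu p0; nra.
move: b h2; lra.
Qed.

(** Deform [1] into [a] through [aj j = 1 + (j / J) * (a - 1)], inside the right half-plane.
    Consecutive ratios are [1 + O(1/J)], so [apx_near1] gives them zero-free approximations with
    error [O(1/J^2)]; the product of the [J] factors is off by [O(1/J)]. *)
Lemma apxn_rhp a (m : R) : 0 < m -> (forall u, X u -> m <= re (a u)) -> apx a -> apxn a.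
Proof.
move=> m0 hm ha r e e0; have [B B0 hB] := apx_bounded ha.
pose m' := Num.min m 1.
have m'0 : 0 < m' by rewrite lt_min m0 ltr01.
have [m'm m'1] : m' <= m /\ m' <= 1 by rewrite /m' !ge_min !lexx orbT.
pose K := (B + 1) / m'.
have K0 : 0 < K by rewrite divr_gt0//; lra.
have K1 : 1 <= K by rewrite /K ler_pdivlMr//; lra.
pose A := B + 1.
(* The choice makes [J * k0] at most [1/2] and the final error [2 * J * k0 * B] at most [e], for the
   relative error [k0] of one factor. *)
have [J J0 hJ] := nat_big (20 * K ^+ 2 * (1 + A / e)).
have Jr : 0 < J%:R :> R by rewrite ltr0n.
have Ae : 0 < A / e by rewrite divr_gt0 // /A; lra.
have K21 : 1 <= K ^+ 2 by move: K1; nra.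
have hJ1 : 20 * K ^+ 2 <= J%:R by move: hJ Ae K21; nra.
have hJ2 : 20 * K ^+ 2 * A <= e * J%:R.
  have : 20 * K ^+ 2 * (A / e) <= J%:R by move: hJ Ae K21; nra.
  by rewrite mulrA ler_pdivrMr// [_ * e]mulrC.
have JK : K / J%:R <= 1 / 2.
  rewrite ler_pdivrMr//; move: hJ1 K1; nra.
pose aj (j : nat) u : C := 1 + rc (j%:R / J%:R) * (a u - 1).
have tj j : (j <= J)%N -> 0 <= (j%:R / J%:R : R) <= 1.
  move=> jJ; apply/andP; split; first exact: divr_ge0.
  by rewrite ler_pdivrMr// mul1r ler_nat.
have raj j u : (j <= J)%N -> X u -> m' <= re (aj j u).
  pose t : R := j%:R / J%:R; move=> /tj /andP[]; rewrite -/t => t0 t1 /hm h.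
  rewrite /aj reD reM re1 re_rc im_rc mul0r subr0 reB re1.
  rewrite -/t; have t1' : 0 <= 1 - t by lra.
  have := ler_wpM2l t0 (le_trans m'm h); have := ler_wpM2l t1' m'1; clear; lra.
have naj j u : (j <= J)%N -> X u -> m' <= nm (aj j u).
  by move=> jJ Xu; apply: le_trans (raj _ _ jJ Xu) (re_le _).
have apxaj j : apx (aj j).
  apply: apxD; first exact: apx_cst.
  apply: apxM; first exact: apx_cst.
  by apply: apxB => //; exact: apx_cst.
pose x j u := (rc J%:R)^-1 * ((a u - 1) * (aj j u)^-1).
have apxx j : (j <= J)%N -> apx (x j).
  move=> jJ; apply: apxM; first exact: apx_cst.
  apply: apxM; first by apply: apxB => //; exact: apx_cst.
  by apply: (apx_inv (m := m')) => // u; exact: raj.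
have nx j u : (j <= J)%N -> X u -> nm (x j u) <= K / J%:R.
  move=> jJ Xu; rewrite /x !nmM nmV nm_rc ger0_norm// mulrC ler_wpM2r ?invr_ge0//.
  rewrite nmV /K; apply: ler_pM; rewrite ?nm_ge0 ?invr_ge0 ?nm_ge0//.
    by apply: (le_trans (nmB _ _)); rewrite nm1 lerD2r hB.
  rewrite lef_pV2 ?posrE//; first exact: naj.
  by apply: lt_le_trans (naj _ _ jJ Xu).
have Ja : rc (J%:R : R) != 0 by apply: nm_neq0; rewrite nm_rc ger0_norm.
have step j u : (j <= J)%N -> X u -> aj j u * (1 + x j u) = aj j.+1 u.
  move=> jJ Xu; have n0 : aj j u != 0.
    by apply: nm_neq0; apply: lt_le_trans (naj _ _ jJ Xu).
  have -> : aj j u * (1 + x j u) = aj j u + (rc J%:R)^-1 * (a u - 1).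
    rewrite /x; move: n0 Ja; move: (aj j u) (rc J%:R) (a u) => p q s p0 q0; field.
    by rewrite p0 q0.
  rewrite /aj -natr1 mulrDl rcD rcM mul1r rcV; ring.
(* [apx_near1] has error [5 * (K / J) ^ 2]; dividing by [nm (1 + x j u) >= 1/2] doubles it. *)
pose k0 := 10 * K ^+ 2 / J%:R ^+ 2.
have Jk0 : J%:R * k0 = 10 * K ^+ 2 / J%:R by rewrite /k0; field; rewrite lt0r_neq0.
have Jk0' : J%:R * k0 <= 1 / 2 by rewrite Jk0 ler_pdivrMr//; lra.
have k00 : 0 < k0.
  by apply: divr_gt0; rewrite ?exprn_gt0//; apply: mulr_gt0; rewrite ?exprn_gt0.
have main j : (j <= J)%N -> exists P : {poly C},
  (exists2 m, 0 < m & forall v, nm v <= r -> m <= nm P.[v]) /\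
  forall u, X u -> nm (P.[w u] - aj j u) <= 2 * j%:R * k0 * nm (aj j u).
  elim: j => [|j IH] jJ.
    exists 1; split; first by exists 1 => // v _; rewrite hornerC nm1.
    move=> u _; have -> : aj 0%N u = 1 by rewrite /aj mul0r rc0 mul0r addr0.
    by rewrite hornerC subrr nm0 mulr0 mul0r mul0r.
  have jJ' := ltnW jJ.
  have [P [[mP mP0 hmP] hP]] := IH jJ'.
  have KJ0 : 0 < K / J%:R by rewrite divr_gt0.
  have KJ2 : 0 < (K / J%:R) ^+ 2 by rewrite exprn_gt0.
  have [Q [[mQ mQ0 hmQ] hQ]] := apx_near1 r KJ0 JK KJ2 (apxx j jJ') (fun u => @nx j u jJ').
  exists (P * Q); split.
    exists (mP * mQ); first by rewrite mulr_gt0.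
    by move=> v hv; rewrite hornerM nmM ler_pM ?hmP ?hmQ// ltW.
  move=> u Xu; rewrite hornerM.
  have nf : 1 / 2 <= nm (1 + x j u).
    have := nmBge 1 (- x j u); rewrite opprK nmN nm1.
    have := nx _ _ jJ' Xu; move: JK; clear; lra.
  have hQ' : nm (Q.[w u] - (1 + x j u)) <= k0 * nm (1 + x j u).
    apply: (le_trans (hQ _ Xu)).
    have -> : k0 = 10 * (K / J%:R) ^+ 2 by rewrite /k0; field; rewrite lt0r_neq0.
    move: nf KJ2; clear; nra.
  rewrite -step//.
  have -> : P.[w u] * Q.[w u] - aj j u * (1 + x j u) =
     (P.[w u] - aj j u) * Q.[w u] + aj j u * (Q.[w u] - (1 + x j u)) by ring.
  apply: (le_trans (nmD _ _)); rewrite !nmM.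
  have hQn : nm Q.[w u] <= (1 + k0) * nm (1 + x j u).
    have := nmBge Q.[w u] (1 + x j u); lra.
  have k1 := ler_pM (nm_ge0 _) (nm_ge0 _) (hP _ Xu) hQn.
  have k2 := ler_wpM2l (nm_ge0 (aj j u)) hQ'.
  apply: (le_trans (lerD k1 k2)).
  have jk : j%:R * k0 <= 1 / 2.
    by apply: le_trans Jk0'; rewrite ler_wpM2r ?ler_nat// ltW.
  have q0 : 0 <= nm (aj j u) * nm (1 + x j u) by rewrite mulr_ge0 ?nm_ge0.
  move: q0; set q := nm (aj j u) * nm (1 + x j u) => q0.
  have -> : 2 * j%:R * k0 * nm (aj j u) * ((1 + k0) * nm (1 + x j u)) +
     nm (aj j u) * (k0 * nm (1 + x j u)) = (2 * (j%:R * k0) * (1 + k0) + k0) * q.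
    by rewrite /q; ring.
  rewrite -natr1 ler_wpM2r//.
  move: jk k00; clear; nra.
have [P [mP hP]] := main J (leqnn J).
exists P; split=> // u Xu.
have ajJ : aj J u = a u by rewrite /aj divff ?lt0r_neq0// rc1 mul1r addrC subrK.
have := hP _ Xu; rewrite ajJ -[2 * _ * k0]mulrA Jk0 => /le_trans; apply.
apply: (le_trans (ler_wpM2l _ (hB _ Xu))).
  by rewrite mulr_ge0// divr_ge0// mulr_ge0// sqr_ge0.
rewrite mulrA mulrAC ler_pdivrMr// mulrA.
move: hJ2; rewrite /A; have : 0 <= K ^+ 2 by exact: sqr_ge0.
clear; lra.
Qed.

End Approx.

(** * The slit map *)

Section Roots.
Variable R : realType.
Local Notation C := (Cx R).
Implicit Types x y z : C.

Definition psqrt z : C := let r : C := sqrtc (z : R[i]) in if 0 <= re r then r else - r.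

Lemma psqrtK z : psqrt z ^+ 2 = z.
Proof.
have h : (sqrtc (z : R[i]) : C) ^+ 2 = z by exact: sqr_sqrtc.
by rewrite /psqrt; case: ifP => _; rewrite ?sqrrN.
Qed.

Lemma re_psqrt_ge0 z : 0 <= re (psqrt z).
Proof.
rewrite /psqrt; case: ifP => // /negbT; rewrite -ltNge reN oppr_ge0; exact: ltW.
Qed.

Lemma re_sqr z : re (z ^+ 2) = re z ^+ 2 - im z ^+ 2.
Proof. by rewrite expr2 reM -!expr2. Qed.
Lemma im_sqr z : im (z ^+ 2) = 2 * re z * im z.
Proof. by rewrite expr2 imM; ring. Qed.

(** A square root with real part zero has a real nonpositive square, so only the cut is excluded. *)
Lemma re_psqrt_gt0 z : (im z = 0 -> 0 < re z) -> 0 < re (psqrt z).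
Proof.
move=> h; rewrite lt_neqAle re_psqrt_ge0 andbT; apply/eqP => e.
have e1 := re_sqr (psqrt z); have e2 := im_sqr (psqrt z).
rewrite psqrtK -e mulr0 mul0r in e2; rewrite psqrtK -e expr0n sub0r in e1.
by have := h e2; rewrite e1 oppr_gt0 ltNge sqr_ge0.
Qed.

Lemma psqrt_re_gt0 z : 0 < re z -> 0 < re (psqrt z).
Proof. by move=> h; apply: re_psqrt_gt0. Qed.

Lemma psqrt_uniq r : 0 < re r -> psqrt (r ^+ 2) = r.
Proof.
move=> r0; have := psqrtK (r ^+ 2); move/eqP; rewrite eqf_sqr => /orP[/eqP//|/eqP e].
by have := re_psqrt_ge0 (r ^+ 2); rewrite e reN oppr_ge0 leNgt r0.
Qed.

Lemma psqrt_rc (a : R) : 0 < a -> psqrt (rc a) = rc (Num.sqrt a).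
Proof.
move=> a0; have -> : rc a = rc (Num.sqrt a) ^+ 2 by rewrite -rcX sqr_sqrtr// ltW.
by apply: psqrt_uniq; rewrite re_rc sqrtr_gt0.
Qed.

Lemma re_psqrt_ge (m : R) z : 0 < m -> m <= re z -> Num.sqrt m <= re (psqrt z).
Proof.
move=> m0 mz; rewrite -(ler_pXn2r (n := 2)) ?nnegrE ?sqrtr_ge0 ?re_psqrt_ge0//.
rewrite sqr_sqrtr ?(ltW m0)//; apply: (le_trans mz).
by rewrite -{1}(psqrtK z) re_sqr gerBl sqr_ge0.
Qed.

Definition near_pos (s : C -> C) z := exists2 d : R, 0 < d & forall x, nm (x - z) < d -> 0 < re (s x).

Lemma hasd_near_pos f z l : hasd f z l -> 0 < re (f z) -> near_pos f z.
Proof.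
move=> h p; have [d d0 hd] := hasd_cont h (divr_gt0 p (ltr0Sn R 1)).
exists d => // x /hd hx; have := le_trans (le_re _) hx.
rewrite reB ler_norml => /andP[]; lra.
Qed.

(** Continuity of [s] comes from [(s x - s z) * (s x + s z) = F x - F z], whose second factor has
    modulus at least [re (s z)]; then [hasd_branch] applies. *)
Lemma hasd_sqrt (s F : C -> C) z l : near_pos s z -> (forall x, s x ^+ 2 = F x) ->
  hasd F z l -> hasd s z (l / (2 * s z)).
Proof.
move=> [d d0 hd] sF hF.
have pz : 0 < re (s z) by apply: hd; rewrite subrr nm0.
have sz0 : s z != 0 by apply: nm_neq0; apply: lt_le_trans (re_le _).
have hF' : hasd (fun x => s x ^+ 2) z l by apply: hasd_ext hF => // x _; rewrite sF.
have h2 : hasd (fun x : C => x ^+ 2) (s z) (2 * s z).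
  by have := hasd_exp (s z) 2; congr hasd; rewrite /= expr1 mulr_natl.
have n2 : 2 * s z != 0 by rewrite mulf_neq0 ?pnatr_eq0.
apply: (@hasd_branch R s (fun x : C => x ^+ 2) z l (2 * s z) _ h2 n2 hF').
move=> e e0.
have [d' d'0 hd'] := hasd_cont hF (mulr_gt0 e0 pz).
exists (Num.min d d'); first by rewrite lt_min d0.
move=> x; rewrite lt_min => /andP[/hd px /hd'].
rewrite -!sF subr_sqr nmM.
have h : re (s z) <= nm (s x + s z).
  by apply: le_trans (re_le _); rewrite reD lerDr ltW.
move=> h'; rewrite -(ler_pM2r pz); apply: le_trans h'.
by rewrite ler_wpM2l ?nm_ge0.
Qed.

(** Iterated square roots keep the real part positive, so no branch has to be followed: the reason
    for orders that are powers of two. *)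
Definition proot k z : C := iter k psqrt z.

Lemma proot_pos k z : 0 < re z -> 0 < re (proot k z).
Proof. by move=> z0; elim: k => // k IH; apply: psqrt_re_gt0. Qed.

Lemma prootK k z : proot k z ^+ (2 ^ k) = z.
Proof. by elim: k => // k IH; rewrite expnS exprM [proot _ _]/(psqrt _) psqrtK. Qed.

Lemma proot_rc k (a : R) : 0 < a -> exists2 b, 0 < b & proot k (rc a) = rc b.
Proof.
move=> a0; elim: k => [|k [b b0 IH]]; first by exists a.
by exists (Num.sqrt b); rewrite ?sqrtr_gt0// /proot iterS -/(proot k _) IH psqrt_rc.
Qed.

Lemma hasd_proot k (F : C -> C) z l : hasd F z l -> 0 < re (F z) ->
  hasd (fun x => proot k (F x)) z (proot k (F z) * l / ((2 ^ k)%:R * F z)).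
Proof.
move=> hF p.
have Fz0 : F z != 0 by apply: nm_neq0; apply: lt_le_trans (re_le _).
elim: k => [|k IH].
  by have := hF; congr hasd; rewrite expn0 mul1r mulrAC divff// mul1r.
have IHp := proot_pos k p.
have np := hasd_near_pos IH IHp.
have : near_pos (fun x => psqrt (proot k (F x))) z.
  by case: np => d d0 hd; exists d => // x /hd; exact: psqrt_re_gt0.
move=> /hasd_sqrt /(_ (fun x => psqrtK _) IH).
congr hasd; rewrite /proot iterS -/(proot k (F z)).
have q0 : psqrt (proot k (F z)) != 0.
  by apply: nm_neq0; apply: lt_le_trans (psqrt_re_gt0 IHp) (re_le _).
have n0 : (2 ^ k)%:R != 0 :> C by rewrite pnatr_eq0 expn_eq0.
rewrite -{1}(psqrtK (proot k (F z))) expnS natrM; move: q0 n0 Fz0.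
move: (psqrt _) => a; move: ((2 ^ k)%:R : C) (F z) => b c a0 b0 c0.
by field; rewrite a0 b0 c0.
Qed.

End Roots.

(** * The Cayley transform between disc and right half-plane *)

Section Cayley.
Variable R : realType.
Local Notation C := (Cx R).
Implicit Types u s w : C.

Definition cayley u : C := (1 + u) / (1 - u).
Definition cayley_inv s : C := (s - 1) / (s + 1).

Lemma cayley_den u : nm u < 1 -> 1 - u != 0.
Proof.
move=> h; apply: nm_neq0; have := nmBge 1 u; rewrite nm1; lra.
Qed.
Lemma cayley_inv_den s : 0 < re s -> s + 1 != 0.
Proof.
move=> h; apply: nm_neq0; apply: lt_le_trans (re_le _).
by rewrite reD re1 ltr_wpDl// ltW.
Qed.
Lemma cayleyK u : nm u < 1 -> cayley_inv (cayley u) = u.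
Proof.
move=> h; have u1 := cayley_den h; rewrite /cayley_inv /cayley; field; rewrite u1 /=.
have -> : 1 + u + (1 - u) = 2 by ring.
by rewrite pnatr_eq0.
Qed.
Lemma cayley_invK s : 0 < re s -> cayley (cayley_inv s) = s.
Proof.
move=> h; have u1 := cayley_inv_den h; rewrite /cayley_inv /cayley; field; rewrite u1 /=.
have -> : s + 1 - (s - 1) = 2 by ring.
by rewrite pnatr_eq0.
Qed.
Lemma cayley_re u : nm u < 1 -> re (cayley u) = (1 - nm u ^+ 2) / nm (1 - u) ^+ 2.
Proof.
move=> h; have u1 := cayley_den h.
have p := nm_gt0 u1.
have E : cayley u * (1 - u) = 1 + u by rewrite /cayley divfK.
have := congr1 (@re R) E; have := congr1 (@im R) E.
rewrite reM imM reB imB reD imD re1 im1 => e1 e2.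
apply: (mulIf (lt0r_neq0 (exprn_gt0 2 p))); rewrite divfK; last first.
  by rewrite lt0r_neq0 ?exprn_gt0.
rewrite !nm_sqr reB imB re1 im1.
move: e1 e2; set a := re (cayley u); set b := im (cayley u).
move=> e1 e2.
have -> : 1 - (re u ^+ 2 + im u ^+ 2) = (1 + re u) * (1 - re u) - (0 + im u) * im u by ring.
rewrite -e1 -e2; ring.
Qed.
Lemma cayley_re_gt0 u : nm u < 1 -> 0 < re (cayley u).
Proof.
move=> h; rewrite cayley_re//; have p := nm_gt0 (cayley_den h).
rewrite divr_gt0 ?exprn_gt0// subr_gt0 expr_lt1 ?nm_ge0//.
Qed.
Lemma cayley_inv_nm s : 0 < re s -> nm (cayley_inv s) < 1.
Proof.
move=> h; have p := nm_gt0 (cayley_inv_den h); rewrite nm_div ltr_pdivrMr// mul1r nm_lt_sqr.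
rewrite reB imB reD imD re1 im1; move: h; lra.
Qed.
Lemma cayley_re_ge u (r : R) : r < 1 -> nm u <= r -> (1 - r ^+ 2) / 4 <= re (cayley u).
Proof.
move=> r1 ur; have u1 : nm u < 1 by apply: le_lt_trans r1.
have u0 := nm_ge0 u.
have p := nm_gt0 (cayley_den u1).
rewrite cayley_re// ler_pM ?invr_ge0// ?subr_ge0.
- by rewrite expr_le1//; lra.
- by rewrite lerD2l lerN2 ler_pXn2r ?nnegrE//; lra.
rewrite lef_pV2 ?posrE ?exprn_gt0//.
have : nm (1 - u) <= 2 by apply: (le_trans (nmB _ _)); rewrite nm1; lra.
move: p; set x := nm _; nra.
Qed.
Lemma cayley_nm_le u (r : R) : r < 1 -> nm u <= r -> nm (cayley u) <= 2 / (1 - r).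
Proof.
move=> r1 ur; have u1 : nm u < 1 by apply: le_lt_trans r1.
have p := nm_gt0 (cayley_den u1).
rewrite nm_div ler_pM ?nm_ge0 ?invr_ge0//.
- by apply: ltW.
- by apply: (le_trans (nmD _ _)); rewrite nm1; lra.
rewrite lef_pV2 ?posrE//; last lra.
have := nmBge 1 u; rewrite nm1; lra.
Qed.

(* In the half-plane coordinate the slit map [k(w) = p^2 k(u)], [k] the Koebe
   function, reads [S^2 - 1 = p^2 (s^2 - 1)]. *)
Definition slit_hp (p : R) s : C := psqrt (rc (1 - p ^+ 2) + rc (p ^+ 2) * s ^+ 2).

Lemma slit_hpK p s : slit_hp p s ^+ 2 = rc (1 - p ^+ 2) + rc (p ^+ 2) * s ^+ 2.
Proof. exact: psqrtK. Qed.

Lemma slit_hp_gt0 (p : R) s : 0 < p < 1 -> 0 < re s -> 0 < re (slit_hp p s).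
Proof.
move=> /andP[p0 p1] s0; apply: re_psqrt_gt0.
rewrite imD reD imM reM re_sqr im_sqr !re_rc !im_rc add0r !mul0r addr0 subr0.
have pp : 0 < p ^+ 2 by rewrite exprn_gt0.
have p2 : p ^+ 2 < 1 by rewrite expr_lt1// ltW.
move=> /eqP; rewrite mulf_eq0 (gt_eqF pp) /= mulf_eq0 mulf_eq0 pnatr_eq0 /= (gt_eqF s0) /=.
move=> /eqP ->; rewrite expr0n subr0.
have := mulr_gt0 pp (exprn_gt0 2 s0); lra.
Qed.

(** For [S = slit_hp p s]: if [re S < p * re s], the imaginary part of [S ^ 2] forces
    [(im S) ^ 2 >= (p * im s) ^ 2]; then [re (S ^ 2) < re (p ^ 2 * s ^ 2)], against the added term
    [1 - p ^ 2 > 0]. *)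
Lemma slit_hp_ge (p : R) s : 0 < p < 1 -> 0 < re s -> p * re s <= re (slit_hp p s).
Proof.
move=> pp s0; have S0 := slit_hp_gt0 pp s0.
have e1 := congr1 (@re R) (slit_hpK p s); have e2 := congr1 (@im R) (slit_hpK p s).
rewrite reD reM !re_sqr !re_rc im_rc mul0r subr0 in e1.
rewrite imD imM !im_sqr !im_rc re_rc mul0r addr0 add0r in e2.
case/andP: pp => p0 p1.
rewrite leNgt; apply/negP => lt.
move: e1 e2 lt S0; set a := re (slit_hp p s); set b := im (slit_hp p s).
set x := re s in s0 *; set y := im s => e1 e2 lt S0.
have ab : a * b = p ^+ 2 * (x * y) by move: e2; lra.
have ab2 : a ^+ 2 * b ^+ 2 = (p * x) ^+ 2 * (p * y) ^+ 2.
  by rewrite -exprMn ab; ring.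
have a2 : a ^+ 2 < (p * x) ^+ 2 by rewrite ltr_pXn2r ?nnegrE//; lra.
have a20 : 0 < a ^+ 2 by rewrite exprn_gt0.
have b2 : (p * y) ^+ 2 <= b ^+ 2.
  have : a ^+ 2 * (p * y) ^+ 2 <= a ^+ 2 * b ^+ 2.
    by rewrite ab2 ler_wpM2r ?sqr_ge0// ltW.
  by rewrite ler_pM2l.
have : a ^+ 2 - b ^+ 2 = 1 - p ^+ 2 + (p * x) ^+ 2 - (p * y) ^+ 2 by rewrite e1; ring.
have : p ^+ 2 < 1 by rewrite expr_lt1// ltW.
lra.
Qed.

End Cayley.

(** * The conformal map onto the slit disc *)

Section SlitMap.
Variable R : realType.
Local Notation C := (Cx R).
Variables (k : nat) (tau : R).
Hypothesis tau01 : 0 < tau < 1.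
Local Notation q := (2 ^ k.+1)%N.
Local Notation p := (tau ^+ (2 ^ k)).
Implicit Types y v : C.

(* [slit] maps the disc onto the disc cut along the [q] radial slits from modulus
   about [tau] to [1] on which [v ^+ q < 0]; [src] and [tgt] are the half-plane
   coordinates of [y ^+ q] and of [slit_pow y = slit y ^+ q]. *)
Definition src y : C := cayley (y ^+ q).
Definition tgt y : C := slit_hp p (src y).
(** A single-valued root of order [q = 2 * 2 ^ k] of the factor [tau ^ q * ((1 + src y) / (1 + tgt
    y)) ^ 2] from [y ^ q] to [slit_pow y]: the square absorbs one factor 2 and [proot k] the
    others. *)
Definition slit_quo y : C := rc tau * (proot k (1 + src y) / proot k (1 + tgt y)).
Definition slit y : C := y * slit_quo y.
Definition slit_pow y : C := cayley_inv (tgt y).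

Lemma slit_powE y : slit_pow y = cayley_inv (tgt y). Proof. by []. Qed.
Lemma slit_quoE y : slit_quo y = rc tau * (proot k (1 + src y) / proot k (1 + tgt y)).
Proof. by []. Qed.

Let q0 : (0 < q)%N. Proof. by rewrite expn_gt0. Qed.

Lemma p01 : 0 < p < 1.
Proof.
case/andP: tau01 => t0 t1.
by rewrite exprn_gt0//= exprn_ilt1 ?ltW// -lt0n expn_gt0.
Qed.

Lemma p_sqr : p ^+ 2 = tau ^+ q.
Proof. by rewrite -exprM expnSr. Qed.

Lemma nmq y : nm y < 1 -> nm (y ^+ q) < 1.
Proof. by move=> y1; rewrite nmX exprn_ilt1 ?nm_ge0// -lt0n. Qed.

Lemma nmq_le y (r : R) : nm y <= r -> r < 1 -> nm (y ^+ q) <= r.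
Proof.
move=> yr r1; rewrite nmX; apply: (le_trans _ yr).
have : nm y ^+ q <= nm y ^+ 1 by apply: ler_wiXn2l; rewrite ?nm_ge0 ?q0//; lra.
by rewrite expr1.
Qed.

Lemma src_gt0 y : nm y < 1 -> 0 < re (src y).
Proof. by move=> /nmq; exact: cayley_re_gt0. Qed.

Lemma tgt_gt0 y : nm y < 1 -> 0 < re (tgt y).
Proof. by move=> /src_gt0; apply: slit_hp_gt0; exact: p01. Qed.

Lemma re1_gt0 (z : C) : 0 < re z -> 0 < re (1 + z).
Proof. by move=> h; rewrite reD re1 ltr_wpDl. Qed.

Lemma re_gt0_neq0 (z : C) : 0 < re z -> z != 0.
Proof. by move=> h; apply: nm_neq0; apply: lt_le_trans (re_le _). Qed.

Lemma proot2 z : proot k z ^+ q = z ^+ 2 :> C.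
Proof. by rewrite expnSr exprM prootK. Qed.

Lemma tgt_sqr y : tgt y ^+ 2 - 1 = rc tau ^+ q * (src y ^+ 2 - 1).
Proof. by rewrite /tgt slit_hpK p_sqr rcB rc1 rcX; ring. Qed.

Lemma slit_quoq y : slit_quo y ^+ q = rc tau ^+ q * ((1 + src y) / (1 + tgt y)) ^+ 2.
Proof. by rewrite /slit_quo exprMn expr_div_n !proot2 expr_div_n. Qed.

Lemma slitq y : nm y < 1 -> slit y ^+ q = slit_pow y.
Proof.
move=> y1; have s0 := src_gt0 y1; have S0 := tgt_gt0 y1.
have s1 := re_gt0_neq0 (re1_gt0 s0); have S1 := re_gt0_neq0 (re1_gt0 S0).
rewrite /slit exprMn slit_quoq.
have -> : y ^+ q = (src y - 1) / (1 + src y).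
  by rewrite -[LHS](cayleyK (nmq y1)) /cayley_inv [_ + 1]addrC.
have -> : (src y - 1) / (1 + src y) * (rc tau ^+ q * ((1 + src y) / (1 + tgt y)) ^+ 2) =
  rc tau ^+ q * (src y ^+ 2 - 1) / (1 + tgt y) ^+ 2.
  move: s1 S1; move: (src y) (tgt y) => a b a0 b0; field; by rewrite a0 b0.
rewrite -tgt_sqr /slit_pow /cayley_inv [_ + 1]addrC.
by move: S1; move: (tgt y) => a a0; field.
Qed.

Lemma slit_pow_lt1 y : nm y < 1 -> nm (slit_pow y) < 1.
Proof. by move=> /tgt_gt0; exact: cayley_inv_nm. Qed.

Lemma slit_lt1 y : nm y < 1 -> nm (slit y) < 1.
Proof.
move=> y1; have := slit_pow_lt1 y1; rewrite -slitq// nmX.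
by rewrite expr_lt1 ?nm_ge0 ?q0.
Qed.

Lemma slit0 : slit 0 = 0. Proof. by rewrite /slit mul0r. Qed.

Lemma slit_rot l y : l ^+ q = 1 -> slit (l * y) = l * slit y.
Proof. by move=> lq; rewrite /slit /slit_quo /tgt /src exprMn lq mul1r -mulrA. Qed.

Lemma hasd_src y : nm y < 1 -> hasd src y ((2 * (y ^+ q.-1 *+ q)) / (1 - y ^+ q) ^+ 2).
Proof.
move=> y1; have h := hasd_exp y q.
have d := cayley_den (nmq y1).
have := hasd_div _ (hasdD (hasd_cst y 1) h) (hasdB (hasd_cst y 1) h).
move=> /(_ d).
by congr hasd; congr (_ / _); ring.
Qed.

Lemma hasd_tgt y l : nm y < 1 -> hasd src y l ->
  hasd tgt y (rc (p ^+ 2) * src y * l / tgt y).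
Proof.
move=> y1 h.
have hF : hasd (fun x => rc (1 - p ^+ 2) + rc (p ^+ 2) * src x ^+ 2) y
    (0 + rc (p ^+ 2) * ((src y ^+ 1 *+ 2) * l)).
  by apply: hasdD (hasd_cst _ _) (hasdMl _ (hasd_comp h (hasd_exp _ 2))).
have np : near_pos tgt y.
  exists (1 - nm y); first lra.
  move=> x hx; apply: tgt_gt0.
  have := nmBge x y; lra.
have := hasd_sqrt np (fun x => slit_hpK p (src x)) hF.
congr hasd; have S0 := re_gt0_neq0 (tgt_gt0 y1).
by rewrite expr1 -mulr_natl add0r; move: S0; move: (tgt y) => a a0; field.
Qed.

(** The derivative collapses to a product because [y * src' = 2 ^ k * (src ^ 2 - 1)] and
    [p ^ 2 * (src ^ 2 - 1) = tgt ^ 2 - 1]. The product form is what permits a zero-free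
    approximation of its inverse. *)
Lemma hasd_slit y : nm y < 1 -> hasd slit y (slit_quo y * src y / tgt y).
Proof.
move=> y1; have hs' := hasd_src y1; move: hs'; set l := _ / _ ^+ 2 => hs'.
have hS := hasd_tgt y1 hs'.
have s0 := src_gt0 y1; have S0 := tgt_gt0 y1.
have s1 := re1_gt0 s0; have S1 := re1_gt0 S0.
have r1 := hasd_proot k (hasdD (hasd_cst y 1) hs') s1.
have r2 := hasd_proot k (hasdD (hasd_cst y 1) hS) S1.
have rn := re_gt0_neq0 (proot_pos k S1).
have rs := re_gt0_neq0 (proot_pos k s1).
have hb' := hasd_div _ r1 r2; have hb := hasdMl (rc tau) (hb' rn).
have := hasdM (hasd_id y) hb.
congr hasd.
have sn := re_gt0_neq0 s0; have Sn := re_gt0_neq0 S0.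
have s1n := re_gt0_neq0 s1; have S1n := re_gt0_neq0 S1.
have n0 : (2 ^ k)%:R != 0 :> C by rewrite pnatr_eq0 expn_eq0.
have yl : y * l = (2 ^ k)%:R * (src y ^+ 2 - 1).
  have d := cayley_den (nmq y1).
  have -> : src y ^+ 2 - 1 = 4 * y ^+ q / (1 - y ^+ q) ^+ 2.
    by rewrite /src /cayley; move: (y ^+ q) d => u d; field.
  rewrite /l !mulrA [_ * (_ *+ q)]mulrC -[y ^+ q.-1 *+ q]mulr_natl -!mulrA; move: d.
  have -> : y ^+ q = y ^+ q.-1 * y by rewrite -exprSr prednK.
  have -> : (q%:R : C) = 2 * (2 ^ k)%:R by rewrite expnS natrM.
  by move=> d; field.
have pp : (rc (p ^+ 2) : C) * (src y ^+ 2 - 1) = tgt y ^+ 2 - 1.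
  by rewrite tgt_sqr p_sqr rcX.
rewrite /slit_quo; move: pp yl sn Sn s1n S1n n0 rn rs.
move: (proot k (1 + src y)) (proot k (1 + tgt y)) => A B.
move: (src y) (tgt y) (rc (p ^+ 2)) ((2 ^ k)%:R : C) (rc tau) => s S t n ta.
move=> pp yl sn Sn s1' S1' n0 B0 A0.
rewrite mul1r !add0r.
have -> : y * (ta * ((A * l / (n * (1 + s)) * B - A * (B * (t * s * l / S) / (n * (1 + S)))) / B ^+ 2))
  = ta * (A / B) * ((y * l / n) / (1 + s) - s * t * (y * l / n) / (S * (1 + S))).
  by field; rewrite ?n0 ?s1' ?S1' ?B0 ?Sn.
rewrite yl.
have -> : n * (s ^+ 2 - 1) / n = (s ^+ 2 - 1) by rewrite mulrAC divff// mul1r.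
rewrite -[s * t * _]mulrA pp.
by field; rewrite ?n0 ?s1' ?S1' ?B0 ?Sn.
Qed.

Lemma cayley_inv_ratio (t a c : C) : c ^+ 2 - 1 = t * (a ^+ 2 - 1) ->
  1 + a != 0 -> 1 + c != 0 -> t != 0 ->
  cayley_inv c / (t * ((1 + a) / (1 + c)) ^+ 2) = cayley_inv a.
Proof.
move=> Ss a0 c0 t0; rewrite /cayley_inv.
have -> : (c - 1) / (c + 1) = (c ^+ 2 - 1) / (1 + c) ^+ 2 by field; rewrite ?[c + 1]addrC ?c0.
by rewrite Ss; field; rewrite ?[a + 1]addrC ?t0 ?a0 ?c0.
Qed.

(** The hypothesis excludes the whole radii where [v ^ q < 0], not only the slits; they are null
    sets all the same. The preimage is found by solving the half-plane equation for [T = s ^ 2]. *)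
Lemma slit_surj v : nm v < 1 -> (im (v ^+ q) = 0 -> 0 <= re (v ^+ q)) ->
  exists y, nm y < 1 /\ slit y = v.
Proof.
move=> v1 hv; have w1 := nmq v1.
pose S := cayley (v ^+ q).
have S0 : 0 < re S by exact: cayley_re_gt0.
have pp := p01; case/andP: (pp) => pp0 pp1.
pose T := (S ^+ 2 - rc (1 - p ^+ 2)) / rc (p ^+ 2).
have p20 : 0 < p ^+ 2 by rewrite exprn_gt0.
have pn : rc (p ^+ 2) != 0 :> C by apply: nm_neq0; rewrite nm_rc gtr0_norm.
have TS : rc (p ^+ 2) * T = S ^+ 2 - rc (1 - p ^+ 2) by rewrite /T mulrC divfK.
(* A real [T] forces [S] and then [v ^ q] to be real; the hypothesis gives [S >= 1], hence
   [p ^ 2 * T = S ^ 2 - 1 + p ^ 2 > 0]. *)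
have sT : 0 < re (psqrt T).
  apply: re_psqrt_gt0 => T0.
  have := congr1 (@im R) TS; have := congr1 (@re R) TS.
  rewrite reB reM imB imM re_sqr im_sqr T0 !re_rc !im_rc !(mulr0, mul0r) !subr0 add0r.
  move=> e1 /esym/eqP; rewrite !mulf_eq0 pnatr_eq0 (gt_eqF S0) /= => /eqP S00.
  rewrite S00 expr0n subr0 in e1.
  have ws : v ^+ q = cayley_inv S by rewrite /S cayleyK.
  have Sr : S = rc (re S) by apply: ceq => //; rewrite S00.
  have yr : cayley_inv S = rc ((re S - 1) / (re S + 1)).
    by rewrite {1}Sr /cayley_inv rcM rcV rcB rcD rc1.
  have := hv; rewrite ws yr im_rc re_rc => /(_ erefl).
  rewrite ler_pdivlMr ?mul0r; last lra.
  move=> S1; have S2 : 1 <= re S ^+ 2 by move: S1; nra.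
  have : 0 < p ^+ 2 * re T by rewrite e1; lra.
  by rewrite pmulr_rgt0.
pose s := psqrt T.
pose b := rc tau * (proot k (1 + s) / proot k (1 + S)).
have s1 := re1_gt0 sT; have S1 := re1_gt0 S0.
have s1n := re_gt0_neq0 s1; have S1n := re_gt0_neq0 S1.
have tn : rc tau != 0 :> C.
  by apply: nm_neq0; case/andP: tau01 => t0 _; rewrite nm_rc gtr0_norm.
have b0 : b != 0.
  rewrite /b mulf_neq0// mulf_neq0 ?invr_eq0//; apply: re_gt0_neq0; exact: proot_pos.
have bq : b ^+ q = rc tau ^+ q * ((1 + s) / (1 + S)) ^+ 2.
  by rewrite /b exprMn expr_div_n !proot2 expr_div_n.
have Ss : S ^+ 2 - 1 = rc tau ^+ q * (s ^+ 2 - 1).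
  have := TS; rewrite -{1}(psqrtK T) -/s rcB rc1 p_sqr rcX => e.
  have -> : S ^+ 2 = rc tau ^+ q * s ^+ 2 + (1 - rc tau ^+ q) by rewrite e; ring.
  ring.
pose y := v / b.
have yq : y ^+ q = cayley_inv s.
  rewrite /y expr_div_n bq.
  have -> : v ^+ q = cayley_inv S by rewrite /S cayleyK.
  have tqn : rc tau ^+ q != 0 by rewrite expf_neq0.
  exact: cayley_inv_ratio.
have y1 : nm y < 1.
  by have := cayley_inv_nm sT; rewrite -/s -yq nmX expr_lt1 ?nm_ge0 ?q0.
exists y; split=> //.
have sy : src y = s by rewrite /src yq cayley_invK.
have Sy : tgt y = S.
  rewrite /tgt sy /slit_hp.
  have -> : rc (1 - p ^+ 2) + rc (p ^+ 2) * s ^+ 2 = S ^+ 2.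
    by rewrite /s psqrtK TS addrC subrK.
  exact: psqrt_uniq.
by rewrite /slit /slit_quo sy Sy -/b /y divfK.
Qed.

Lemma slit_real (x : R) : -1 < x < 1 -> forall y, nm y < 1 -> y ^+ q = rc x ->
  exists s S : R, [/\ 0 < s, 0 < S, x = (s - 1) / (s + 1), S ^+ 2 - 1 = p ^+ 2 * (s ^+ 2 - 1)
   & src y = rc s /\ tgt y = rc S].
Proof.
move=> /andP[x0 x1] y y1 yx.
pose s := (1 + x) / (1 - x).
have s0 : 0 < s by rewrite divr_gt0//; lra.
have sy : src y = rc s by rewrite /src yx /cayley /s rcM rcV rcD rcB rc1.
have pp := p01; case/andP: (pp) => pp0 pp1.
have p21 : p ^+ 2 < 1 by rewrite expr_lt1// ltW.
have a0 : 0 < 1 - p ^+ 2 + p ^+ 2 * s ^+ 2.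
  by rewrite ltr_wpDr ?subr_gt0// mulr_ge0 ?sqr_ge0// ltW.
exists s, (Num.sqrt (1 - p ^+ 2 + p ^+ 2 * s ^+ 2)); split=> //.
- by rewrite sqrtr_gt0.
- rewrite /s; field; apply/andP; split; apply: lt0r_neq0; lra.
- by rewrite sqr_sqrtr ?ltW//; ring.
split=> //; rewrite /tgt sy /slit_hp -psqrt_rc//; congr psqrt.
by rewrite [RHS]rcD [X in _ = _ + X]rcM [rc (s ^+ 2)]rcX.
Qed.

(** Here [S = tgt y] is real in [(0, 1]] and [nm (slit y) ^ q = (1 - S) / (1 + S) <= 1 - S ^ 2 <= p
    ^ 2 = tau ^ q]. This sends points near the circle with [y ^ q < 0] to small modulus. *)
Lemma slit_tip (x : R) y : 0 <= x < 1 -> nm y < 1 -> y ^+ q = rc (- x) -> nm (slit y) <= tau.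
Proof.
move=> /andP[x0 x1] y1 yx.
have [|s [S [s0 S0 xs Ss [sy Sy]]]] := slit_real _ y1 yx.
  by apply/andP; split; lra.
case/andP: tau01 => t0 t1.
have q00 : (0 < q)%N by [].
rewrite -(ler_pXn2r q00) ?nnegrE ?nm_ge0 ?(ltW t0)//.
rewrite -nmX slitq// /slit_pow Sy -p_sqr.
have -> : cayley_inv (rc S) = rc ((S - 1) / (S + 1)) :> C by rewrite /cayley_inv rcM rcV rcB rcD rc1.
have s1 : s <= 1.
  have : (s - 1) / (s + 1) <= 0 by lra.
  rewrite ler_pdivrMr ?mul0r; lra.
have p20 : 0 <= p ^+ 2 by rewrite exprn_ge0// exprn_ge0// ltW.
have s21 : s ^+ 2 <= 1 by move: s0 s1; nra.
have S21 : S ^+ 2 <= 1 by move: p20 s21 Ss; nra.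
have S1 : S <= 1 by move: S0 S21; nra.
rewrite nm_rc ler0_norm; last first.
  by rewrite ler_pdivrMr ?mul0r; lra.
rewrite -mulNr ler_pdivrMr; last lra.
have k1 : 1 - S ^+ 2 <= p ^+ 2 by have := mulr_ge0 p20 (sqr_ge0 s); move: Ss; lra.
move: S0 S1 k1 p20; nra.
Qed.

(** The direction of [1] lies between two slits. For [z = slit x] the constant comes from [1 - z <=
    1 - z ^ q = 2 / (S + 1) <= 2 / (p * s)] and [1 / s <= 1 - x ^ q <= q * (1 - x)]. *)
Lemma slit_one (x : R) : 0 < x < 1 -> nm (slit (rc x) - 1) <= (2 * q%:R / p) * (1 - x).
Proof.
move=> /andP[x0 x1]; have y1 : nm (rc x) < 1 by rewrite nm_rc gtr0_norm.
have xq : (rc x : C) ^+ q = rc (x ^+ q) by rewrite rcX.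
have xq0 : 0 < x ^+ q by rewrite exprn_gt0.
have xq1 : x ^+ q < 1 by rewrite exprn_ilt1 ?ltW// -lt0n.
have [|s [S [s0 S0 xs Ss [sy Sy]]]] := slit_real _ y1 xq.
  by apply/andP; split; lra.
case/andP: tau01 => t0 t1.
have [|A A0 EA] := proot_rc k (a := 1 + s); first lra.
have [|B B0 EB] := proot_rc k (a := 1 + S); first lra.
pose z := x * (tau * (A / B)).
have z0 : 0 < z by rewrite !mulr_gt0// invr_gt0.
have Ez : slit (rc x) = rc z.
  rewrite /slit /slit_quo sy Sy -rc1 -!rcD EA EB /z !rcM rcV//.
have zq : z ^+ q = (S - 1) / (S + 1).
  apply: (@rc_inj R); rewrite rcX -Ez slitq// /slit_pow Sy /cayley_inv rcM rcV rcB rcD rc1//.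
have pp := p01; case/andP: (pp) => pp0 pp1.
have z1 : z < 1.
  by have := slit_lt1 y1; rewrite Ez nm_rc gtr0_norm.
have zqz : z ^+ q <= z.
  have : z ^+ q <= z ^+ 1 by rewrite ler_wiXn2l ?ltW.
  by rewrite expr1.
rewrite Ez -rc1 -rcB nm_rc ltr0_norm ?subr_lt0// opprB.
have Sps : p * s <= S.
  rewrite -(ler_pXn2r (n := 2)) ?nnegrE ?(ltW S0)//; last by rewrite mulr_ge0// ltW.
  have : p ^+ 2 < 1 by rewrite expr_lt1// ltW.
  rewrite exprMn; move: Ss; lra.
have k1 : 1 - z <= 2 / (p * s).
  have -> : 2 / (p * s) = 2 / p / s by field; rewrite !lt0r_neq0.
  apply: (@le_trans _ _ (2 / (S + 1))).
    have -> : 2 / (S + 1) = 1 - z ^+ q.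
      by rewrite zq; field; rewrite lt0r_neq0// addr_gt0.
    lra.
  have -> : 2 / p / s = 2 / (p * s) by field; rewrite !lt0r_neq0.
  rewrite ler_pM2l// lef_pV2 ?posrE ?addr_gt0 ?mulr_gt0//; lra.
apply: (le_trans k1).
have k2 : s^-1 <= 1 - x ^+ q.
  have -> : 1 - x ^+ q = 2 / (s + 1).
    by rewrite xs; field; rewrite lt0r_neq0// addr_gt0.
  have s1 : 1 <= s.
    have sp : 0 < s + 1 by lra.
    have : 0 < (s - 1) / (s + 1) by rewrite -xs.
    by rewrite ltr_pdivlMr// mul0r subr_gt0 => /ltW.
  rewrite -[s^-1]mul1r ler_pdivlMr ?addr_gt0// mul1r ler_pdivrMl//; lra.
have k3 : 1 - x ^+ q <= q%:R * (1 - x).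
  elim: (q) => [|n IH]; first by rewrite expr0 subrr mul0r.
  have xn0 : 0 <= x ^+ n by rewrite exprn_ge0 ?ltW.
  have xn1 : x ^+ n <= 1 by rewrite exprn_ile1 ?ltW.
  rewrite exprS -natr1; move: IH xn0 xn1; nra.
have -> : 2 / (p * s) = 2 / p * s^-1 by field; rewrite !lt0r_neq0.
have -> : 2 * q%:R / p * (1 - x) = 2 / p * (q%:R * (1 - x)) by field; rewrite lt0r_neq0.
rewrite ler_pM2l ?divr_gt0//; lra.
Qed.

End SlitMap.

(** * Approximable functions with values in the right half-plane *)

Section Rhp.
Variable R : realType.
Local Notation C := (Cx R).
Variables (X : C -> Prop) (w : C -> C) (W : R).
Hypothesis wW : forall u, X u -> nm (w u) <= W.

(** Stable under inverse, square root and adding [1], but not under products; these are taken at the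
    level of [apxn] only. *)
Definition rhp a := apx X w a /\ exists2 m : R, 0 < m & forall u, X u -> m <= re (a u).

Lemma rhp_apxn a : rhp a -> apxn X w a.
Proof. by move=> [ha [m m0 hm]]; exact: (apxn_rhp wW m0 hm ha). Qed.

Lemma rhp_cst (c : R) : 0 < c -> rhp (fun=> rc c).
Proof. by move=> c0; split; [exact: apx_cst|exists c]. Qed.

Lemma rhp_inv a : rhp a -> rhp (fun u => (a u)^-1).
Proof.
move=> [ha [m m0 hm]]; split; first exact: (apx_inv wW m0 hm ha).
have [B B0 hB] := apx_bounded wW ha.
exists (m / B ^+ 2); first by rewrite divr_gt0// exprn_gt0.
move=> u Xu; have mu := hm _ Xu; have Bu := hB _ Xu.
have a0 : 0 < nm (a u) by apply: lt_le_trans (le_trans mu (re_le _)).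
have -> : re (a u)^-1 = re (a u) / nm (a u) ^+ 2.
  have e : (a u)^-1 * a u = 1 by rewrite mulVf// nm_neq0.
  have := congr1 (@re R) e; have := congr1 (@im R) e.
  rewrite reM imM re1 im1 => e1 e2.
  apply: (mulIf (lt0r_neq0 (exprn_gt0 2 a0))); rewrite divfK; last first.
    by rewrite lt0r_neq0 ?exprn_gt0.
  rewrite nm_sqr; move: e1 e2; move: (re (a u)) (im (a u)) (re (a u)^-1) (im (a u)^-1) => x y z t e1 e2.
  transitivity (x * (z * x - t * y) + y * (z * y + t * x)); last rewrite e1 e2; ring.
apply: ler_pM => //; first exact: ltW.
  by rewrite invr_ge0 exprn_ge0 ?ltW.
by rewrite lef_pV2 ?posrE ?exprn_gt0// ler_pXn2r ?nnegrE ?(ltW a0) ?(ltW B0).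
Qed.

Lemma rhp_psqrt a : rhp a -> rhp (fun u => psqrt (a u)).
Proof.
move=> [ha [m m0 hm]].
have h u : X u -> Num.sqrt m <= re (psqrt (a u)) by move=> /hm; exact: re_psqrt_ge.
have s0 : 0 < Num.sqrt m by rewrite sqrtr_gt0.
by split; [apply: (apx_sqrt wW s0 h _ ha) => u _; exact: psqrtK|exists (Num.sqrt m)].
Qed.

Lemma rhp_proot k a : rhp a -> rhp (fun u => proot k (a u)).
Proof. by move=> ha; elim: k => // k; exact: rhp_psqrt. Qed.

Lemma rhp_1D a : rhp a -> rhp (fun u => 1 + a u).
Proof.
move=> [ha [m m0 hm]]; split; first exact: apxD (apx_cst _ _ _) ha.
by exists m => // u /hm; rewrite reD re1; lra.
Qed.

End Rhp.

(** * Zero-free approximation of the inverse derivative of the slit map *)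

Section SlitApprox.
Variable R : realType.
Local Notation C := (Cx R).
Variables (k : nat) (tau : R).
Hypothesis tau01 : 0 < tau < 1.
Local Notation q := (2 ^ k.+1)%N.
Local Notation p := (tau ^+ (2 ^ k)).
Local Notation slit := (slit k tau).
Local Notation src := (@src R k).
Local Notation tgt := (tgt k tau).
Local Notation slit_quo := (slit_quo k tau).
Local Notation slit_pow := (slit_pow k tau).
Variable sg : R.
Hypothesis sg01 : 0 < sg < 1.
Let X (y : C) : Prop := nm y <= sg.

Let X1 y : X y -> nm y < 1.
Proof. by rewrite /X; case/andP: sg01 => _ ? /le_lt_trans; apply. Qed.

Lemma slit_pow_bound u : X u -> nm (slit_pow u) <= 1.
Proof. by move=> /X1 /(slit_pow_lt1 k tau01) /ltW. Qed.

Local Notation rhp := (rhp X slit_pow).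

Lemma src_lower : exists2 m, 0 < m & forall u, X u -> m <= re (src u).
Proof.
case/andP: sg01 => s0 s1.
exists ((1 - sg ^+ 2) / 4).
  by rewrite divr_gt0// subr_gt0 expr_lt1// ltW.
by move=> u Xu; apply: cayley_re_ge => //; exact: nmq_le.
Qed.

(** [tgt] is the Cayley transform [(1 + w) / (1 - w)] of the variable [w = slit_pow], and
    [1 - w = 2 / (1 + tgt)] has real part bounded below. *)
Lemma rhp_tgt : rhp tgt.
Proof.
have [m m0 hm] := src_lower; have pp := p01 k tau01; case/andP: (pp) => pp0 pp1.
case/andP: sg01 => s0 s1.
split; last first.
  exists (p * m); first by rewrite mulr_gt0.
  move=> u Xu; apply: le_trans (slit_hp_ge pp (src_gt0 k (X1 Xu))).
  by rewrite ler_wpM2l ?hm// ltW.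
pose B := 2 / (1 - sg).
have B0 : 0 < B by rewrite divr_gt0//; lra.
have sB u : X u -> nm (src u) <= B by move=> Xu; apply: cayley_nm_le => //; exact: nmq_le.
have SB u : X u -> nm (1 + tgt u) <= 3 + B ^+ 2.
  move=> Xu; apply: (le_trans (nmD _ _)); rewrite nm1.
  suff : nm (tgt u) <= 2 + B ^+ 2 by lra.
  have h : nm (tgt u) ^+ 2 <= 1 + B ^+ 2.
    rewrite -nmX slit_hpK; apply: (le_trans (nmD _ _)); rewrite nmM nmX !nm_rc.
    have p20 : 0 < p ^+ 2 by rewrite exprn_gt0.
    have p21 : p ^+ 2 < 1 by rewrite expr_lt1// ltW.
    rewrite !ger0_norm ?subr_ge0 ?ltW//.
    have : nm (src u) ^+ 2 <= B ^+ 2 by rewrite ler_pXn2r ?nnegrE ?nm_ge0 ?sB// ltW.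
    have := sqr_ge0 (nm (src u)); move: p20 p21; nra.
  have := nm_ge0 (tgt u); have := sqr_ge0 B; move: h; nra.
have w1 : apx X slit_pow (fun u => 1 - slit_pow u) 
  by exact: (apxB slit_pow_bound (apx_cst _ _ _) (apx_base _ _)).
apply: (apx_ext (a := fun u => (1 + slit_pow u) * (1 - slit_pow u)^-1)).
  move=> u Xu; rewrite !slit_powE -[RHS](cayley_invK (tgt_gt0 k tau01 (X1 Xu))).
  by rewrite [in RHS]/cayley.
apply: (apxM slit_pow_bound); first exact: apxD (apx_cst _ _ _) (apx_base _ _).
have D0 : 0 < 3 + B ^+ 2 by rewrite addr_gt0// exprn_gt0.
apply: (apx_inv slit_pow_bound (m := 2 / (3 + B ^+ 2) ^+ 2)) => //.
  by rewrite divr_gt0// exprn_gt0.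
move=> u Xu; have S0 := tgt_gt0 k tau01 (X1 Xu).
have S1 := re_gt0_neq0 (re1_gt0 S0); have np := nm_gt0 S1.
have E : (1 - slit_pow u) * (1 + tgt u) = 2.
  by rewrite !slit_powE /cayley_inv [tgt u + 1]addrC; field.
have -> : re (1 - slit_pow u) = 2 * re (1 + tgt u) / nm (1 + tgt u) ^+ 2.
  have := congr1 (@re R) E; have := congr1 (@im R) E.
  have e2 : (2 : C) = rc 2 by rewrite rcn.
  rewrite reM imM e2 re_rc im_rc => e3 e4.
  apply: (mulIf (lt0r_neq0 (exprn_gt0 2 np))); rewrite divfK; last first.
    by rewrite lt0r_neq0 ?exprn_gt0.
  rewrite nm_sqr; move: e3 e4.
  move: (re (1 + tgt u)) (im (1 + tgt u)) (re (1 - slit_pow u)) (im (1 - slit_pow u)) => x y z t e3 e4.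
  transitivity (x * (z * x - t * y) + y * (z * y + t * x)); last rewrite e3 e4; ring.
apply: ler_pM => //.
- by rewrite invr_ge0 exprn_ge0// ltW.
- by rewrite reD re1; lra.
by rewrite lef_pV2 ?posrE ?exprn_gt0// ler_pXn2r ?nnegrE ?SB ?(ltW np) ?(ltW D0).
Qed.

(** [src] is recovered from [tgt]: solve the slit equation for [src ^ 2] and take the root with
    positive real part. *)
Lemma rhp_src : rhp src.
Proof.
have [m m0 hm] := src_lower; have [hS _] := rhp_tgt.
split; last by exists m.
have pp := p01 k tau01; case/andP: (pp) => pp0 pp1.
have pn : rc (p ^+ 2) != 0 :> C.
  have p20 : 0 < p ^+ 2 by rewrite exprn_gt0.
  by apply: nm_neq0; rewrite nm_rc gtr0_norm.
apply: (apx_sqrt slit_pow_bound m0 hm (c := fun u => (rc (p ^+ 2))^-1 * (tgt u * tgt u - rc (1 - p ^+ 2)))).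
  move=> u _; have -> : tgt u * tgt u = rc (1 - p ^+ 2) + rc (p ^+ 2) * src u ^+ 2.
    by rewrite -expr2; exact: slit_hpK.
  by rewrite [_ + rc _ * _]addrC addrK mulKf.
apply: (apxM slit_pow_bound); first exact: apx_cst.
exact: (apxB slit_pow_bound (apxM slit_pow_bound hS hS) (apx_cst _ _ _)).
Qed.

(** The inverse of the derivative found in [hasd_slit], each factor having positive real part. *)
Definition slit_dinv (y : C) : C :=
  (rc tau)^-1 * (tgt y * ((src y)^-1 * (proot k (1 + tgt y) * (proot k (1 + src y))^-1))).

Lemma slit_dinv_inv y : X y -> slit_dinv y * (slit_quo y * src y / tgt y) = 1.
Proof.
move=> /X1 y1; have s0 := src_gt0 k y1; have S0 := tgt_gt0 k tau01 y1.
have a1 := re_gt0_neq0 s0; have a2 := re_gt0_neq0 S0.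
have a3 := re_gt0_neq0 (proot_pos k (re1_gt0 s0)).
have a4 := re_gt0_neq0 (proot_pos k (re1_gt0 S0)).
have tn : rc tau != 0 :> C.
  by apply: nm_neq0; case/andP: tau01 => t0 _; rewrite nm_rc gtr0_norm.
rewrite /slit_dinv !slit_quoE; move: a1 a2 a3 a4 tn.
move: (proot k (1 + src y)) (proot k (1 + tgt y)) (src y) (tgt y) (rc tau) => A B s S t.
by move=> a1 a2 a3 a4 t0; field; rewrite a1 a2 a3 a4 t0.
Qed.

Lemma slit_dinv_apxn : apxn X slit_pow slit_dinv.
Proof.
have t0 : 0 < tau^-1 by rewrite invr_gt0; case/andP: tau01.
apply: (apxnM slit_pow_bound).
  apply: (apxn_ext (a := fun=> rc (tau^-1))); first by move=> u _; rewrite rcV.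
  exact: (rhp_apxn slit_pow_bound (rhp_cst _ _ t0)).
apply: (apxnM slit_pow_bound); first exact: (rhp_apxn slit_pow_bound rhp_tgt).
apply: (apxnM slit_pow_bound).
  exact: (rhp_apxn slit_pow_bound (rhp_inv slit_pow_bound rhp_src)).
apply: (apxnM slit_pow_bound).
  exact: (rhp_apxn slit_pow_bound (rhp_proot slit_pow_bound k (rhp_1D rhp_tgt))).
exact: (rhp_apxn slit_pow_bound (rhp_inv slit_pow_bound (rhp_proot slit_pow_bound k (rhp_1D rhp_src)))).
Qed.

Lemma slit_deriv_bounded : exists2 B, 0 < B & forall y, X y -> nm (slit_quo y * src y / tgt y) <= B.
Proof.
apply: (@apx_bounded R X slit_pow 1 slit_pow_bound (fun y => slit_quo y * src y / tgt y)).
have [h1 _] := rhp_inv slit_pow_bound rhp_tgt.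
have [h2 _] := rhp_src.
have [h3 _] := rhp_proot slit_pow_bound k (rhp_1D rhp_src).
have [h4 _] := rhp_inv slit_pow_bound (rhp_proot slit_pow_bound k (rhp_1D rhp_tgt)).
apply: (apxM slit_pow_bound) h1; apply: (apxM slit_pow_bound) h2.
apply: (apxM slit_pow_bound); first exact: apx_cst.
exact: (apxM slit_pow_bound h3 h4).
Qed.

End SlitApprox.

Section Primitive.
Variable R : realType.
Local Notation C := (Cx R).

(** Integrate term by term. The shape of the primitive, [X] times a polynomial in [X ^ q], makes it
    commute with the rotations of order [q]. *)
Lemma primitive_exists (P : {poly C}) (q : nat) :
  exists Q : {poly C}, deriv ('X * (Q \Po 'X^q)) = P \Po 'X^q.
Proof.
pose H P := exists Q : {poly C}, deriv ('X * (Q \Po 'X^q)) = P \Po 'X^q.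
have H0 : H 0 by exists 0; rewrite !comp_poly0 mulr0 deriv0.
have HD A B : H A -> H B -> H (A + B).
  by move=> [QA hA] [QB hB]; exists (QA + QB); rewrite !comp_polyD mulrDr derivD hA hB.
have Hm i c : H (c *: 'X^i).
  exists ((c / (q * i).+1%:R) *: 'X^i); rewrite !comp_polyZ !comp_Xn_poly -!exprM.
  by rewrite -scalerAr -exprS derivZ derivXn /= -scalerMnr scalerMnl -mulr_natr divfK.
rewrite -/(H P) -[P]coefK poly_def.
by elim/big_ind: _.
Qed.

End Primitive.

(** * A slit map and its polynomial approximate inverse *)

Section SlitStep.
Variable R : realType.
Local Notation C := (Cx R).

Lemma subBB (a b c d : C) : a - b - (c - d) = a - c - (b - d).
Proof. ring. Qed.
Lemma subBl (a b c : C) : a - b - (a - c) = c - b.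
Proof. ring. Qed.

Definition lip_disc (f : C -> C) (L : R) :=
  forall x y, nm x <= 1 -> nm y <= 1 -> nm (f x - f y) <= L * nm (x - y).

Definition slit_covers (q : nat) (slit : C -> C) :=
  (forall v : C, nm v < 1 -> (im (v ^+ q) = 0 -> 0 <= re (v ^+ q)) ->
    exists y, nm y < 1 /\ slit y = v) /\
  (forall r : R, r < 1 -> exists2 L : R, 0 < L &
    forall x y, nm x <= r -> nm y <= r -> nm (slit x - slit y) <= L * nm (x - y)).

(** [phi] is an exact right inverse of [g] but only close to [slit]. The last clause transfers area.
    In [slit_step] the map [slit] precedes [R0] and [r1], since [r1] is chosen from the areas of its
    images. *)
Definition slit_data (q : nat) (eps R0 r1 : R) (slit : C -> C) (g : {poly C}) (phi : C -> C) :=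
  [/\ exists2 m, 0 < m & forall v, nm v <= R0 -> m <= nm (deriv g).[v],
      forall l v, l ^+ q = 1 -> g.[l * v] = l * g.[v] /\ (deriv g).[l * v] = (deriv g).[v],
      exists2 L, 0 < L & lip_disc phi L &
      forall y, nm y <= 1 -> g.[phi y] = y /\ nm (phi y) <= 1] /\
  [/\ phi 0 = 0,
      forall l y, nm y <= 1 -> l ^+ q = 1 -> phi (l * y) = l * phi y,
      nm (phi 1 - 1) <= eps,
      forall y, y ^+ q = -1 -> nm (phi y) <= eps &
      forall y, nm y <= r1 -> exists x, nm x <= 1 /\ phi x = slit y].

(* A zero-free polynomial [P] in [v ^+ q] approximates [1 / slit'] in the target
   variable; its primitive [g] has no critical point on the given disc and
   [g \o slit] is close to the identity, hence invertible on a slightly smaller disc. *)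
Lemma slit_step (k : nat) (eps : R) : 0 < eps ->
  exists slit, slit_covers (2 ^ k.+1) slit /\
  forall R0 r1 : R, r1 < 1 -> exists g phi, slit_data (2 ^ k.+1) eps R0 r1 slit g phi.
Proof.
move=> eps0; pose q := (2 ^ k.+1)%N.
have q0 : (0 < q)%N by rewrite expn_gt0.
(* Half of [eps] pays for the slit tips, the other half for the distance between [phi] and
   [slit]. *)
pose tau := Num.min (eps / 2) (1 / 2).
have tau01 : 0 < tau < 1.
  rewrite /tau lt_min gt_min; apply/andP; split; last by apply/orP; right; lra.
  by apply/andP; split; lra.
have taue : tau <= eps / 2 by rewrite ge_min lexx.
have := p01 k tau01; set p := tau ^+ _ => /andP[pp0 pp1].
have slit_lip (sg : R) : 0 < sg < 1 -> exists2 B, 0 < B & forall x y,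
    nm x <= sg -> nm y <= sg -> nm (slit k tau x - slit k tau y) <= B * nm (x - y).
  move=> sg01; have [B B0 hB] := slit_deriv_bounded k tau01 sg01.
  exists B => // x y hx hy; have sg1 : sg < 1 by case/andP: sg01.
  apply: (@mvt_ball R _ (fun y => slit_quo k tau y * src k y / tgt k tau y) 0 sg); rewrite ?subr0//.
  move=> z; rewrite subr0 => hz; split; last exact: hB.
  by apply: hasd_slit => //; apply: le_lt_trans sg1.
exists (slit k tau); split.
  split; first by move=> v; exact: slit_surj.
  move=> r r1; have sg01 : 0 < Num.max r (1 / 2) < 1.
    by rewrite lt_max gt_max r1; apply/andP; split; [apply/orP; right|]; lra.
  have [B B0 hB] := slit_lip _ sg01; exists B => // x y hx hy.
  by apply: hB; rewrite le_max ?hx ?hy.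
move=> R0 r1 r11.
pose c := 2 * q%:R / p.
have c0 : 0 < c by rewrite divr_gt0// mulr_gt0// ltr0n.
pose dl := Num.min (Num.min (1 - r1) (1 / 2)) (eps / (4 * c)).
have dl0 : 0 < dl.
  rewrite !lt_min; apply/andP; split; last by rewrite divr_gt0// mulr_gt0.
  by apply/andP; split; lra.
have [dl1 dl2 dl3] : [/\ dl <= 1 - r1, dl <= 1 / 2 & dl <= eps / (4 * c)].
  by rewrite /dl !ge_min !lexx ?orbT.
pose sg := 1 - dl / 2.
have sg01 : 0 < sg < 1 by rewrite /sg; apply/andP; split; lra.
have [sg0 sg1] := andP sg01.
have r1s : r1 < sg by rewrite /sg; lra.
have hone : nm (slit k tau (rc sg) - 1) <= eps / 2.
  apply: (le_trans (slit_one k tau01 sg01)); rewrite -/q -/p -/c.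
  have -> : 1 - sg = dl / 2 by rewrite /sg; ring.
  have c4 : 0 < 4 * c by rewrite mulr_gt0.
  rewrite (ler_pdivlMr _ _ c4) in dl3; move: dl3; lra.
have X1 y : nm y <= sg -> nm y < 1 by move=> h; apply: le_lt_trans sg1.
have [B B0 hB] := slit_deriv_bounded k tau01 sg01.
have lp0 x y : nm x <= sg -> nm y <= sg -> nm (slit k tau x - slit k tau y) <= B * nm (x - y).
  move=> hx hy.
  apply: (@mvt_ball R _ (fun y => slit_quo k tau y * src k y / tgt k tau y) 0 sg); rewrite ?subr0//.
  by move=> z; rewrite subr0 => hz; split; [exact: hasd_slit (X1 _ hz)|exact: hB].
(* [1/2] makes [F] invertible by contraction, [eps / (4 * B)] keeps [phi] near [slit], and
   [(sg - r1) / 2] sends the disc [r1] under [F] into the disc [s2]. *)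
pose e2 := Num.min (Num.min (1 / 2) (eps / (4 * B))) ((sg - r1) / 2).
have e20 : 0 < e2.
  rewrite !lt_min; apply/andP; split; last by lra.
  by apply/andP; split; [lra|rewrite divr_gt0// mulr_gt0].
have [e21 e22 e23] : [/\ e2 <= 1 / 2, e2 <= eps / (4 * B) & e2 <= (sg - r1) / 2].
  by rewrite /e2 !ge_min !lexx ?orbT.
have e1B : 0 < e2 / B by rewrite divr_gt0.
(* [P] will be evaluated at [v ^ q], hence the power of [R0]; an error [e2 / B] against a derivative
   bounded by [B] gives [F' - 1] of size at most [e2]. *)
have [P [[m m0 mP] hP]] := slit_dinv_apxn k tau01 sg01 (`|R0| ^+ q) e1B.
have [Q hQ] := primitive_exists P q.
pose g0 := 'X * (Q \Po 'X^q).
pose F y := g0.[slit k tau y].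
have dF y : nm y <= sg -> hasd F y (P.[slit_pow k tau y] * (slit_quo k tau y * src k y / tgt k tau y)).
  move=> hy; have := hasd_comp (hasd_slit k tau01 (X1 _ hy)) (hasd_poly g0 _).
  by congr hasd; rewrite /g0 hQ horner_comp hornerXn slitq// X1.
have lE x y : nm x <= sg -> nm y <= sg -> nm ((F x - x) - (F y - y)) <= e2 * nm (x - y).
  move=> hx hy.
  apply: (@mvt_ball R (fun y => F y - y) (fun y => P.[slit_pow k tau y] * (slit_quo k tau y * src k y / tgt k tau y) - 1) 0 sg);
    rewrite ?subr0//.
  move=> z; rewrite subr0 => hz; split; first exact: hasdB (dF _ hz) (hasd_id _).
  rewrite -(slit_dinv_inv k tau01 sg01 hz) -mulrBl nmM.
  have -> : e2 = e2 / B * B by rewrite divfK// lt0r_neq0.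
  by apply: ler_pM; rewrite ?nm_ge0 ?hP ?hB.
have F0 : F 0 = 0 by rewrite /F slit0 /g0 hornerM hornerX mul0r.
have Fnm y : nm y <= sg -> nm (F y - y) <= e2 * nm y.
  move=> hy; have := lE y 0 hy; rewrite nm0 F0 !subr0 => ->//; exact: ltW.
(* A displacement of at most [e2 * sg] lets [F] of the disc [sg] cover the disc [s2]; the witnesses
   rescale that disc to the unit disc. *)
pose s2 := (1 - e2) * sg.
have s20 : 0 < s2 by rewrite mulr_gt0//; lra.
have s2sg : s2 <= sg by rewrite /s2; move: e20 sg0; clear; nra.
have s2sg' : sg - s2 <= e2 by rewrite /s2; move: e20 sg1; clear; nra.
have finj x y : nm x <= sg -> nm y <= sg -> nm (x - y) <= 2 * nm (F x - F y).
  move=> hx hy; have := lE x y hx hy.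
  rewrite subBB.
  have := nmBge (x - y) (F x - F y); rewrite (nmBC (x - y)).
  have := ler_wpM2r (nm_ge0 (x - y)) e21; clear; lra.
have fsurj z : exists x, nm z <= s2 -> nm x <= sg /\ F x = z.
  have [hz|] := boolP (nm z <= s2); last by exists 0.
  have [||x [hx1 hx2]] := @half_fixpoint R (fun x => z - (F x - x)) 0 sg (ltW sg0).
  - move=> x; rewrite !subr0 => hx; apply: (le_trans (nmB _ _)).
    have := Fnm x hx; have := ler_wpM2l (ltW e20) hx; move: hz; rewrite /s2; clear; lra.
  - move=> x y; rewrite !subr0 => hx hy.
    rewrite subBl.
    rewrite nmBC; have := lE x y hx hy.
    have := ler_wpM2r (nm_ge0 (x - y)) e21; clear; lra.
  exists x => _; rewrite subr0 in hx1; split=> //.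
  by rewrite -[RHS](subrK (F x - x)) hx2 addrC subrK.
have [psi hpsi] := choice fsurj.
have s2C : rc s2 != 0 :> C by apply: nm_neq0; rewrite nm_rc gtr0_norm.
have sc y : nm y <= 1 -> nm (rc s2 * y) <= s2.
  by move=> hy; rewrite nmM nm_rc gtr0_norm// ler_piMr// ltW.
have g0rot l v : l ^+ q = 1 -> g0.[l * v] = l * g0.[v].
  move=> lq; rewrite /g0 !hornerM !hornerX !horner_comp !hornerXn exprMn lq mul1r.
  by rewrite mulrA.
have frot l y : l ^+ q = 1 -> F (l * y) = l * F y.
  by move=> lq; rewrite /F slit_rot// g0rot.
have nm1q (l : C) n : (0 < n)%N -> l ^+ n = 1 -> nm l = 1.
  move=> n0 lq; have := nmX l n; rewrite lq nm1 => /esym/eqP.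
  by rewrite pexprn_eq1 ?nm_ge0// => /orP[|/eqP//]; rewrite eqn0Ngt n0.
have close y : nm y <= 1 -> nm (psi (rc s2 * y) - rc s2 * y) <= e2.
  move=> hy; have [h1 h2] := hpsi _ (sc _ hy).
  rewrite nmBC -{1}h2; apply: (le_trans (Fnm _ h1)).
  have := ler_wpM2l (ltW e20) h1; move: e20 sg1; clear; nra.
have phi_near y : nm y <= 1 -> nm (slit k tau (psi (rc s2 * y)) - slit k tau (rc sg * y)) <= eps / 2.
  move=> hy; have [h1 h2] := hpsi _ (sc _ hy).
  have h3 : nm (rc sg * y) <= sg by rewrite nmM nm_rc gtr0_norm// ler_piMr// ltW.
  apply: (le_trans (lp0 _ _ h1 h3)).
  have h4 : nm (psi (rc s2 * y) - rc sg * y) <= 2 * e2.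
    apply: (le_trans (nm_tri (rc s2 * y) _ _)).
    have := close y hy; have : nm (rc s2 * y - rc sg * y) <= e2; last (clear; lra).
    rewrite -mulrBl -rcB nmM nm_rc distrC ger0_norm ?subr_ge0//.
    by apply: le_trans s2sg'; rewrite ler_piMr// subr_ge0.
  have B4 : 0 < 4 * B by rewrite mulr_gt0.
  rewrite (ler_pdivlMr _ _ B4) in e22.
  have := ler_wpM2l (ltW B0) h4; lra.
exists ((rc s2)^-1 *: g0), (fun y => slit k tau (psi (rc s2 * y))); split; split.
- exists (m / s2); first by rewrite divr_gt0.
  move=> v hv; rewrite derivZ hornerZ hQ horner_comp hornerXn nmM nmV nm_rc (gtr0_norm s20).
  rewrite mulrC ler_pM2l ?invr_gt0//; apply: mP; rewrite nmX.
  by rewrite ler_pXn2r ?nnegrE ?nm_ge0 ?normr_ge0//; apply: le_trans hv (ler_norm _).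
- move=> l v lq; split; first by rewrite !hornerZ g0rot// mulrCA.
  by rewrite derivZ !hornerZ hQ !horner_comp !hornerXn exprMn lq mul1r.
- exists (B * (2 * s2)); first by apply: mulr_gt0 => //; apply: mulr_gt0.
  move=> x y hx hy.
  have [hx1 hx2] := hpsi _ (sc _ hx); have [hy1 hy2] := hpsi _ (sc _ hy).
  apply: (le_trans (lp0 _ _ hx1 hy1)); rewrite -[leRHS]mulrA ler_wpM2l ?(ltW B0)//.
  apply: (le_trans (finj _ _ hx1 hy1)); by rewrite hx2 hy2 -mulrBr nmM nm_rc (gtr0_norm s20) mulrA.
- move=> y hy; have [h1 h2] := hpsi _ (sc _ hy); split; last exact/ltW/(slit_lt1 k tau01)/X1.
  by rewrite hornerZ -/(F _) h2 mulKf.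
- have [h1 h2] := hpsi _ (sc 0 ltac:(by rewrite nm0 ler01)).
  have := finj _ 0 h1; rewrite nm0 (ltW sg0) h2 F0 mulr0 subrr nm0 mulr0 => /(_ isT).
  rewrite subr0 => h; have -> : psi 0 = 0; last exact: slit0.
  by apply: nm_eq0; apply/eqP; rewrite eq_le h nm_ge0.
- move=> l y hy lq; have l1 := nm1q _ _ q0 lq.
  have [h1 h2] := hpsi _ (sc _ hy).
  have hly : nm (l * y) <= 1 by rewrite nmM l1 mul1r.
  have [h3 h4] := hpsi _ (sc _ hly).
  rewrite -(slit_rot tau (psi (rc s2 * y)) lq); apply: (congr1 (slit k tau)).
  have h5 : nm (l * psi (rc s2 * y)) <= sg by rewrite nmM l1 mul1r.
  have := finj _ _ h3 h5; rewrite h4 frot// h2 mulrCA subrr nm0 mulr0 => h6.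
  apply/eqP; rewrite -subr_eq0; apply/eqP/nm_eq0/eqP.
  by rewrite eq_le h6 nm_ge0.
- have := phi_near 1; rewrite nm1 lexx => /(_ isT) h.
  rewrite [rc sg * 1]mulr1 in h.
  apply: (le_trans (nm_tri (slit k tau (rc sg)) _ _)); move: h hone; clear; lra.
- move=> y yq; have y1 : nm y = 1.
    apply: (nm1q _ (2 * q)%N); first by rewrite muln_gt0.
    by rewrite mulnC exprM yq sqrrN expr1n.
  have hy : nm y <= 1 by rewrite y1.
  have h3 : nm (rc sg * y) < 1 by rewrite nmM y1 nm_rc gtr0_norm// mulr1.
  have h4 : nm (slit k tau (rc sg * y)) <= tau.
    apply: (@slit_tip R k tau tau01 (sg ^+ q)) => //.
      by rewrite exprn_ge0 ?exprn_ilt1 ?(ltW sg0)// -lt0n.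
    by rewrite exprMn yq rcN mulrN1 rcX.
  have h5 := nmBge (slit k tau (psi (rc s2 * y))) (slit k tau (rc sg * y)).
  rewrite lerBlDr in h5; apply: (le_trans h5).
  apply: (le_trans (lerD (phi_near y hy) (le_trans h4 taue))).
  by rewrite -splitr.
- move=> y hy; have ysg : nm y <= sg by apply: le_trans hy (ltW r1s).
  have hF : nm (F y) <= s2.
    rewrite -[F y](subrK y).
    apply: (le_trans (nmD _ _)); have := Fnm y ysg.
    have := ler_wpM2l (ltW e20) ysg; have := ler_wpM2l (ltW e20) (ltW sg1).
    rewrite /s2; move: hy e23; clear; lra.
  exists ((rc s2)^-1 * F y); split.
    by rewrite nmM nmV nm_rc (gtr0_norm s20) mulrC ler_pdivrMr// mul1r.
  have -> : rc s2 * ((rc s2)^-1 * F y) = F y by exact: mulVKf.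
  apply: (congr1 (slit k tau)).
  have [h1 h2] := hpsi _ hF.
  have := finj _ _ h1 ysg; rewrite h2 subrr nm0 mulr0 => h6.
  apply/eqP; rewrite -subr_eq0; apply/eqP/nm_eq0/eqP.
  by rewrite eq_le h6 nm_ge0.
Qed.

End SlitStep.

(** * Topology and area of plane sets *)

Arguments nm : simpl never.
Arguments re : simpl never.
Arguments im : simpl never.
Arguments rc : simpl never.

Section Top.
Variable R : realType.
Local Notation C := (Cx R).

Lemma pos_rc (e : C) : 0 < e -> exists2 r : R, 0 < r & e = rc r.
Proof.
move=> e0; have ee : e = rc (re e).
  apply: ceq => //; have := e0; rewrite ltcE /= => /andP[/eqP he _].
  by rewrite /im he.
by exists (re e) => //; move: e0; rewrite {1}ee -rc0 ltrc.
Qed.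

Lemma nbhs_nmP (z : C) (A : set C) :
  nbhs z A <-> exists2 r : R, 0 < r & forall y, nm (y - z) < r -> A y.
Proof.
split.
  move=> /nbhs_ballP[e /= /pos_rc[r r0 ->] h]; exists r => // y yz; apply: h.
  by rewrite -ball_normE /= normE ltrc nmBC.
move=> [r r0 h]; apply/nbhs_ballP; exists (rc r) => /=; first by rewrite -rc0 ltrc.
by move=> y; rewrite -ball_normE /= normE ltrc nmBC; apply: h.
Qed.

Lemma open_nmP (A : set C) :
  open A <-> forall z, A z -> exists2 r : R, 0 < r & forall y, nm (y - z) < r -> A y.
Proof.
rewrite openE; split.
  by move=> h z /h /nbhs_nmP.
by move=> h z /h /nbhs_nmP.
Qed.

Lemma closure_nmP (A : set C) z :
  closure A z <-> forall e : R, 0 < e -> exists2 y, A y & nm (y - z) < e.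
Proof.
split.
  move=> h e e0; have [|y [Ay yz]] := h [set y | nm (y - z) < e].
    by apply/nbhs_nmP; exists e.
  by exists y.
move=> h B /nbhs_nmP[r r0 hB]; have [y Ay yz] := h r r0.
by exists y; split=> //; exact: hB.
Qed.

Lemma closed_nmP (A : set C) :
  closed A <-> forall z, (forall e : R, 0 < e -> exists2 y, A y & nm (y - z) < e) -> A z.
Proof.
split=> [h z hz|h z /closure_nmP]; last exact: h.
by apply: h; exact/closure_nmP.
Qed.

Lemma within_cont_nm (T : topologicalType) (A : set T) (f : T -> C) :
  (forall x, A x -> forall e : R, 0 < e -> nbhs x [set y | A y -> nm (f y - f x) < e]) ->
  {within A, continuous f}.
Proof.
move=> h; apply/subspace_continuousP => x Ax B /nbhs_nmP[r r0 hB].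
have := h x Ax r r0; apply: filterS => y /= hy Ay.
exact/hB/hy.
Qed.

Lemma cont_nm (T : topologicalType) (f : T -> C) :
  (forall x (e : R), 0 < e -> nbhs x [set y | nm (f y - f x) < e]) -> continuous f.
Proof.
move=> h x B /nbhs_nmP[r r0 hB]; have := h x r r0; apply: filterS => y /= hy.
exact: hB.
Qed.

Lemma cont_mkC : continuous (fun x : R * R => (Complex x.1 x.2 : R[i]) : C).
Proof.
apply: cont_nm => -[a b] e e0.
exists (ball a (e / 2), ball b (e / 2)) => /=.
  by split; apply: nbhsx_ballx; lra.
move=> [x y] /= []; rewrite -!ball_normE /= => hx hy.
apply: (le_lt_trans (nm_le (Complex (x - a) (y - b) : R[i]))).
rewrite /re /im /= (distrC x) (distrC y).
lra.
Qed.

Lemma compact_nm (A : set C) (r : R) : closed A -> (forall z, A z -> nm z <= r) -> compact A.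
Proof.
move=> cA hA.
pose B : set C := (fun x : R * R => (Complex x.1 x.2 : R[i]) : C) @` (`[- r, r] `*` `[- r, r]).
have cB : compact B.
  apply: continuous_compact.
    by apply: continuous_subspaceT; exact: cont_mkC.
  by apply: compact_setX; exact: segment_compact.
apply: subclosed_compact cA cB _ => z Az.
exists (re z, im z); last by case: z Az.
have h := hA z Az.
by split => /=; rewrite in_itv /= -ler_norml; [apply: le_trans (le_re _) h|apply: le_trans (le_im _) h].
Qed.

Lemma star_connected (A : set C) (c : C) : A c ->
  (forall x, A x -> forall t : R, 0 <= t <= 1 -> A (c + rc t * (x - c))) -> connected A.
Proof.
move=> Ac hA.
pose S x : set C := (fun t : R => c + rc t * (x - c)) @` `[0, 1].
have -> : A = \bigcup_(x in A) S x.
  rewrite eqEsubset; split=> [x Ax|_ [x Ax [t /= ht <-]]].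
    exists x => //; exists 1; first by rewrite /= in_itv /= lexx ler01.
    by rewrite rc1 mul1r addrC subrK.
  by apply: hA => //; move: ht; rewrite in_itv.
apply: bigcup_connected.
  exists c => x Ax; exists 0; first by rewrite /= in_itv /= lexx ler01.
  by rewrite rc0 mul0r addr0.
move=> x Ax; apply: connected_continuous_connected.
  by apply/connected_intervalP; exact: interval_is_interval.
apply: continuous_subspaceT; apply: cont_nm => t e e0.
have n0 := nm_ge0 (x - c).
exists (e / (1 + nm (x - c))) => /=; first by rewrite divr_gt0//; lra.
move=> s /=; rewrite ltr_pdivlMr; last lra.
have -> : c + rc s * (x - c) - (c + rc t * (x - c)) = rc (s - t) * (x - c).
  by rewrite rcB; ring.
rewrite nmM nm_rc distrC; have := normr_ge0 (s - t); nra.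
Qed.

Definition disc (r : R) : set C := [set z | nm z <= r].

Lemma disc_closed r : closed (disc r).
Proof.
apply/closed_nmP => z h; rewrite /disc /=; apply/ler_addgt0Pl => e e0.
have [y yr yz] := h e e0; have := nmBge z y; rewrite nmBC.
by move: yr; rewrite /disc /=; lra.
Qed.

Lemma disc_compact r : compact (disc r).
Proof. by apply: (@compact_nm _ r (@disc_closed r)). Qed.

Lemma disc_connected r : 0 <= r -> connected (disc r).
Proof.
move=> r0; apply: (@star_connected _ 0); first by rewrite /disc /= nm0.
move=> x; rewrite /disc /= => hx t /andP[t0 t1].
rewrite add0r subr0 nmM nm_rc ger0_norm//.
by apply: le_trans hx; rewrite ler_piMl ?nm_ge0.
Qed.

Lemma lip_within (r L : R) (f : C -> C) :
  (forall x y, nm x <= r -> nm y <= r -> nm (f x - f y) <= L * nm (x - y)) ->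
  {within disc r, continuous f}.
Proof.
move=> h; apply: within_cont_nm => x Ax e e0; apply/nbhs_nmP.
exists (e / (1 + `|L|)); first by rewrite divr_gt0// ltr_pwDl.
move=> y; rewrite ltr_pdivlMr ?ltr_pwDl// => hy Ay.
apply: (le_lt_trans (h _ _ Ay Ax)); apply: le_lt_trans hy.
rewrite mulrC ler_wpM2l ?nm_ge0//; have := ler_norm L; lra.
Qed.

Lemma lip_image_compact (r L : R) (f : C -> C) :
  (forall x y, nm x <= r -> nm y <= r -> nm (f x - f y) <= L * nm (x - y)) ->
  compact (f @` disc r).
Proof. by move=> /lip_within h; apply: continuous_compact h _; exact: disc_compact. Qed.

Lemma Chaus : hausdorff_space C.
Proof. exact: (@norm_hausdorff _ C^o). Qed.

Lemma compact_closed_nm (A : set C) : compact A -> closed A.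
Proof. by move=> h; apply: compact_closed h; exact: Chaus. Qed.

Lemma lip_image_connected (r L : R) (f : C -> C) : 0 <= r ->
  (forall x y, nm x <= r -> nm y <= r -> nm (f x - f y) <= L * nm (x - y)) ->
  connected (f @` disc r).
Proof.
move=> r0 /lip_within h; apply: connected_continuous_connected h.
exact: disc_connected.
Qed.

(** The sequential form of compactness used below; [K] may also be constant. *)
Lemma cluster_seq (K : nat -> set C) (z : nat -> C) :
  (forall n, compact (K n)) -> (forall n, K n.+1 `<=` K n) -> (forall n, K n (z n)) ->
  exists p, (forall n, K n p) /\
    forall (e : R) N, 0 < e -> exists2 n, (N <= n)%N & nm (z n - p) < e.
Proof.
move=> cK sK Kz.
have mono n m : (n <= m)%N -> K m `<=` K n.
  move=> /subnK <-; elim: (m - n)%N => // i IH; rewrite addSn.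
  exact: subset_trans (sK _) IH.
have [|p [K0p hp]] := cK 0%N (z @ \oo) _.
  by exists 0%N => // n _ /=; apply: (mono 0%N n) => //; exact: Kz.
have near (e : R) N : 0 < e -> exists2 n, (N <= n)%N & nm (z n - p) < e.
  move=> e0.
  have [||y [/= [n Nn <-] h]] := hp [set z n | n in [set n | (N <= n)%N]] [set y | nm (y - p) < e].
  - by exists N => // n Nn /=; exists n.
  - by apply/nbhs_nmP; exists e.
  by exists n.
exists p; split=> // n.
have := compact_closed_nm (cK n); rewrite closed_nmP; apply => e e0.
have [m nm_ hm] := near e n e0.
by exists (z m) => //; apply: (mono n m).
Qed.

Lemma disjoint_gap (A B : set C) : compact A -> compact B ->
  (forall z, A z -> B z -> False) ->
  exists2 d : R, 0 < d & forall x y, A x -> B y -> d <= nm (x - y).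
Proof.
move=> cA cB AB; apply: contrapT => H.
have {}H (n : nat) : exists xy : C * C, [/\ A xy.1, B xy.2 & nm (xy.1 - xy.2) < n.+1%:R^-1].
  apply: contrapT => h; apply: H; exists (n.+1%:R^-1); first by rewrite invr_gt0.
  move=> x y Ax By; rewrite leNgt; apply/negP => lt; apply: h.
  by exists (x, y).
have [xy hxy] := choice H.
have [|n|p [Ap hp]] := @cluster_seq (fun=> A) (fun n => (xy n).1) (fun=> cA).
- by move=> n x.
- by case: (hxy n).
apply: (AB p); first exact: (Ap 0%N).
have := compact_closed_nm cB; rewrite closed_nmP; apply => e e0.
have [N hN] : exists N : nat, N.+1%:R^-1 < e / 2.
  exists (Num.truncn (2 / e)); rewrite invf_plt ?posrE//; last lra.
  by rewrite invf_div; exact: truncnS_gt.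
have e2 : 0 < e / 2 by lra.
have [n Nn /= h] := hp (e / 2) N e2.
have [_ Bn h'] := hxy n.
exists (xy n).2 => //.
apply: (le_lt_trans (nm_tri (xy n).1 _ _)); rewrite nmBC.
have : n.+1%:R^-1 <= N.+1%:R^-1 :> R by rewrite lef_pV2 ?posrE// ler_nat ltnS.
move: h h'; move: hN; set u := N.+1%:R^-1; set v := n.+1%:R^-1; lra.
Qed.

(** A splitting of the intersection into two compact pieces leaves a gap [d]. By compactness some
    [K n] lies in the union of their disjoint [d / 3]-neighbourhoods, so it is split too. *)
Lemma nested_connected (K : nat -> set C) :
  (forall n, compact (K n)) -> (forall n, K n.+1 `<=` K n) -> (forall n, connected (K n)) ->
  connected (\bigcap_n K n).
Proof.
move=> cK sK kK B [b0 Bb0] [V oV BV] [D cD BD].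
pose L := \bigcap_n K n.
have cL : closed L by apply: closed_bigI => n _; exact: compact_closed_nm.
have Lcomp A : closed A -> compact (L `&` A).
  move=> cA; apply: (subclosed_compact _ (cK 0%N)); first exact: closedI.
  by move=> z [Lz _]; exact: Lz.
have cB : compact B by rewrite BD; exact: Lcomp.
have cB' : compact (L `&` ~` V) by apply: Lcomp; exact: open_closedC.
have [|d d0 hd] := disjoint_gap cB cB'.
  by move=> z; rewrite BV => -[_ Vz] [_ nVz].
rewrite eqEsubset; split=> [z|z Lz]; first by rewrite BV => -[].
apply: contrapT => nBz.
have B'z : (L `&` ~` V) z by split=> // Vz; apply: nBz; rewrite BV.
pose near (S : set C) := [set x | exists2 y, S y & nm (x - y) < d / 3].
have nearO S : open (near S).
  apply/open_nmP => x [y Sy xy]; exists (d / 3 - nm (x - y)); first by rewrite subr_gt0.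
  move=> x' hx'; exists y => //; apply: (le_lt_trans (nm_tri x _ _)).
  by move: hx'; lra.
have [n hn] : exists n, K n `<=` near B `|` near (L `&` ~` V).
  apply: contrapT => H.
  have {}H n : exists x, K n x /\ ~ (near B `|` near (L `&` ~` V)) x.
    apply: contrapT => h; apply: H; exists n => x Kx.
    by apply: contrapT => h'; apply: h; exists x.
  have [x hx] := choice H.
  have [p [Kp hp]] := cluster_seq cK sK (fun n => proj1 (hx n)).
  have d3 : 0 < d / 3 by lra.
  have [m _ hm] := hp (d / 3) 0%N d3.
  have [_] := hx m; apply.
  have Lp : L p by move=> i _; exact: Kp.
  have [Vp|nVp] := pselect (V p); last by right; exists p.
  by left; exists p => //; rewrite BV.
have near_disj x : near B x -> near (L `&` ~` V) x -> False.
  move=> [y By xy] [y' By' xy'].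
  have := hd y y' By By'; apply/negP; rewrite -ltNge.
  apply: (le_lt_trans (nm_tri x _ _)); rewrite nmBC; lra.
have LK x : L x -> K n x by move=> Lx; exact: Lx.
have BK x : B x -> K n x by rewrite BV => -[/LK].
have self (S : set C) x : S x -> near S x.
  by move=> Sx; exists x => //; rewrite subrr nm0; lra.
have E : K n `&` near B = K n.
  apply: (kK n).
  - by exists b0; split; [exact: BK|exact: self].
  - by exists (near B).
  exists (~` near (L `&` ~` V)); first exact: open_closedC.
  rewrite eqEsubset; split=> x [Kx hx]; split=> //.
    by move=> h; exact: near_disj hx h.
  by case: (hn _ Kx).
have : (K n `&` near B) z by rewrite E; exact: LK.
by move=> [_ h]; apply: near_disj h (self _ _ B'z).
Qed.
End Top.

(** * Area: measurability, null curves and monotone limits *)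

Section Area.
Variable R : realType.
Local Notation C := (Cx R).
Local Notation RR := (measurableTypeR R * measurableTypeR R)%type.

Let mu : {measure set RR -> \bar R} := ((@lebesgue_measure R) \x (@lebesgue_measure R))%E.

Definition box (c : C) (r : R) : set RR :=
  (`[re c - r, re c + r] : set R) `*` (`[im c - r, im c + r] : set R).

Lemma box_measurable c r : measurable (box c r).
Proof.
apply: measurableX.
 exact: measurable_itv.
exact: measurable_itv.
Qed.

Lemma box_mu c r : 0 <= r -> mu (box c r) = ((2 * r) ^+ 2)%:E.
Proof.
move=> r0.
have leb (x : R) : @lebesgue_measure R (`[x - r, x + r] : set R) = (2 * r)%:E.
  rewrite lebesgue_measure_itv /= lte_fin.
  case: ltP => hr.
    by rewrite -EFinB; congr (_%:E); ring.
  have r00 : r = 0 by move: hr r0; clear; lra.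
  by rewrite r00 mulr0.
pose A : set R := `[re c - r, re c + r]; pose B : set R := `[im c - r, im c + r].
transitivity (@lebesgue_measure R A * @lebesgue_measure R B)%E.
  by apply: product_measure1E; exact: measurable_itv.
by rewrite /A /B !leb -EFinM expr2.
Qed.

Definition mk (p : RR) : C := (Complex p.1 p.2 : R[i]).

Lemma boxP c r p : box c r p <-> (`|re (mk p - c)| <= r /\ `|im (mk p - c)| <= r).
Proof.
by rewrite /box /= !in_itv /= reB imB !ler_distl; split.
Qed.

Lemma realifyE (S : set C) p : realify S p = S (mk p).
Proof. by []. Qed.

(** The complement is a countable union of squares with rational centres and half-sides
    [1 / (n + 1)]; [unpickle] enumerates them. *)
Lemma realify_measurable (F : set C) : closed F -> measurable (realify F).
Proof.
move=> cF.
pose G (x : rat * rat * nat) : set RR :=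
  let c : C := (Complex (ratr x.1.1) (ratr x.1.2) : R[i]) in
  let r : R := x.2.+1%:R^-1 in
  if `[< forall p, box c r p -> ~ F (mk p) >] then box c r else set0.
suff -> : realify F = ~` (\bigcup_(n : nat) (if unpickle n is Some x then G x else set0)).
  apply: measurableC; apply: bigcup_measurable => n _.
  case: unpickle => // x; rewrite /G; case: ifP => // _; exact: box_measurable.
rewrite eqEsubset; split=> [p Fp [n _]|p H].
  case: unpickle => // x; rewrite /G; case: ifP => // /asboolP h /h; exact.
rewrite realifyE; apply: contrapT => nF; apply: H.
have : open (~` F) by exact: closed_openC.
move=> /open_nmP /(_ _ nF) [r r0 hr].
have [N hN] : exists N : nat, (N.+1%:R : R)^-1 < r / 4.
  exists (Num.truncn (4 / r)); rewrite invf_plt ?posrE//; last lra.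
  by rewrite invf_div; exact: truncnS_gt.
pose s : R := N.+1%:R^-1.
have s0 : 0 < s by rewrite invr_gt0.
have [x hx] : exists x : rat, `|re (mk p) - ratr x| < s.
  have [x] := rat_in_itvoo (ltac:(lra) : re (mk p) - s < re (mk p) + s).
  by rewrite in_itv /= -ltr_distlC => h; exists x.
have [y hy] : exists x : rat, `|im (mk p) - ratr x| < s.
  have [x0] := rat_in_itvoo (ltac:(lra) : im (mk p) - s < im (mk p) + s).
  by rewrite in_itv /= -ltr_distlC => h; exists x0.
exists (pickle (x, y, N)); first exact: I.
rewrite pickleK /G.
pose c : C := (Complex (ratr x) (ratr y) : R[i]).
change ((if `[< forall p, box c s p -> ~ F (mk p) >] then box c s else set0) p).
have pc : box c s p.
  by apply/boxP; rewrite reB imB; split; apply: ltW.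
case: ifP => // /asboolP; apply=> p' /boxP[h1 h2].
apply: hr; apply: (le_lt_trans (nm_tri c _ _)).
have h3 : nm (mk p' - c) <= s + s by apply: (le_trans (nm_le _)); lra.
have h4 : nm (c - mk p) <= s + s.
  move/boxP: pc => [h5 h6]; rewrite nmBC; apply: (le_trans (nm_le _)); lra.
by move: hN h3 h4; rewrite -/s; lra.
Qed.

Lemma area_mono (A B : set C) : closed A -> closed B -> A `<=` B -> (area A <= area B)%E.
Proof.
move=> cA cB AB; apply: (@le_measure _ _ _ mu); rewrite ?inE.
- exact: realify_measurable.
- exact: realify_measurable.
by move=> p; exact: AB.
Qed.

Definition boxes (c : nat -> C) (n : nat) (r : R) : set RR :=
  \big[setU/set0]_(i < n) box (c i) r.

Lemma boxesS c n r : boxes c n.+1 r = boxes c n r `|` box (c n) r.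
Proof. by rewrite /boxes big_ord_recr. Qed.

Lemma boxes_measurable c n r : measurable (boxes c n r).
Proof. by apply: bigsetU_measurable => i _; exact: box_measurable. Qed.

Lemma boxes_mu c n r : 0 <= r -> (mu (boxes c n r) <= (n%:R * (2 * r) ^+ 2)%:E)%E.
Proof.
move=> r0; elim: n => [|n IH]; first by rewrite /boxes big_ord0 measure0 mul0r.
rewrite boxesS.
apply: (@le_trans _ _ (mu (boxes c n r) + mu (box (c n) r))%E).
  by apply: measureU2; [exact: boxes_measurable|exact: box_measurable].
rewrite box_mu//; move: ((2 * r) ^+ 2) IH => K IH.
have -> : n.+1%:R * K = n%:R * K + K.
  by rewrite -[X in X * K]natr1 mulrDl mul1r.
by rewrite EFinD leeD2r.
Qed.

Lemma boxes_in c n r i p : (i < n)%N -> box (c i) r p -> boxes c n r p.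
Proof.
elim: n => // n IH; rewrite ltnS leq_eqVlt boxesS => /orP[/eqP <-|/IH h] hp; first by right.
by left; apply: h.
Qed.

Definition lip01 (g : R -> C) (L : R) :=
  forall s t, 0 <= s <= 1 -> 0 <= t <= 1 -> nm (g s - g t) <= L * `|s - t|.

(** [N + 1] squares of side [O(1/N)] cover the curve, for a total area [O(1/N)]. *)
Lemma curve_null (g : R -> C) (L : R) : 0 <= L -> lip01 g L ->
  forall e : R, 0 < e -> exists B : set RR, [/\ measurable B, (mu B <= e%:E)%E &
    forall t, 0 <= t <= 1 -> B (re (g t), im (g t))].
Proof.
move=> L0 hg e e0.
have [N N0 hN] : exists2 N : nat, (0 < N)%N & (2 * (L + 1)) ^+ 2 * 2 / e <= N%:R :> R.
  exists (Num.truncn ((2 * (L + 1)) ^+ 2 * 2 / e)).+1 => //.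
  exact/ltW/truncnS_gt.
have Nr : 0 < N%:R :> R by rewrite ltr0n.
pose r := (L + 1) / N%:R.
have r0 : 0 <= r by rewrite divr_ge0// addr_ge0.
exists (boxes (fun i => g (i%:R / N%:R)) N.+1 r); split; first exact: boxes_measurable.
  apply: (le_trans (boxes_mu _ _ r0)); rewrite lee_fin.
  have h : N.+1%:R <= 2 * N%:R :> R by rewrite -natrM ler_nat mul2n -addnn -addn1 leq_add2l.
  rewrite ler_pdivrMr// in hN.
  have -> : (2 * r) ^+ 2 = (2 * (L + 1)) ^+ 2 / N%:R ^+ 2.
    by rewrite /r mulrA expr_div_n.
  rewrite mulrA ler_pdivrMr ?exprn_gt0//.
  move: hN; set K := (2 * (L + 1)) ^+ 2 => hN.
  have K0 : 0 <= K by rewrite sqr_ge0.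
  have h2 := ler_wpM2r K0 h.
  have h3 := ler_wpM2r (ltW Nr) hN.
  move: h2 h3; rewrite expr2; lra.
move=> t /andP[t0 t1].
pose i := Num.truncn (t * N%:R).
have tN0 : 0 <= t * N%:R by rewrite mulr_ge0// ltW.
have i1 : i%:R <= t * N%:R by rewrite /i truncn_le.
have i2 : t * N%:R < i.+1%:R by exact: truncnS_gt.
have iN : (i <= N)%N.
  rewrite -(ler_nat R); apply: (le_trans i1); rewrite ler_piMl// ltW//.
apply: (@boxes_in _ _ _ i) => //.
have ii : 0 <= (i%:R / N%:R : R) <= 1.
  by rewrite divr_ge0//= ler_pdivrMr// mul1r ler_nat.
have d : nm (g t - g (i%:R / N%:R)) <= r.
  apply: (le_trans (hg _ _ _ ii)); first by rewrite t0 t1.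
  rewrite /r; have h : `|t - i%:R / N%:R| <= N%:R^-1.
    rewrite ger0_norm; last by rewrite subr_ge0 ler_pdivrMr.
    rewrite -(ler_pM2r Nr) mulVf ?lt0r_neq0// mulrBl divfK ?lt0r_neq0//.
    rewrite -natr1 in i2; lra.
  apply: ler_pM => //; lra.
have mkE : mk (re (g t), im (g t)) = g t by rewrite /mk /=; case: (g t).
by apply/boxP; rewrite mkE; split; apply: le_trans d; [exact: le_re|exact: le_im].
Qed.

Lemma curves_null (gs : seq (R -> C)) (L : R) : 0 <= L ->
  (forall g, List.In g gs -> lip01 g L) ->
  forall e : R, 0 < e -> exists B : set RR, [/\ measurable B, (mu B <= e%:E)%E &
    forall g t, List.In g gs -> 0 <= t <= 1 -> B (re (g t), im (g t))].
Proof.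
move=> L0; elim: gs => [|g gs IH] hgs e e0.
  by exists set0; split; rewrite ?measure0 ?lee_fin ?(ltW e0)//; exact: measurable0.
have e2 : 0 < e / 2 by lra.
have [B [mB Be hB]] := curve_null L0 (hgs g (or_introl erefl)) e2.
have [B' [mB' Be' hB']] := IH (fun g' h => hgs g' (or_intror h)) _ e2.
exists (B `|` B'); split; first exact: measurableU.
  apply: (@le_trans _ _ (mu B + mu B')%E); first exact: measureU2.
  have -> : (e%:E = (e / 2)%:E + (e / 2)%:E)%E by rewrite -EFinD -splitr.
  exact: leeD.
by move=> g' t [<-|hg] ht; [left; apply: hB|right; apply: hB'].
Qed.

Lemma area_le_box (S : set C) (r : R) : closed S -> 0 <= r -> (forall z, S z -> nm z <= r) ->
  (area S <= ((2 * r) ^+ 2)%:E)%E.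
Proof.
move=> cS r0 hS; rewrite -(box_mu 0 r0).
apply: (@le_measure _ _ _ mu); rewrite ?inE; [exact: realify_measurable|exact: box_measurable|].
move=> p Sp; apply/boxP; rewrite subr0; have := hS _ Sp.
by move=> h; split; apply: le_trans h; [exact: le_re|exact: le_im].
Qed.

Lemma area_fin (S : set C) (r : R) : closed S -> 0 <= r -> (forall z, S z -> nm z <= r) ->
  (area S < +oo)%E.
Proof. by move=> cS r0 hS; apply: (le_lt_trans (area_le_box cS r0 hS)); rewrite ltry. Qed.

(** Continuity of the measure from below, the rest of [S] being covered by curves of area zero. *)
Lemma area_exhaust (S : set C) (E : nat -> set C) (gs : seq (R -> C)) (L r : R) :
  closed S -> 0 <= r -> (forall z, S z -> nm z <= r) ->
  (forall n, closed (E n)) -> (forall n, E n `<=` E n.+1) ->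
  0 <= L -> (forall g, List.In g gs -> lip01 g L) ->
  (forall z, S z -> (exists n, E n z) \/ exists g t, [/\ List.In g gs, 0 <= t <= 1 & g t = z]) ->
  forall e : R, 0 < e -> exists n, (area S <= area (E n) + e%:E)%E.
Proof.
move=> cS r0 Sr cE EE L0 hgs cov e e0.
have e2 : 0 < e / 2 by lra.
have [B [mB Be hB]] := curves_null L0 hgs e2.
pose U := \bigcup_n realify (E n).
have mE n : measurable (realify (E n)) by exact: realify_measurable.
have mU : measurable U by apply: bigcup_measurable => n _.
have le1 : (area S <= mu U + (e / 2)%:E)%E.
  apply: (@le_trans _ _ (mu (U `|` B))).
    apply: (@le_measure _ _ _ mu); rewrite ?inE; [exact: realify_measurable|exact: measurableU|].
    move=> p /cov[[n En]|[g [t [gin ht gt]]]]; first by left; exists n.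
    by right; have := hB g t gin ht; rewrite gt; case: p gt.
  apply: (le_trans (measureU2 mu mU mB)).
  by apply: leeD.
have homoE : {homo (fun n => realify (E n)) : n m / (n <= m)%N >-> (n <= m)%O}.
  move=> n m /subnK <-; apply/subsetPset; elim: (m - n)%N => // i IH.
  rewrite addSn; apply: subset_trans IH _ => p; exact: EE.
have cv := @nondecreasing_cvg_mu _ _ R mu _ mE mU homoE.
have fS := area_fin cS r0 Sr.
have [//|H] := pselect (exists n, (area S <= area (E n) + e%:E)%E).
exfalso.
have lt n : (area (E n) + e%:E < area S)%E.
  by rewrite ltNge; apply/negP => h; apply: H; exists n.
have : (mu U + e%:E <= area S)%E.
  rewrite -leeBrDr//.
  have := cvg_lim (@ereal_hausdorff R) cv => <-.
  apply: lime_le; first by apply/cvg_ex; eexists; exact: cv.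
  by near=> n; rewrite leeBrDr//; apply/ltW; exact: lt.
move=> h; have h' := le_trans h le1.
have Uf : mu U \is a fin_num.
  rewrite ge0_fin_numE//; apply: le_lt_trans fS.
  by apply: le_trans h; rewrite leeDl// lee_fin ltW.
move: h'; rewrite leeD2lE// lee_fin; lra.
Unshelve. all: by end_near.
Qed.

Lemma area_nested (K : nat -> set C) (r : R) (c : \bar R) : 0 <= r ->
  (forall n, compact (K n)) -> (forall n, K n.+1 `<=` K n) -> (forall z, K 0%N z -> nm z <= r) ->
  (forall n, c <= area (K n))%E -> (c <= area (\bigcap_n K n))%E.
Proof.
move=> r0 cK sK K0 hc.
have mK n : measurable (realify (K n)) by apply: realify_measurable; exact: compact_closed_nm.
have mI : measurable (\bigcap_n realify (K n)) by apply: bigcap_measurable.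
have homoK : {homo (fun n => realify (K n)) : n m / (n <= m)%N >-> (m <= n)%O}.
  move=> n m /subnK <-; apply/subsetPset; elim: (m - n)%N => // i IH.
  rewrite addSn; apply: subset_trans IH => p; exact: sK.
have f0 : (mu (realify (K 0%N)) < +oo)%E.
  exact: (area_fin (compact_closed_nm (cK 0%N)) r0 K0).
have cv := @nonincreasing_cvg_mu _ _ R mu _ f0 mK mI homoK.
have -> : area (\bigcap_n K n) = mu (\bigcap_n realify (K n)).
  by congr (mu _); rewrite eqEsubset; split=> p h i Ii; exact: h.
have <- := cvg_lim (@ereal_hausdorff R) cv.
apply: lime_ge; first by apply/cvg_ex; eexists; exact: cv.
by near=> n; exact: hc.
Unshelve. all: by end_near.
Qed.

Lemma area_disc1 : (1%:E <= area (@disc R 1))%E.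
Proof.
have -> : (1%:E = mu (box 0 (1 / 2)))%E.
  rewrite box_mu; last lra.
  by congr (_%:E); field.
apply: (@le_measure _ _ _ mu); rewrite ?inE; [exact: box_measurable| |].
  by apply: realify_measurable; exact: disc_closed.
move=> p /boxP[]; rewrite subr0 realifyE /disc /= => h1 h2.
apply: (le_trans (nm_le _)); lra.
Qed.

End Area.

(** * Lifts of rotations *)

Section Rotc.
Variable R : realType.
Local Notation C := (Cx R).
Implicit Types a b : R.

Lemma rotcD a b : rotc (a + b) = rotc a * rotc b.
Proof.
apply: ceq.
  by rewrite reM /rotc /re /im /= mulrDr cosD.
by rewrite imM /rotc /re /im /= mulrDr sinD; ring.
Qed.

Lemma rotc0 : rotc (0 : R) = 1.
Proof. by apply: ceq; rewrite /rotc /re /im /= mulr0 ?cos0 ?sin0. Qed.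

Lemma rotc1 : rotc (1 : R) = 1.
Proof.
by apply: ceq; rewrite /rotc /re /im /= mulr1 mulr_natl ?cos2pi ?sin2pi.
Qed.

Lemma rotc_half : rotc (1 / 2 : R) = -1.
Proof.
have e : 2 * pi * (1 / 2) = pi :> R by field.
by apply: ceq; rewrite /rotc ?reN ?imN /re /im /= e ?cospi ?sinpi ?oppr0.
Qed.

Lemma rotcX a n : rotc a ^+ n = rotc (n%:R * a).
Proof.
elim: n => [|n IH]; first by rewrite mul0r rotc0 expr0.
by rewrite exprS IH -natr1 mulrDl mul1r addrC rotcD.
Qed.

Lemma rotc_nat n : rotc (n%:R : R) = 1.
Proof. by rewrite -[n%:R]mulr1 -rotcX rotc1 expr1n. Qed.

Lemma nm_rotc a : nm (rotc a) = 1.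
Proof. by rewrite /nm /rotc /= cos2Dsin2 sqrtr1. Qed.

Lemma cos_lip (x y : R) : `|cos x - cos y| <= `|x - y|.
Proof.
wlog xy : x y / x <= y.
  move=> H; case: (leP x y) => [|/ltW] h; first exact: H.
  by rewrite distrC (distrC x); exact: H.
have [|c _ e] := @MVT_segment R cos (fun t => - sin t) x y xy.
  by apply/continuous_subspaceT => t; exact: continuous_cos.
by rewrite distrC e normrM normrN (distrC x) ler_piMl// ler_norml sin_geN1 sin_le1.
Qed.

Lemma sin_lip (x y : R) : `|sin x - sin y| <= `|x - y|.
Proof.
wlog xy : x y / x <= y.
  move=> H; case: (leP x y) => [|/ltW] h; first exact: H.
  by rewrite distrC (distrC x); exact: H.
have [|c _ e] := @MVT_segment R sin cos x y xy.
  by apply/continuous_subspaceT => t; exact: continuous_sin.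
by rewrite distrC e normrM (distrC x) ler_piMl// ler_norml cos_geN1 cos_le1.
Qed.

(** Each coordinate contributes [2 * pi]. *)
Lemma rotc_lip a b : nm (rotc a - rotc b) <= 4 * pi * `|a - b|.
Proof.
have := nm_le (rotc a - rotc b); rewrite reB imB /rotc /re /im /= => h.
apply: (le_trans h).
have h1 := cos_lip (2 * pi * a) (2 * pi * b).
have h2 := sin_lip (2 * pi * a) (2 * pi * b).
have p0 := pi_ge0 R.
rewrite -mulrBr normrM ger0_norm ?mulr_ge0// in h1 h2.
lra.
Qed.

Lemma polar (v : C) : nm v = 1 -> exists2 t : R, 0 <= t <= 1 & rotc t = v.
Proof.
move=> v1; have pp := pi_gt0 R.
have s := nm_sqr v; rewrite v1 expr1n in s.
have r1 : -1 <= re v <= 1 by rewrite -ler_norml -v1 le_re.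
pose th := acos (re v).
have th0 : 0 <= th by exact: acos_ge0.
have thp : th <= pi by exact: acos_lepi.
have cth : cos th = re v by rewrite acosK// in_itv.
have sth : sin th = `|im v|.
  rewrite sin_acos//; have -> : 1 - re v ^+ 2 = im v ^+ 2 by rewrite s; ring.
  by rewrite sqrtr_sqr.
have p2 : 0 < 2 * pi :> R by rewrite mulr_gt0.
have t01 : 0 <= th / (2 * pi) <= 1.
  apply/andP; split; first by rewrite divr_ge0// ltW.
  by rewrite (ler_pdivrMr _ _ p2) mul1r; lra.
have e : 2 * pi * (th / (2 * pi)) = th by rewrite mulrC divfK// lt0r_neq0.
case: (leP 0 (im v)) => h.
  exists (th / (2 * pi)) => //.
  by apply: ceq; rewrite /rotc /re /im /= e ?cth ?sth ?ger0_norm.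
exists (1 - th / (2 * pi)).
  by case/andP: t01 => a b; apply/andP; split; lra.
have e' : 2 * pi * (1 - th / (2 * pi)) = - th + pi *+ 2.
  by rewrite mulrBr e mulr1 addrC mulr_natl.
apply: ceq; rewrite /rotc /re /im /= e'.
  by rewrite cosD2pi cosN cth.
by rewrite sinD2pi sinN sth ltr0_norm ?opprK.
Qed.

End Rotc.

(** * Local inverses of polynomials and lifts through them *)

Section Lift.
Variable R : realType.
Local Notation C := (Cx R).

Lemma poly_lip (h : {poly C}) (r : R) : exists2 B, 0 < B & forall x y, nm x <= r -> nm y <= r ->
  nm (h.[x] - h.[y]) <= B * nm (x - y).
Proof.
have [B B0 hB] := poly_bounded (deriv h) r.
exists B => // x y hx hy.
apply: (@mvt_ball R (fun z => h.[z]) (fun z => (deriv h).[z]) 0 r); rewrite ?subr0//.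
by move=> z; rewrite subr0 => hz; split; [exact: hasd_poly|exact: hB].
Qed.

(** An inverse function theorem with [r0] uniform in [z0]: on the ball, [h] minus its linear part
    has Lipschitz constant [m / 2], and Newton iteration with the derivative frozen at [z0]
    converges. Centres in the disc [3] and [r0 <= 1] keep everything in the disc [4]. *)
Lemma local_inv (h : {poly C}) (m : R) : 0 < m ->
  (forall z, nm z <= 4 -> m <= nm (deriv h).[z]) ->
  exists r0 : R, [/\ 0 < r0, r0 <= 1 & forall z0, nm z0 <= 3 ->
   (forall x y, nm (x - z0) <= r0 -> nm (y - z0) <= r0 -> nm (x - y) <= 2 / m * nm (h.[x] - h.[y])) /\
   (forall r c, 0 <= r <= r0 -> nm (c - h.[z0]) <= m / 2 * r -> exists x, nm (x - z0) <= r /\ h.[x] = c)].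
Proof.
move=> m0 hm.
have [B B0 hB] := poly_lip (deriv h) 4.
pose r0 := Num.min 1 (m / (2 * B)).
have r00 : 0 < r0 by rewrite lt_min ltr01 divr_gt0// mulr_gt0.
have r01 : r0 <= 1 by rewrite ge_min lexx.
have r0B : B * r0 <= m / 2.
  have B2 : 0 < 2 * B by rewrite mulr_gt0.
  have : r0 <= m / (2 * B) by rewrite ge_min lexx orbT.
  by rewrite (ler_pdivlMr _ _ B2); lra.
exists r0; split=> // z0 hz0.
have in4 x : nm (x - z0) <= r0 -> nm x <= 4.
  by move=> hx; have := nmBge x z0; move: hx r01 hz0; lra.
pose D := (deriv h).[z0].
have mD : m <= nm D by apply: hm; lra.
have est x y : nm (x - z0) <= r0 -> nm (y - z0) <= r0 ->
    nm (h.[x] - h.[y] - D * (x - y)) <= m / 2 * nm (x - y).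
  move=> hx hy.
  have -> : h.[x] - h.[y] - D * (x - y) = (h.[x] - D * x) - (h.[y] - D * y) by ring.
  apply: (@mvt_ball R (fun z => h.[z] - D * z) (fun z => (deriv h).[z] - D) z0 r0) => //.
  move=> z hz; split.
    by have := hasdB (hasd_poly h z) (hasdMl D (hasd_id z)); rewrite mulr1.
  apply: le_trans (hB _ _ (in4 _ hz) _) _; first lra.
  by apply: le_trans r0B; rewrite ler_wpM2l// ltW.
have D0 : D != 0 by apply: nm_neq0; lra.
split=> [x y hx hy|r c /andP[rr0 rr1] hc].
  have := est x y hx hy; have := nmBge (D * (x - y)) (h.[x] - h.[y]).
  rewrite nmBC nmM => e1 e2.
  have e3 := ler_wpM2r (nm_ge0 (x - y)) mD.
  rewrite mulrAC ler_pdivlMr//; lra.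
have [||x [hx1 hx2]] := @half_fixpoint R (fun x => x - (h.[x] - c) / D) z0 r rr0.
- move=> x hx.
  have hz : nm (z0 - z0) <= r0 by rewrite subrr nm0 ltW.
  have e := est x z0 (le_trans hx rr1) hz.
  have -> : x - (h.[x] - c) / D - z0 =
     (c - h.[z0]) / D - (h.[x] - h.[z0] - D * (x - z0)) / D by field.
  apply: (le_trans (nmB _ _)); rewrite !nm_div -mulrDl ler_pdivrMr; last lra.
  have := ler_wpM2l (ltac:(lra) : 0 <= m / 2) hx.
  have := ler_wpM2r rr0 mD; move: e hc; lra.
- move=> x y hx hy.
  have e := est x y (le_trans hx rr1) (le_trans hy rr1).
  have -> : x - (h.[x] - c) / D - (y - (h.[y] - c) / D) =
     - ((h.[x] - h.[y] - D * (x - y)) / D) by field.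
  rewrite nmN nm_div ler_pdivrMr; last lra.
  have := ler_wpM2r (nm_ge0 (x - y)) mD; move: e; lra.
exists x; split=> //.
have e : (h.[x] - c) / D = 0 by have := hx2; move/eqP; rewrite subr_eq addrC -subr_eq subrr => /eqP.
by apply/eqP; rewrite -subr_eq0; move/eqP: e; rewrite mulf_eq0 invr_eq0 (negbTE D0) orbF.
Qed.

(** The last identity is the second one differentiated; it determines [f1 z] when the derivative of
    [h] is nonzero at [f z]. *)
Definition is_lift (h : {poly C}) (l : C) (f f1 : C -> C) := forall z, nm z < 2 ->
  [/\ hasd f z (f1 z), h.[f z] = l * h.[z] & f1 z * (deriv h).[f z] = l * (deriv h).[z]].

(** The new lift solves [h (f' z) = l' * h z] near [f z]. The radius of uniqueness [r0] is fixed
    before [e]; uniqueness later identifies [f'] on the image of the inverse branch. *)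
Lemma lift_perturb (h : {poly C}) (m : R) (l : C) (f f1 : C -> C) : 0 < m ->
  (forall z, nm z <= 4 -> m <= nm (deriv h).[z]) -> nm l = 1 ->
  is_lift h l f f1 -> (forall z, nm z < 2 -> nm (f z) <= 3) ->
  exists2 r0 : R, 0 < r0 & forall e : R, 0 < e -> exists2 d : R, 0 < d & forall l',
    nm l' = 1 -> nm (l' - l) <= d -> exists f' f1',
    [/\ is_lift h l' f' f1',
        forall z, nm z < 2 -> nm (f' z - f z) <= e /\ nm (f1' z - f1 z) <= e &
        forall z x, nm z < 2 -> nm (x - f z) <= r0 -> h.[x] = l' * h.[z] -> f' z = x].
Proof.
move=> m0 hm l1 lf f3.
have [r0 [r00 r01 hr0]] := local_inv m0 hm.
exists r0 => // e e0.
have [H H0 hH] := poly_bounded h 4.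
have [H1 H10 hH1] := poly_bounded (deriv h) 4.
have [B B0 hB] := poly_lip (deriv h) 4.
(* [r0 / 4] keeps nearby values of [f'] in one ball where [h] is injective; the last bound controls
   the derivative, as [B * rho] bounds the variation of [deriv h]. *)
pose rho := Num.min (Num.min (r0 / 4) e) (e * m ^+ 2 / (2 * H1 * B)).
have m20 : 0 < m ^+ 2 by rewrite exprn_gt0.
have HB : 0 < 2 * H1 * B by rewrite !mulr_gt0.
have rho0 : 0 < rho.
  rewrite !lt_min e0 andbT; apply/andP; split; first lra.
  by rewrite divr_gt0// mulr_gt0.
have [rho1 rho2 rho3] : [/\ rho <= r0 / 4, rho <= e & rho <= e * m ^+ 2 / (2 * H1 * B)].
  by rewrite /rho !ge_min !lexx ?orbT.
pose d := Num.min (m / 2 * rho / H) (e * m / (2 * H1)).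
have mr0 : 0 < m / 2 * rho by rewrite mulr_gt0//; lra.
have H12 : 0 < 2 * H1 by rewrite mulr_gt0.
have d0 : 0 < d by rewrite lt_min !divr_gt0// mulr_gt0.
have d1 : d * H <= m / 2 * rho.
  by rewrite -(ler_pdivlMr _ _ H0) ge_min lexx.
have d2 : d * (2 * H1) <= e * m.
  by rewrite -(ler_pdivlMr _ _ H12) ge_min lexx orbT.
exists d => // l' l'1 ll'.
have ex z : exists x, nm z < 2 -> nm (x - f z) <= rho /\ h.[x] = l' * h.[z].
  have [z2|] := boolP (nm z < 2); last by exists 0.
  have [hf hfl _] := lf z z2.
  have [_ /(_ rho (l' * h.[z]))] := hr0 _ (f3 _ z2).
  rewrite hfl -mulrBl nmM => hh.
  have [||x hx] := hh; last by exists x.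
    by rewrite ltW//=; lra.
  apply: le_trans d1; apply: ler_pM; rewrite ?nm_ge0//; apply: hH; lra.
have [f' hf'] := choice ex.
pose f1' z := l' * (deriv h).[z] / (deriv h).[f' z].
have f'4 z : nm z < 2 -> nm (f' z) <= 4.
  move=> z2; have [h1 _] := hf' z z2.
  by have := nmBge (f' z) (f z); have := f3 z z2; move: h1 rho1 r01; clear; lra.
have D1 z : nm z < 2 -> m <= nm (deriv h).[f' z] by move=> z2; apply/hm/f'4.
have D1n z : nm z < 2 -> (deriv h).[f' z] != 0.
  by move=> z2; apply: nm_neq0; have := D1 z z2; move: m0; clear; lra.
exists f', f1'; split.
- move=> z z2; have [hf hfl hf1] := lf z z2; have [h1 h2] := hf' z z2.
  split=> //; last by rewrite /f1' divfK// D1n.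
  have near2 : 0 < 2 - nm z by lra.
  have nz x : nm (x - z) < 2 - nm z -> nm x < 2 by have := nmBge x z; clear; lra.
  (* [f'] was chosen pointwise; its continuity follows from the injectivity of [h] on the [r0]-ball
     about [f z]. *)
  apply: (@hasd_branch R f' (fun x => h.[x])) (hasd_poly h _) (D1n _ z2) _.
    move=> ee ee0.
    have r04 : 0 < r0 / 4 by lra.
    have [da da0 hda] := hasd_cont hf r04.
    have k0 : 0 < ee * m / 2 by rewrite divr_gt0// mulr_gt0.
    have [db db0 hdb] := hasd_cont (hasd_poly h z) k0.
    exists (Num.min (2 - nm z) (Num.min da db)); first by rewrite !lt_min near2 da0.
    move=> x; rewrite !lt_min => /andP[/nz x2 /andP[/hda xa /hdb xb]].
    have [h3 h4] := hf' x x2.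
    have [inj _] := hr0 _ (f3 _ z2).
    have h5 : nm (f' x - f z) <= r0.
      apply: (le_trans (nm_tri (f x) _ _)); move: h3 xa rho1; lra.
    have h6 : nm (f' z - f z) <= r0 by move: h1 rho1; lra.
    apply: (le_trans (inj _ _ h5 h6)).
    rewrite h4 h2 -mulrBr nmM l'1 mul1r mulrC mulrA ler_pdivrMr//.
    move: xb; clear; lra.
  apply: (hasd_ext (f := fun x => l' * h.[x]) near2).
    by move=> x /nz /hf'[].
  exact: hasdMl (hasd_poly h z).
- move=> z z2; have [h1 h2] := hf' z z2; have [hf hfl hf1] := lf z z2.
  split; first exact: le_trans h1 rho2.
  have z4 : nm z <= 4 by lra.
  have D0 : m <= nm (deriv h).[f z] by apply: hm; have := f3 z z2; clear; lra.
  have D0n : (deriv h).[f z] != 0 by apply: nm_neq0; lra.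
  have -> : f1 z = l * (deriv h).[z] / (deriv h).[f z] by rewrite -hf1 mulfK.
  have Dn := D1n z z2; have Dm := D1 z z2.
  have lip : nm ((deriv h).[f z] - (deriv h).[f' z]) <= B * rho.
    apply: le_trans (hB _ _ _ (f'4 _ z2)) _; first by have := f3 z z2; clear; lra.
    by rewrite ler_wpM2l ?(ltW B0)// nmBC.
  rewrite /f1'; move: (hH1 z z4) Dn Dm D0 D0n lip.
  move: ((deriv h).[z]) ((deriv h).[f z]) ((deriv h).[f' z]) => p q s hp s0 sm qm q0 lip.
  have -> : l' * p / s - l * p / q = (l' - l) * (p / s) + l * p * (q - s) / (s * q).
    by field; rewrite s0 q0.
  apply: (le_trans (nmD _ _)); rewrite !nmM !nmV !nmM l1 mul1r.
  have iV x : m <= nm x -> (nm x)^-1 <= m^-1.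
    by move=> hx; rewrite lef_pV2 ?posrE//; lra.
  have i0 (x : C) : 0 <= (nm x)^-1 by rewrite invr_ge0 nm_ge0.
  have a1 : nm (l' - l) * (nm p * (nm s)^-1) <= d * (H1 * m^-1).
    apply: ler_pM; rewrite ?mulr_ge0 ?nm_ge0//; apply: ler_pM; rewrite ?nm_ge0//; exact: iV.
  have a2 : nm p * nm (q - s) * (nm s * nm q)^-1 <= H1 * (B * rho) * (m^-1 * m^-1).
    rewrite invfM; apply: ler_pM; rewrite ?mulr_ge0 ?nm_ge0//.
      by apply: ler_pM; rewrite ?nm_ge0.
    by apply: ler_pM; rewrite ?iV.
  have b1 : d * (H1 * m^-1) <= e / 2.
    rewrite mulrA ler_pdivrMr//; move: d2; clear; lra.
  have b2 : H1 * (B * rho) * (m^-1 * m^-1) <= e / 2.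
    rewrite -invfM -expr2 ler_pdivrMr//.
    rewrite (ler_pdivlMr _ _ HB) in rho3; move: rho3; clear; lra.
  lra.
- move=> z x z2 xr hx; have [h1 h2] := hf' z z2.
  have [inj _] := hr0 _ (f3 _ z2).
  have h6 : nm (f' z - f z) <= r0 by move: h1 rho1; lra.
  have := inj _ _ h6 xr; rewrite h2 hx subrr nm0 mulr0 => h7.
  by apply/eqP; rewrite -subr_eq0; apply/eqP/nm_eq0/eqP; rewrite eq_le h7 nm_ge0.
Qed.

End Lift.

(** * One step of the construction *)

Section Step.
Variable R : realType.
Local Notation C := (Cx R).

(* A stage is a dyadic angle [sa], a polynomial [sh], the lift [sf] of the rotation
   by [sa] through [sh] (so [sh (sf z) = rotc sa * sh z]), the derivative [sf1] of
   [sf], and the branch [sPsi] of the inverse of [sh] on the unit disc, whose image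
   [sK] is a closed Siegel disc of [sf]; [sb] bounds the displacement of [sf] and
   records the error spent so far. *)
Record stage := Stage { sk : nat; sa : R; sb : R; sh : {poly C}; sf : C -> C;
  sf1 : C -> C; sPsi : C -> C }.

Definition sq s := (2 ^ (sk s).+1)%N.

Definition good s :=
  [/\ exists n : nat, sa s = n%:R / (sq s)%:R,
      exists2 m, 0 < m & forall z, nm z <= 4 -> m <= nm (deriv (sh s)).[z],
      is_lift (sh s) (rotc (sa s)) (sf s) (sf1 s) &
      forall z, nm z < 2 -> nm (sf s z - z) <= sb s] /\
  [/\ exists2 L, 0 < L & lip_disc (sPsi s) L,
      forall y, nm y <= 1 -> [/\ (sh s).[sPsi s y] = y, nm (sPsi s y) <= 1 &
        sf s (sPsi s y) = sPsi s (rotc (sa s) * y)] &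
      sPsi s 0 = 0].

Definition sK s : set C := sPsi s @` disc 1.

Lemma sK_compact s : good s -> compact (sK s).
Proof. by move=> [_ [[L _ hL] _ _]]; exact: (@lip_image_compact R 1 L). Qed.

Lemma sK_connected s : good s -> connected (sK s).
Proof. by move=> [_ [[L _ hL] _ _]]; apply: (@lip_image_connected R 1 L). Qed.

Lemma good_rotq s : good s -> rotc (sa s) ^+ sq s = 1.
Proof.
move=> [[[n ->] _ _ _] _]; rewrite rotcX mulrC divfK ?rotc_nat//.
by rewrite pnatr_eq0 expn_eq0.
Qed.

Lemma iter_conj s n y : good s -> nm y <= 1 ->
  iter n (sf s) (sPsi s y) = sPsi s (rotc (sa s) ^+ n * y).
Proof.
move=> [_ [_ h _]] y1; elim: n => [|n IH]; first by rewrite expr0 mul1r.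
rewrite iterS IH; have [|_ _ ->] := h (rotc (sa s) ^+ n * y).
  by rewrite nmM nmX nm_rotc expr1n mul1r.
by rewrite mulrA -exprS.
Qed.

(** The directions of the slits, as a finite list of radii to be covered by [curves_null]. *)
Lemma root_list (q : nat) : (0 < q)%N -> exists rs : seq C, forall w, w ^+ q = -1 -> List.In w rs.
Proof.
move=> q0; have [rs hrs] := closed_field_poly_normal ('X^q + 1%:P : {poly C}).
exists rs => w wq.
have : root ('X^q + 1%:P) w by rewrite /root hornerD hornerXn hornerC wq addNr.
rewrite hrs rootZ; last first.
  by rewrite lead_coef_eq0 -size_poly_eq0 size_XnaddC.
rewrite root_prod_XsubC; elim: (rs) => // x l IH; rewrite inE => /orP[/eqP ->|/IH h].
  by left.
by right.
Qed.

Lemma In_map (T S : Type) (f : T -> S) (x : T) (l : seq T) : List.In x l -> List.In (f x) (map f l).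
Proof. by elim: l => //= a l IH [->|/IH h]; [left|right]. Qed.

(** Images of discs with radius tending to [1] exhaust the disc up to its boundary circle and the
    radii in the directions [w ^ q = -1]; these stay null under the Lipschitz map [Psi]. *)
Lemma area_step (Psi slit : C -> C) (L : R) (q : nat) (e : R) : (0 < q)%N -> 0 < L -> lip_disc Psi L ->
  (forall y, nm y <= 1 -> nm (Psi y) <= 1) ->
  (forall y, nm y < 1 -> nm (slit y) <= 1) -> slit_covers q slit -> 0 < e ->
  exists2 r : R, r < 1 & closed (Psi @` (slit @` disc r)) /\
    (area (Psi @` disc 1) <= area (Psi @` (slit @` disc r)) + e%:E)%E.
Proof.
move=> q0 L0 hL Psi1 p01 [surj plip] e0.
have [rs hrs] := @root_list q q0.
pose r (n : nat) : R := 1 - n.+1%:R^-1.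
have r1 n : r n < 1 by rewrite /r ltrBlDr ltrDl invr_gt0.
pose E n : set C := Psi @` (slit @` disc (r n)).
have cE n : closed (E n).
  have -> : E n = (Psi \o slit) @` disc (r n) by rewrite /E image_comp.
  have [M M0 hM] := plip (r n) (r1 n).
  apply: compact_closed_nm; apply: (@lip_image_compact R (r n) (L * M)) => x y hx hy /=.
  apply: (le_trans (hL _ _ (p01 _ (le_lt_trans hx (r1 n))) (p01 _ (le_lt_trans hy (r1 n))))).
  by rewrite -mulrA ler_wpM2l ?(ltW L0)// hM.
have EE n : E n `<=` E n.+1.
  move=> _ [_ [y hy <-] <-]; exists (slit y) => //; exists y => //.
  apply: le_trans hy _; rewrite /r lerD2l lerN2 lef_pV2 ?posrE// ler_nat//.
pose gs := (fun t : R => Psi (rotc t)) :: [seq (fun t : R => Psi (rc t * w)) | w <- [seq w <- rs | nm w == 1]].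
have L' : 0 <= 4 * pi * L + L by rewrite addr_ge0 ?mulr_ge0 ?pi_ge0 ?(ltW L0).
have p4 : 0 <= 4 * pi :> R by rewrite mulr_ge0 ?pi_ge0.
have hgs g : List.In g gs -> lip01 g (4 * pi * L + L).
  move=> [<-|gin] s t s01 t01.
    apply: (le_trans (hL _ _ _ _)); rewrite ?nm_rotc//.
    have := ler_wpM2l (ltW L0) (rotc_lip s t).
    have := mulr_ge0 (ltW L0) (normr_ge0 (s - t)); lra.
  move: gin; elim: (rs) => //= w l IH; case: ifP => //= /eqP w1 [<-|//].
  have nw x : 0 <= x <= 1 -> nm (rc x * w) <= 1.
    by move=> /andP[x0 x1]; rewrite nmM w1 mulr1 nm_rc ger0_norm.
  apply: (le_trans (hL _ _ (nw _ s01) (nw _ t01))).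
  rewrite -mulrBl -rcB nmM w1 mulr1 nm_rc mulrDl lerDr.
  by rewrite mulr_ge0// mulr_ge0// ltW.
have [||||n hn] := @area_exhaust R (Psi @` disc 1) E gs (4 * pi * L + L) 1 _ _ _ cE EE L' hgs _ e e0.
- by apply: compact_closed_nm; exact: (@lip_image_compact R 1 L).
- by [].
- by move=> _ [y hy <-]; exact: Psi1.
- move=> _ [v hv <-].
  have [v1|nv1] := boolP (nm v < 1); last first.
    have [|t ht tv] := @polar R v.
      by apply/eqP; rewrite eq_le hv /= leNgt.
    by right; exists (fun t : R => Psi (rotc t)), t; split=> //; [left|rewrite tv].
  have [H|H] := pselect (im (v ^+ q) = 0 -> 0 <= re (v ^+ q)).
    left; have [y [y1 yv]] := surj v v1 H.
    exists (Num.truncn (1 - nm y)^-1); exists v => //; exists y => //.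
    rewrite /disc /= /r lerBrDr -lerBrDl -[leRHS]invrK lef_pV2 ?posrE ?invr_gt0 ?subr_gt0//.
    exact/ltW/truncnS_gt.
  right; have [H1 H2] : im (v ^+ q) = 0 /\ re (v ^+ q) < 0.
    split; first by apply: contrapT => h; apply: H => /h.
    by rewrite ltNge; apply/negP => h; apply: H.
  have v0 : v != 0.
    by apply/eqP => v0; move: H2; rewrite v0 expr0n eqn0Ngt q0 re0 ltxx.
  have nv := nm_gt0 v0.
  have nvC : rc (nm v) != 0 :> C by apply: nm_neq0; rewrite nm_rc gtr0_norm.
  pose w := v / rc (nm v).
  have w1 : nm w = 1 by rewrite /w nm_div nm_rc gtr0_norm// divff// lt0r_neq0.
  have wq : w ^+ q = -1.
    have E1 : v ^+ q = rc (re (v ^+ q)) by apply: ceq.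
    have E2 : re (v ^+ q) = - nm v ^+ q.
      by have := congr1 (@nm R) E1; rewrite nmX nm_rc ltr0_norm// => ->; rewrite opprK.
    by rewrite /w expr_div_n E1 E2 rcN rcX mulNr divff// expf_neq0.
  exists (fun t : R => Psi (rc t * w)), (nm v); split.
  - right; apply: In_map; have := hrs w wq; elim: (rs) => //= x l IH [->|/IH h].
      by rewrite w1 eqxx; left.
    by case: ifP => // _; right.
  - by rewrite ltW//= ltW.
  by rewrite /w mulrC divfK.
by exists (r n); [exact: r1|split; [exact: cE|exact: hn]].
Qed.


(** The new denominator is [2 * q * q * M] with [q = 2 ^ k.+1] and [M = 2 ^ j], the shape that
    closes the orbit computation in [step]. *)
Lemma pow_split (k j : nat) : (2 ^ (k + k + j).+3 = 2 * 2 ^ k.+1 * 2 ^ k.+1 * 2 ^ j)%N.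
Proof. rewrite !expnS !expnD; move: (2 ^ k)%N (2 ^ j)%N => x y; nia. Qed.

Definition refines (e : R) (s s' : stage) :=
  [/\ sK s' `<=` sK s, (area (sK s) <= area (sK s') + e%:E)%E,
      nm (sPsi s' 1 - sPsi s 1) <= e,
      exists z k, [/\ sK s' z, nm z <= e & iter k (sf s') z = sPsi s' 1] &
      [/\ sa s < sa s', sa s' <= sa s + e, sb s' = sb s + e &
          forall z, nm z < 2 -> nm (sf s' z - sf s z) <= e /\ nm (sf1 s' z - sf1 s z) <= e]].

Lemma is_lift_comp (h g : {poly C}) (l : C) (f f1 : C -> C) :
  (forall v, g.[l * v] = l * g.[v] /\ (deriv g).[l * v] = (deriv g).[v]) ->
  is_lift h l f f1 -> is_lift (g \Po h) l f f1.
Proof.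
move=> hg hf z z2; have [h1 h2 h3] := hf z z2; split=> //.
  by rewrite !horner_comp h2; case: (hg h.[z]).
rewrite deriv_comp !hornerM !horner_comp h2.
by have [_ ->] := hg h.[z]; rewrite mulrCA h3 mulrCA.
Qed.

Lemma step (s : stage) (e : R) : good s -> sb s <= 1 / 2 -> 0 < e -> exists s', good s' /\ refines e s s'.
Proof.
move=> gs sb2 e0; have rq := good_rotq gs.
move: s gs sb2 rq => [k a b h f f1 Psi]; rewrite /good /refines /sK /sq /=.
move=> [[[n ha] [m m0 hm] hl hb] [[L L0 hL] hPsi Psi0]] b2 rq.
pose q := (2 ^ k.+1)%N; rewrite -/q in ha rq.
have q0 : (0 < q)%N by rewrite expn_gt0.
have qr : 0 < q%:R :> R by rewrite ltr0n.
pose l := rotc a; rewrite -/l in hl rq.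
have l1 : nm l = 1 by exact: nm_rotc.
have Psi1 y : nm y <= 1 -> nm (Psi y) <= 1 by move=> /hPsi[].
(* [Psi] stretches distances by at most [L], so the slit map is built with precision [e / L]. *)
have eL : 0 < e / L by rewrite divr_gt0.
have [slit [cov data]] := slit_step k eL.
(* With [r1 = nm y], the data exhibit [slit y] as a value of [phi], which stays in the unit disc. *)
have p01 y : nm y < 1 -> nm (slit y) <= 1.
  move=> y1; have [g [phi [[_ _ _ hphi] [_ _ _ _ hc]]]] := data 0 (nm y) y1.
  by have [x [x1 <-]] := hc y (lexx _); case: (hphi x x1).
have [r1 r11 [cE hE]] := area_step q0 L0 hL Psi1 p01 cov e0.
(* The critical points of [g] must avoid all values of [h] on the disc [4]. *)
have [R0 R00 hR0] := poly_bounded h 4.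
have [g [phi [[[mg mg0 hmg] hg [Lp Lp0 hLp] hphi] [phi0 phirot phi1 phitip hc]]]] := data R0 r1 r11.
pose h' := g \Po h; pose Psi' y := Psi (phi y).
have hm' z : nm z <= 4 -> mg * m <= nm (deriv h').[z].
  move=> z4; rewrite deriv_comp hornerM horner_comp nmM.
  by apply: ler_pM; rewrite ?(ltW mg0) ?(ltW m0) ?hm// hmg// hR0.
have mm0 : 0 < mg * m by rewrite mulr_gt0.
have hl' : is_lift h' l f f1 by apply: is_lift_comp hl => v; exact: hg.
have f3 z : nm z < 2 -> nm (f z) <= 3.
  by move=> z2; have := hb z z2; have := nmBge (f z) z; lra.
have [r0 r00 lift] := lift_perturb mm0 hm' l1 hl' f3.
have [d d0 hd] := lift e e0.
have L'0 : 0 < L * Lp by rewrite mulr_gt0.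
have hL' : lip_disc Psi' (L * Lp).
  move=> x y hx hy; have [_ px] := hphi x hx; have [_ py] := hphi y hy.
  apply: (le_trans (hL _ _ px py)); rewrite -mulrA ler_wpM2l ?(ltW L0)//.
  exact: hLp.
(* [r0 / (L * Lp)] puts [Psi' (l' * y)] in the ball where the new lift is unique. *)
pose dd := Num.min (Num.min d (r0 / (L * Lp))) 1.
have dd0 : 0 < dd by rewrite !lt_min d0 ltr01 divr_gt0.
have [dd1 dd2] : dd <= d /\ dd <= r0 / (L * Lp) by rewrite /dd !ge_min !lexx ?orbT.
pose mu := Num.min (dd / (4 * pi)) e.
have pi4 : 0 < 4 * pi :> R by rewrite mulr_gt0// pi_gt0.
have mu0 : 0 < mu by rewrite lt_min e0 divr_gt0.
have [mu1 mu2] : mu <= dd / (4 * pi) /\ mu <= e by rewrite /mu !ge_min !lexx ?orbT.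
pose j := (Num.truncn mu^-1).+1.
pose k' := (k + k + j).+2.
pose q' := (2 ^ k'.+1)%N.
pose M := (2 ^ j)%N.
have q'E : q' = (2 * q * q * M)%N.
  exact: pow_split.
have q'0 : (0 < q')%N by rewrite expn_gt0.
have q'r : 0 < q'%:R :> R by rewrite ltr0n.
have q'mu : q'%:R^-1 <= mu.
  rewrite -[leRHS]invrK lef_pV2 ?posrE ?invr_gt0//.
  apply: (le_trans (ltW (truncnS_gt _))); rewrite ler_nat -/j.
  apply: (leq_trans (ltnW (ltn_expl j (ltnSn 1)))); rewrite -/M q'E.
  by rewrite leq_pmull// !muln_gt0 q0.
pose a' := a + q'%:R^-1.
pose l' := rotc a'.
have l'1 : nm l' = 1 by exact: nm_rotc.
have l'l : nm (l' - l) <= dd.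
  apply: (le_trans (rotc_lip _ _)); rewrite /a' addrAC subrr add0r.
  rewrite ger0_norm ?invr_ge0 ?(ltW q'r)//.
  have := le_trans q'mu mu1; rewrite (ler_pdivlMr _ _ pi4) mulrC//.
have [f' [f1' [lf' near uniq]]] := hd l' l'1 (le_trans l'l dd1).
pose s' := Stage k' a' (b + e) h' f' f1' Psi'.
have Psi'1 y : nm y <= 1 -> nm (Psi' y) <= 1 by move=> /hphi[_ /Psi1].
have hPsi' y : nm y <= 1 -> h'.[Psi' y] = y.
  move=> y1; have [e1 e2] := hphi y y1; rewrite /h' horner_comp /Psi'.
  by have [-> _ _] := hPsi _ e2.
(* Both sides solve [h' x = l' * h' (Psi' y)] close to [f (Psi' y) = Psi' (l * y)], so uniqueness
   applies. *)
have conj y : nm y <= 1 -> f' (Psi' y) = Psi' (l' * y).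
  move=> y1; have e1 := Psi'1 y y1.
  have ly1 : nm (l * y) <= 1 by rewrite nmM l1 mul1r.
  have l'y1 : nm (l' * y) <= 1 by rewrite nmM l'1 mul1r.
  apply: uniq; first lra.
    have -> : f (Psi' y) = Psi' (l * y).
      have [_ e2] := hphi y y1; rewrite /Psi'; have [_ _ ->] := hPsi _ e2.
      by rewrite phirot.
    apply: (le_trans (hL' _ _ l'y1 ly1)); rewrite -mulrBl nmM mulrC.
    rewrite (ler_pdivlMr _ _ L'0) in dd2; apply: le_trans dd2.
    rewrite ler_wpM2r ?(ltW L'0)//; apply: le_trans l'l.
    by rewrite ler_piMr ?nm_ge0.
  by rewrite !hPsi'.
have gs' : good s'.
  rewrite /good /sq /=; split; split.
  - exists (n * (2 * q * M) + 1)%N.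
    rewrite -/q' /a' ha q'E natrD natrM mulrDl mul1r; congr (_ + _).
    rewrite !natrM; field; rewrite !pnatr_eq0 -!lt0n q0 expn_gt0 //.
  - by exists (mg * m).
  - exact: lf'.
  - move=> z z2; apply: (le_trans (nm_tri (f z) _ _)).
    by have [h1 _] := near z z2; have := hb z z2; lra.
  - by exists (L * Lp).
  - by move=> y y1; split; [exact: hPsi'|exact: Psi'1|exact: conj].
  by rewrite /Psi' phi0.
exists s'; split=> //; split.
- by move=> _ [y y1 <-]; exists (phi y) => //; case: (hphi y y1).
- apply: (le_trans hE); rewrite leeD2r//; apply: area_mono => //.
    exact: compact_closed_nm (sK_compact gs').
  move=> _ [_ [y hy <-] <-]; have [x [x1 <-]] := hc y hy.
  by exists x.
- have n1 : nm 1 <= 1 :> R by rewrite nm1.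
  have [_ e2] := hphi 1 n1.
  apply: (le_trans (hL _ _ e2 n1)).
  by rewrite mulrC -(ler_pdivlMr _ _ L0).
(* The orbit starts at the tip of angle [1 / (2 q)]. Over [q * (2 q - 1) * M] steps the part
   [a = n / q] of the angle adds an integer and the part [1 / q'] adds [1 - 1 / (2 q)], so it ends
   at [1]. *)
- pose y1 := rotc (1 / (2 * q%:R) : R).
  have y1q : y1 ^+ q = -1.
    rewrite rotcX; have -> : q%:R * (1 / (2 * q%:R)) = 1 / 2 :> R by field; rewrite lt0r_neq0.
    exact: rotc_half.
  have y11 : nm y1 <= 1 by rewrite nm_rotc.
  exists (Psi' y1), (q * ((2 * q - 1) * M))%N; split; first by exists y1.
    have [_ e2] := hphi y1 y11.
    have := hL (phi y1) 0 e2; rewrite nm0 Psi0 !subr0 => /(_ ler01) h1.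
    apply: (le_trans h1); rewrite mulrC -(ler_pdivlMr _ _ L0).
    exact: phitip.
  have := iter_conj (q * ((2 * q - 1) * M)) gs' y11; rewrite /= => ->.
  rewrite -/l'; congr (Psi' _).
  rewrite /l' rotcX -rotcD /a' mulrDr.
  have -> : (q * ((2 * q - 1) * M))%:R * a = (n * ((2 * q - 1) * M))%:R.
    by rewrite ha !natrM; field; rewrite lt0r_neq0.
  rewrite -addrA rotcD rotc_nat mul1r.
  have -> : (q * ((2 * q - 1) * M))%:R / q'%:R + 1 / (2 * q%:R) = 1 :> R.
    rewrite q'E !natrM natrB ?muln_gt0// natrM; field.
    by rewrite !pnatr_eq0 -!lt0n q0 expn_gt0.
  exact: rotc1.
- split=> //.
  + by rewrite /a' ltrDl invr_gt0.
  by rewrite /a' lerD2l; apply: le_trans q'mu mu2.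
Qed.

End Step.

(** * Filling in a compact set *)

Section Fill.
Variable R : realType.
Local Notation C := (Cx R).

Definition cball (z : C) (r : R) : set C := [set y | nm (y - z) < r].

Lemma cball_connected z r : 0 < r -> connected (cball z r).
Proof.
move=> r0; apply: (@star_connected _ _ z); first by rewrite /cball /= subrr nm0.
move=> x hx t /andP[t0 t1]; rewrite /cball /= addrAC subrr add0r nmM nm_rc ger0_norm//.
by apply: le_lt_trans hx; rewrite ler_piMl ?nm_ge0.
Qed.

Lemma setT_connectedC : connected [set: C].
Proof. exact: (@star_connected _ _ 0). Qed.

Lemma halfplane_connected (f : C -> R) (c : C) :
  (forall x (t : R), f (c + rc t * (x - c)) = (1 - t) * f c + t * f x) -> 1 < f c ->
  connected [set z | 1 < f z].
Proof.
move=> hf fc; apply: (@star_connected _ _ c) => // x /= fx t /andP[t0 t1].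
rewrite hf.
have h1 : 0 <= (1 - t) * (f c - 1) by rewrite mulr_ge0//; lra.
have h2 : 0 <= t * (f x - 1) by rewrite mulr_ge0//; lra.
case: (ltP 0 t) => ht.
  have : 0 < t * (f x - 1) by rewrite mulr_gt0//; lra.
  lra.
have t00 : t = 0 by apply/eqP; rewrite eq_le t0 ht.
rewrite t00; lra.
Qed.

(** The outside of a square rather than of a disc: a chain of four half-planes, each star-shaped. *)
Definition outer : set C := [set z | 1 < `|re z| \/ 1 < `|im z|].

Lemma outer_connected : connected outer.
Proof.
pose A (i : nat) : set C := [set z | 1 < (match i with 0 => re z | 1 => im z | 2 => - re z | _ => - im z end)%N].
have -> : outer = ((A 0%N `|` A 1%N) `|` (A 2%N `|` A 3%N)) `|` (A 0%N `|` A 3%N).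
  rewrite eqEsubset; split=> z; rewrite /outer /A /=.
    rewrite !ltr_normr => -[/orP[|]|/orP[|]] h; tauto.
  by rewrite !ltr_normr => -[[[|]|[|]]|[|]] ->; rewrite ?orbT; [left|right|left|right|left|right].
have hre (s : R) (c x : C) (t : R) : s * re (c + rc t * (x - c)) = (1 - t) * (s * re c) + t * (s * re x).
  by rewrite reD reM re_rc im_rc mul0r subr0 reB; ring.
have him (s : R) (c x : C) (t : R) : s * im (c + rc t * (x - c)) = (1 - t) * (s * im c) + t * (s * im x).
  by rewrite imD imM re_rc im_rc mul0r addr0 imB; ring.
pose c (x y : R) : C := (Complex x y : R[i]).
have cA i : (i < 4)%N -> connected (A i).
  case: i => [|[|[|[|//]]]] _; rewrite /A.
  - apply: (@halfplane_connected (fun z => re z) (c 2 2)); last by rewrite /c /re /=; lra.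
    by move=> x t; have := hre 1 (c 2 2) x t; rewrite !mul1r.
  - apply: (@halfplane_connected (fun z => im z) (c 2 2)); last by rewrite /c /im /=; lra.
    by move=> x t; have := him 1 (c 2 2) x t; rewrite !mul1r.
  - apply: (@halfplane_connected (fun z => - re z) (c (- 2) 2)); last by rewrite /c /re /=; lra.
    by move=> x t; have := hre (- 1) (c (- 2) 2) x t; rewrite !mulN1r.
  - apply: (@halfplane_connected (fun z => - im z) (c 2 (- 2))); last by rewrite /c /im /=; lra.
    by move=> x t; have := him (- 1) (c 2 (- 2)) x t; rewrite !mulN1r.
have j i k x y : A i (c x y) -> A k (c x y) -> (A i `&` A k) !=set0.
  by move=> h1 h2; exists (c x y).
have c01 : connected (A 0%N `|` A 1%N).
  apply: connectedU; [apply: (j _ _ 2 2); rewrite /A /c /= /re /im /=; lra|exact: cA|exact: cA].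
have c23 : connected (A 2%N `|` A 3%N).
  apply: connectedU; [apply: (j _ _ (- 2) (- 2)); rewrite /A /c /= /re /im /=; lra|exact: cA|exact: cA].
have c03 : connected (A 0%N `|` A 3%N).
  apply: connectedU; [apply: (j _ _ 2 (- 2)); rewrite /A /c /= /re /im /=; lra|exact: cA|exact: cA].
apply: connectedU => //.
  by exists (c 2 2); split; left; [left|]; rewrite /A /c /= /re /=; lra.
apply: connectedU => //.
by exists (c (- 2) 2); split; [right|left]; rewrite /A /c /= /re /im /=; lra.
Qed.

Variable K : set C.
Hypothesis cK : compact K.
Hypothesis kK : connected K.
Hypothesis K1 : forall z, K z -> nm z <= 1.
Hypothesis K0 : K 0.

(** As [K] lies in the unit disc, [2] belongs to the unbounded component of the complement. *)
Definition inf_comp : set C := connected_component (~` K) (rc 2).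
Definition fill : set C := ~` inf_comp.

Lemma outer_sub : outer `<=` ~` K.
Proof.
move=> z hz Kz; have h := K1 Kz; have h1 := le_re z; have h2 := le_im z.
by case: hz => hz; move: hz; apply/negP; rewrite -leNgt; apply: le_trans h.
Qed.

Lemma outer2 : outer (rc 2).
Proof. by left; rewrite re_rc ger0_norm//; lra. Qed.

Lemma outer_inf : outer `<=` inf_comp.
Proof. by apply: connected_component_max; [exact: outer2|exact: outer_sub|exact: outer_connected]. Qed.

Lemma inf_subC : inf_comp `<=` ~` K.
Proof. by apply: connected_component_sub; apply: outer_sub; exact: outer2. Qed.

Lemma inf_connected : connected inf_comp.
Proof. exact: component_connected. Qed.

Lemma K_fill : K `<=` fill.
Proof. by move=> z Kz /inf_subC. Qed.

Lemma inf_absorb z r : 0 < r -> cball z r `<=` ~` K -> (cball z r `&` inf_comp) !=set0 ->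
  cball z r `<=` inf_comp.
Proof.
move=> r0 sK [y [y1 y2]].
have h : connected (inf_comp `|` cball z r).
  by apply: connectedU; [exists y|exact: inf_connected|exact: cball_connected].
have : inf_comp `|` cball z r `<=` inf_comp.
  apply: connected_component_max => //.
    by left; apply: outer_inf; exact: outer2.
  by move=> x [/inf_subC|/sK].
by move=> H x hx; apply: H; right.
Qed.

Lemma notK_ball z : ~ K z -> exists2 r : R, 0 < r & cball z r `<=` ~` K.
Proof.
move=> nK; have : open (~` K) by exact: closed_openC (compact_closed_nm cK).
by move=> /open_nmP /(_ z nK)[r r0 h]; exists r.
Qed.

Lemma inf_open : open inf_comp.
Proof.
apply/open_nmP => z iz; have [r r0 hr] := notK_ball (inf_subC iz).
exists r => //; apply: inf_absorb => //; exists z; split=> //.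
by rewrite /cball /= subrr nm0.
Qed.

Lemma fill_interior z : fill z -> ~ K z -> exists2 r : R, 0 < r & cball z r `<=` fill.
Proof.
move=> fz nK; have [r r0 hr] := notK_ball nK; exists r => // y hy iy.
apply: fz; apply: (inf_absorb r0 hr); first by exists y.
by rewrite /cball /= subrr nm0.
Qed.

Lemma fill_closed : closed fill.
Proof. exact/open_closedC/inf_open. Qed.

Lemma fill_square z : fill z -> `|re z| <= 1 /\ `|im z| <= 1.
Proof.
move=> fz; split; rewrite leNgt; apply/negP => h; apply: fz; apply: outer_inf; [by left|by right].
Qed.

(** The square has circumradius [sqrt 2 < 29/20], and [29/20] stays below [3/2], the radius on which
    [fill_invariant] inverts [f]. *)
Lemma fill_nm z : fill z -> nm z <= 29 / 20.
Proof.
move=> /fill_square; rewrite !ler_norml => -[/andP[a1 a2] /andP[b1 b2]].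
have c0 : (0 : R) <= 29 / 20 by lra.
rewrite -(ler_pXn2r (n := 2)) ?nnegrE ?nm_ge0 ?c0// nm_sqr.
have h1 : 0 <= (1 - re z) * (1 + re z) by apply: mulr_ge0; lra.
have h2 : 0 <= (1 - im z) * (1 + im z) by apply: mulr_ge0; lra.
lra.
Qed.

Lemma fill_compact : compact fill.
Proof. apply: (@compact_nm _ _ (29 / 20)); [exact: fill_closed|exact: fill_nm]. Qed.

Lemma clopen_bounded (A : set C) (r : R) : open A -> closed A -> (forall z, A z -> nm z <= r) -> A = set0.
Proof.
move=> oA cA hA; apply: contrapT => /eqP/set0P nA.
have E : A = [set: C].
  apply: setT_connectedC => //; first by exists A; rewrite ?setTI.
  by exists A; rewrite ?setTI.
have : A (rc (`|r| + 1)) by rewrite E.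
move=> /hA; rewrite nm_rc ger0_norm; last by rewrite addr_ge0.
have := ler_norm r; lra.
Qed.

(** Points of [fill] off [K] are interior to [fill], so [A] is open, closed and bounded in the
    plane. *)
Lemma fill_off_K (A V : set C) : closed A -> open V -> A = fill `&` V -> (forall z, A z -> ~ K z) -> A = set0.
Proof.
move=> cA oV AV AK; apply: (@clopen_bounded _ (29 / 20)) => //; last first.
  by move=> z; rewrite AV => -[/fill_nm].
apply/open_nmP => z Az; have nK := AK z Az.
have := Az; rewrite AV => -[fz Vz].
have [r r0 hr] := fill_interior fz nK.
have [r' r'0 hr'] := (open_nmP V).1 oV z Vz.
exists (Num.min r r'); first by rewrite lt_min r0.
by move=> y; rewrite lt_min => /andP[y1 y2]; split; [exact: hr|exact: hr'].
Qed.

(** A relatively clopen part contains all of [K] or none of it; the part that misses [K] is empty by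
    [fill_off_K]. *)
Lemma fill_connected : connected fill.
Proof.
move=> B [b0 Bb0] [V oV BV] [D cD BD].
have cB : closed B by rewrite BD; apply: closedI => //; exact: fill_closed.
have [[z [Kz Bz]]|H] := pselect ((K `&` B) !=set0); last first.
  have E : B = set0.
    by apply: (@fill_off_K B V) => // z Bz Kz; apply: H; exists z.
  by move: Bb0; rewrite E.
have KB : K `&` B = K.
  apply: kK; first by exists z.
    by exists V => //; rewrite BV setIA (setIidl K_fill).
  by exists D => //; rewrite BD setIA (setIidl K_fill).
have E : fill `&` ~` D = set0.
  apply: (@fill_off_K _ (~` D)) => //; last first.
  - move=> x [fx nDx] Kx; apply: nDx.
    by have := Kx; rewrite -KB BD => -[_ []].
  - exact: closed_openC.
  have -> : fill `&` ~` D = fill `&` ~` V.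
    rewrite eqEsubset; split=> x [fx nx]; split=> // h; apply: nx.
      by have : (fill `&` V) x by []; rewrite -BV BD => -[].
    by have : (fill `&` D) x by []; rewrite -BD BV => -[].
  by apply: closedI; [exact: fill_closed|exact: open_closedC].
rewrite BD eqEsubset; split=> [x []//|x fx]; split=> //.
by apply: contrapT => nDx; have : (fill `&` ~` D) x by []; rewrite E.
Qed.

Lemma fillC_connected : connected (~` fill).
Proof. by rewrite setCK; exact: inf_connected. Qed.

(** The part of the image inside [inf_comp] is relatively closed by compactness, and open since it
    comes from interior points of [fill] and [F] is open there. By connectedness it is empty or all
    of [inf_comp], and the latter is unbounded. *)
Lemma fill_inv (F : C -> C) (L : R) : 0 < L ->
  (forall x y, fill x -> fill y -> nm (F x - F y) <= L * nm (x - y)) ->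
  (forall z r, fill z -> 0 < r -> exists2 r' : R, 0 < r' &
     forall w, nm (w - F z) < r' -> exists2 z', nm (z' - z) < r & F z' = w) ->
  (forall z, K z -> K (F z)) -> F @` fill `<=` fill.
Proof.
move=> L0 FL Fopen FK.
have cF : compact (F @` fill).
  apply: continuous_compact; last exact: fill_compact.
  apply: within_cont_nm => x fx e e0; apply/nbhs_nmP; exists (e / L); first by rewrite divr_gt0.
  move=> y; rewrite ltr_pdivlMr// mulrC => h fy; apply: le_lt_trans h.
  exact: FL.
pose S := inf_comp `&` (F @` fill).
have oS : open S.
  apply/open_nmP => s [si [z fz Fz]].
  have nKz : ~ K z by move=> /FK; rewrite Fz; exact: inf_subC.
  have [r r0 hr] := fill_interior fz nKz.
  have [r' r'0 hr'] := Fopen z r fz r0.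
  have [r'' r''0 hr''] := (open_nmP inf_comp).1 inf_open s si.
  exists (Num.min r' r''); first by rewrite lt_min r'0.
  move=> w; rewrite lt_min => /andP[w1 w2]; split; first exact: hr''.
  by rewrite -Fz in w1; have [z' h1 h2] := hr' w w1; exists z' => //; exact: hr.
have [nS|nS] := pselect (S !=set0); last first.
  move=> w [z fz <-] iF; apply: nS; exists (F z); split=> //; by exists z.
have E : S = inf_comp.
  apply: inf_connected => //.
    by exists S => //; rewrite /S setIA setIid.
  by exists (F @` fill) => //; exact: compact_closed_nm.
exfalso.
have [z0 hz0] : exists B : R, forall z, fill z -> nm (F z) <= B.
  exists (nm (F 0) + L * 2) => z fz.
  have f0 : fill 0 by exact: K_fill.
  have := FL z 0 fz f0; rewrite subr0.
  have := ler_wpM2l (ltW L0) (fill_nm fz).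
  have := nmBge (F z) (F 0); move: L0; lra.
have : inf_comp (rc (`|z0| + 2)).
  by apply: outer_inf; left; rewrite re_rc ger0_norm ?addr_ge0//; have := normr_ge0 z0; lra.
rewrite -E => -[_ [z fz Fz]]; have := hz0 z fz; rewrite Fz nm_rc ger0_norm ?addr_ge0//.
by apply/negP; rewrite -ltNge; have := ler_norm z0; lra.
Qed.

End Fill.

(** * Round discs as Jordan domains *)

Section Jordan.
Variable R : realType.
Local Notation C := (Cx R).

Lemma cos1_small (x : R) : `|x| < 2 * pi -> cos x = 1 -> x = 0.
Proof.
move=> hx cx; have pp := pi_gt0 R.
have e : x = (x / 2) + (x / 2) by field.
have s : sin (x / 2) ^+ 2 = 0.
  have := cosD (x / 2) (x / 2); rewrite -e cx -!expr2.
  have := cos2Dsin2 (x / 2); lra.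
have {}s : sin (x / 2) = 0 by apply/eqP; rewrite -sqrf_eq0 s.
move: hx; rewrite ltr_norml => /andP[h1 h2].
case: (ltgtP x 0) => // h.
  have : 0 < sin (- (x / 2)) by apply: sin_gt0_pi; lra.
  by rewrite sinN s oppr0 ltxx.
have : 0 < sin (x / 2) by apply: sin_gt0_pi; lra.
by rewrite s ltxx.
Qed.

Lemma rotc_inj (s t : R) : 0 <= s < 1 -> 0 <= t < 1 -> rotc s = rotc t -> s = t.
Proof.
move=> /andP[s0 s1] /andP[t0 t1] st; have pp := pi_gt0 R.
have h : rotc (s - t) = 1.
  have n0 : rotc t != 0 by apply: nm_neq0; rewrite nm_rotc.
  by apply: (mulIf n0); rewrite -rotcD subrK mul1r.
have := congr1 (@re R) h; rewrite re1 /rotc /re /= => hc.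
have : 2 * pi * (s - t) = 0.
  apply: cos1_small => //; rewrite normrM ger0_norm ?mulr_ge0 ?(ltW pp)//.
  rewrite gtr_pMr ?mulr_gt0// ltr_norml; apply/andP; split; lra.
by move/eqP; rewrite !mulf_eq0 pnatr_eq0 (gt_eqF pp) /= subr_eq0 => /eqP.
Qed.

Lemma disc_jordan (r : R) : 0 < r -> jordan_domain (cball 0 r : set C).
Proof.
move=> r0; have rn : rc r != 0 :> C by apply: nm_neq0; rewrite nm_rc gtr0_norm.
pose g (t : R) : C := rc r * rotc t.
have gr t : nm (g t) = r by rewrite nmM nm_rc nm_rotc mulr1 gtr0_norm.
exists g; split.
  split.
  - apply: cont_nm => x e e0.
    have p4 : 0 < r * (4 * pi) by rewrite mulr_gt0// mulr_gt0// pi_gt0.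
    exists (e / (r * (4 * pi))) => /=; first by rewrite divr_gt0.
    move=> y /=; rewrite (ltr_pdivlMr _ _ p4) => h.
    rewrite -mulrBr nmM nm_rc gtr0_norm//; apply: le_lt_trans h.
    have -> : `|x - y| * (r * (4 * pi)) = r * (4 * pi * `|y - x|) by rewrite distrC; ring.
    exact: (ler_wpM2l (ltW r0) (rotc_lip y x)).
  - by move=> t; rewrite /g rotcD rotc1 mulr1.
  - by move=> s t hs ht /(mulfI rn); exact: rotc_inj.
exists 0; split.
- by move=> [t _ gt]; move: (gr t) r0; rewrite gt nm0 => <-; rewrite ltxx.
- rewrite eqEsubset; split.
    apply: connected_component_max.
    + by rewrite /cball /= subr0 nm0.
    + by move=> z; rewrite /cball /= subr0 => h [t _ gt]; move: h; rewrite -gt gr ltxx.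
    + exact: cball_connected.
  (* A connected set joining [0] to a point of modulus at least [r] takes the modulus [r], hence
     meets the circle. *)
  move=> z [B [B0 sB kB] Bz]; rewrite /cball /= subr0 ltNge; apply/negP => rz.
  have kn : connected ((fun x : C => nm x) @` B).
    apply: connected_continuous_connected => //.
    apply: continuous_subspaceT => x A /nbhs_ballP[e /= e0 hA].
    apply/nbhs_nmP; exists e => // y hy; apply: hA.
    rewrite -ball_normE /= ltr_norml; have := nmBge x y; have := nmBge y x; rewrite (nmBC x y) => h1 h2.
    by apply/andP; split; lra.
  have /connected_intervalP /(_ 0 (nm z)) H := kn.
  have [|||y By yr] := H _ _ r.
  - by exists 0; rewrite ?nm0.
  - by exists z.
  - by rewrite (ltW r0).
  have yn : y != 0 by apply: nm_neq0; rewrite yr.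
  have [t _ ty] : exists2 t : R, 0 <= t <= 1 & rotc t = y / rc r.
    by apply: polar; rewrite nm_div yr nm_rc gtr0_norm// divff// lt0r_neq0.
  by apply: (sB y By); exists t => //; rewrite /g ty mulrC divfK.
exists (rc r); split; first by rewrite realE -rc0 lerc (ltW r0).
move=> M rM x; rewrite /cball /= subr0 => hx; rewrite normE; apply/ltW.
by apply: lt_trans rM; rewrite ltrc.
Qed.

End Jordan.

(** * The limit *)

Section Limit.
Variable R : realType.
Local Notation C := (Cx R).

Definition s0 : stage R := Stage 0 0 0 'X id (fun=> 1) id.

Lemma good0 : good s0.
Proof.
split; split => /=.
- by exists 0%N; rewrite mul0r.
- by exists 1 => // z _; rewrite derivX hornerC nm1.
- move=> z _; split; first exact: hasd_id.
    by rewrite rotc0 mul1r.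
  by rewrite rotc0 derivX !hornerC.
- by move=> z _; rewrite subrr nm0.
- by exists 1 => // x y _ _; rewrite mul1r.
- by move=> y y1; split=> //; rewrite ?hornerX ?rotc0 ?mul1r.
by [].
Qed.

(** A clause of [refines] with the number of steps [k] exposed, because the next error depends on
    it. *)
Definition orbit_data (e : R) (k : nat) (s' : stage R) :=
  exists z, [/\ sK s' z, nm z <= e & iter k (sf s') z = sPsi s' 1].

Lemma mul_ge2 (x y : R) : 2 <= x -> 1 <= y -> 2 <= x * y.
Proof. nra. Qed.

(** The displacement bound plus twice the current error stays at most [1/8], so [step] always
    applies. *)
Lemma budget (b x y : R) : y <= x / 2 -> b + 2 * x <= 1 / 8 -> b + x + 2 * y <= 1 / 8.
Proof. lra. Qed.

Lemma sequence_exists : exists (s : nat -> stage R) (e : nat -> R) (k : nat -> nat),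
  [/\ s 0%N = s0, e 0%N = 1 / 16,
      forall n, e n.+1 = e n / ((sq (s n.+1))%:R * 2 ^+ k n) &
      forall n, [/\ 0 < e n, good (s n), refines (e n) (s n) (s n.+1) & orbit_data (e n) (k n) (s n.+1)]].
Proof.
have ex (x : stage R * R) : exists y : stage R * nat, good x.1 -> sb x.1 <= 1 / 2 -> 0 < x.2 ->
    [/\ good y.1, refines x.2 x.1 y.1 & orbit_data x.2 y.2 y.1].
  have [[[g b] e0]|n] := pselect ((good x.1 /\ sb x.1 <= 1 / 2) /\ 0 < x.2); last first.
    (* A default value: [choice] needs a total function. *)
    by exists (s0, 0%N) => g b e0; case: n.
  have [s' [gs' ns]] := step g b e0; have [_ _ _ [z [k zk]] _] := ns.
  by exists (s', k) => _ _ _; split=> //; exists z.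
have [F hF] := choice ex.
pose G (x : stage R * R) : stage R * R := ((F x).1, x.2 / ((sq (F x).1)%:R * 2 ^+ (F x).2)).
pose st n := iter n G (s0, 1 / 16).
exists (fun n => (st n).1), (fun n => (st n).2), (fun n => (F (st n)).2).
have inv n : [/\ good (st n).1, 0 < (st n).2 & sb (st n).1 + 2 * (st n).2 <= 1 / 8].
  elim: n => [|n [g e0 b]]; first by split; [exact: good0| |]; rewrite /=; lra.
  have b2 : sb (st n).1 <= 1 / 2 by lra.
  have [g' [_ _ _ _ [_ _ sbE _]] _] := hF _ g b2 e0.
  rewrite /st iterS -/(st n) /=; split=> //.
    by rewrite divr_gt0// mulr_gt0 ?exprn_gt0// ltr0n expn_gt0.
  rewrite sbE; apply: budget b.
  rewrite ler_pM2l// lef_pV2 ?posrE ?mulr_gt0 ?exprn_gt0 ?ltr0n ?expn_gt0//.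
  apply: mul_ge2; last by rewrite exprn_ege1// ler1n.
  by rewrite ler_nat /sq expnS leq_pmulr// expn_gt0.
split=> // n; have [g e0 b] := inv n; have b2 : sb (st n).1 <= 1 / 2 by lra.
by have [g' ns ob] := hF _ g b2 e0; split.
Qed.

Variables (s : nat -> stage R) (e : nat -> R) (k : nat -> nat).
Hypothesis s_0 : s 0%N = s0.
Hypothesis e_0 : e 0%N = 1 / 16.
Hypothesis eS : forall n, e n.+1 = e n / ((sq (s n.+1))%:R * 2 ^+ k n).
Hypothesis e_gt0 : forall n, 0 < e n.
Hypothesis sg : forall n, good (s n).
Hypothesis snext : forall n, refines (e n) (s n) (s n.+1).
Hypothesis sorb : forall n, orbit_data (e n) (k n) (s n.+1).

Lemma sq_ge2 (x : stage R) : 2 <= (sq x)%:R :> R.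
Proof. by rewrite ler_nat /sq expnS leq_pmulr// expn_gt0. Qed.

Lemma eSE n : e n.+1 * ((sq (s n.+1))%:R * 2 ^+ k n) = e n.
Proof.
by rewrite eS divfK// mulf_neq0 ?expf_neq0// pnatr_eq0 -lt0n expn_gt0.
Qed.

(** Halving bounds the sum of all errors from stage [n] on by [2 * e n], the form of the limit
    estimates below. *)
Lemma e2 n : 2 * e n.+1 <= e n.
Proof.
rewrite -[leRHS]eSE mulrC ler_pM2l//.
by apply: mul_ge2 (sq_ge2 _) _; rewrite exprn_ege1// ler1n.
Qed.

Lemma e_ge0 n : 0 <= e n. Proof. exact: ltW. Qed.

Lemma e_small (d : R) : 0 < d -> exists n, forall m, (n <= m)%N -> e m <= d.
Proof.
move=> d0.
have h n : e n * 2 ^+ n <= 1.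
  elim: n => [|n IH]; first by rewrite e_0 expr0; lra.
  rewrite exprS mulrA; apply: le_trans IH; rewrite ler_pM2r ?exprn_gt0//.
  by rewrite mulrC e2.
have [n hn] : exists n, (1 / 2 : R) ^+ n <= d.
  have := @cvg_expr R (1 / 2); rewrite ger0_norm; last lra.
  move=> /(_ ltac:(lra)) /cvgrPdist_le /(_ d d0)[N _ hN]; exists N.
  by have := hN N (leqnn N); rewrite /= sub0r normrN ger0_norm// exprn_ge0//; lra.
exists n => m nm_; apply: le_trans hn.
have em i : e (n + i)%N <= e n.
  elim: i => [|i IH]; first by rewrite addn0.
  by rewrite addnS; apply: le_trans IH; have := e2 (n + i)%N; have := e_gt0 (n + i).+1; lra.
rewrite -(subnKC nm_); apply: (le_trans (em _)).
rewrite expr_div_n expr1n ler_pdivlMr ?exprn_gt0//.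
Qed.

(** The strict inequality, due to strictly increasing angles, is what contradicts rationality. *)
Lemma alpha_exists : exists a : R, forall n, sa (s n) < a /\ a - sa (s n) <= 2 * e n.
Proof.
have [|a ha] := @nested_lim R (fun n => sa (s n)) e e_ge0 e2.
  move=> n; have [_ _ _ _ [h1 h2 _ _]] := snext n.
  by rewrite ger0_norm; lra.
have mono n i : sa (s n) <= sa (s (n + i)%N).
  elim: i => [|i IH]; first by rewrite addn0.
  rewrite addnS; apply: (le_trans IH); have [_ _ _ _ [h1 _ _ _]] := snext (n + i)%N.
  exact: ltW.
have le n : sa (s n) <= a.
  apply/ler_addgt0Pl => d d0; have d2 : 0 < d / 2 by lra.
  have [N hN] := e_small d2.
  have h1 := mono n N; have h2 := ha (n + N)%N; have h3 := hN (n + N)%N (leq_addl _ _).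
  by move: h2; rewrite ler_norml => /andP[h4 h5]; lra.
exists a => n; split.
  have [_ _ _ _ [h1 _ _ _]] := snext n; exact: lt_le_trans h1 (le _).
by have := ha n; rewrite ler_norml => /andP[]; lra.
Qed.

(** If [a] has denominator [b], its positive distance to [sa (s N.+1) = c / q] is at least
    [1 / (b q)]; yet it is at most [2 * e N.+1 <= 2 * e N / q], too small once
    [e N <= 1 / (4 b)]. *)
Lemma alpha_irrational (a : R) : (forall n, sa (s n) < a /\ a - sa (s n) <= 2 * e n) ->
  forall r : rat, a <> ratr r.
Proof.
move=> ha r ar.
pose b : R := (denq r)%:~R.
have b0 : 0 < b by rewrite ltr0z denq_gt0.
have ab : a * b = (numq r)%:~R.
  by rewrite ar -[in LHS](divq_num_den r) rmorph_div ?unitfE ?intr_eq0 ?denq_eq0//= !ratr_int divfK// lt0r_neq0.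
have [N hN] := e_small (divr_gt0 (ltr01 : 0 < 1 :> R) (mulr_gt0 (ltr0Sn R 3) b0)).
have {}hN := hN N (leqnn N).
have [h1 h2] := ha N.+1.
have [[[c hc] _ _ _] _] := sg N.+1.
pose q : R := (sq (s N.+1))%:R.
have q2 : 2 <= q by exact: sq_ge2.
have q0 : 0 < q by lra.
have eq : e N.+1 * q <= e N.
  rewrite -[leRHS]eSE -/q; rewrite ler_pM2l// ler_pMr// exprn_ege1// ler1n//.
pose M : int := (numq r * (sq (s N.+1))%:Z - c%:Z * denq r)%R.
have ME : M%:~R = (a - sa (s N.+1)) * b * q.
  rewrite /M rmorphB /= !rmorphM /= -ab hc -/q -/b !pmulrn.
  by rewrite -/q; field; rewrite lt0r_neq0.
have M0 : (0 < M)%R.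
  by rewrite -(ltr0z R) ME mulr_gt0// mulr_gt0// subr_gt0.
have M1 : 1 <= M%:~R :> R by rewrite ler1z; lia.
have h3 : (a - sa (s N.+1)) * b * q <= 2 * e N * b.
  have := ler_wpM2r (ltW q0) (ler_wpM2r (ltW b0) h2).
  have := ler_wpM2r (ltW b0) eq; lra.
have b4 : 0 < 4 * b by rewrite mulr_gt0.
rewrite (ler_pdivlMr _ _ b4) in hN.
by move: M1; rewrite ME; apply/negP; rewrite -ltNge; lra.
Qed.

Lemma f_limit : exists f f1 : C -> C, forall z, nm z < 2 -> forall n,
  nm (f z - sf (s n) z) <= 2 * e n /\ nm (f1 z - sf1 (s n) z) <= 2 * e n.
Proof.
have ex (z : C) : exists w : C * C, nm z < 2 -> forall n,
    nm (w.1 - sf (s n) z) <= 2 * e n /\ nm (w.2 - sf1 (s n) z) <= 2 * e n.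
  have [z2|] := boolP (nm z < 2); last by exists (0, 0).
  have [|w hw] := @nested_limC R (fun n => sf (s n) z) e e_ge0 e2.
    by move=> n; have [_ _ _ _ [_ _ _ h]] := snext n; case: (h z z2).
  have [|w1 hw1] := @nested_limC R (fun n => sf1 (s n) z) e e_ge0 e2.
    by move=> n; have [_ _ _ _ [_ _ _ h]] := snext n; case: (h z z2).
  by exists (w, w1) => _ n; split; [exact: hw|exact: hw1].
have [F hF] := choice ex.
by exists (fun z => (F z).1), (fun z => (F z).2).
Qed.

Variables f f1 : C -> C.
Hypothesis flim : forall z, nm z < 2 -> forall n,
  nm (f z - sf (s n) z) <= 2 * e n /\ nm (f1 z - sf1 (s n) z) <= 2 * e n.

Lemma sf_hasd n z : nm z < 2 -> hasd (sf (s n)) z (sf1 (s n) z).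
Proof. by move=> z2; have [[_ _ h _] _] := sg n; case: (h z z2). Qed.

(** Close derivatives make the difference of consecutive maps Lipschitz with a small constant.
    Summed and passed to the limit in [f_lip], this gives the differentiability of [f]. *)
Lemma step_lip n x y : nm x < 2 -> nm y < 2 ->
  nm ((sf (s n.+1) x - sf (s n) x) - (sf (s n.+1) y - sf (s n) y)) <= e n * nm (x - y).
Proof.
move=> x2 y2.
apply: (@mvt_ball R (fun z => sf (s n.+1) z - sf (s n) z)
  (fun z => sf1 (s n.+1) z - sf1 (s n) z) 0 (Num.max (nm x) (nm y))).
- move=> z; rewrite subr0 le_max => hz.
  have z2 : nm z < 2 by case/orP: hz => hz; apply: le_lt_trans hz _.
  split; first by apply: hasdB; exact: sf_hasd.
  by have [_ _ _ _ [_ _ _ h]] := snext n; case: (h z z2).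
- by rewrite subr0 le_max lexx.
by rewrite subr0 le_max lexx orbT.
Qed.

Lemma tele_lip (n i : nat) x y : nm x < 2 -> nm y < 2 ->
  nm ((sf (s (n + i)%N) x - sf (s n) x) - (sf (s (n + i)%N) y - sf (s n) y)) <=
  (2 * e n - 2 * e (n + i)%N) * nm (x - y).
Proof.
move=> x2 y2; elim: i => [|i IH]; first by rewrite addn0 !subrr nm0 mul0r.
rewrite addnS; have h := step_lip (n + i) x2 y2.
have -> : sf (s (n + i).+1) x - sf (s n) x - (sf (s (n + i).+1) y - sf (s n) y) =
  (sf (s (n + i).+1) x - sf (s (n + i)%N) x - (sf (s (n + i).+1) y - sf (s (n + i)%N) y)) +
  (sf (s (n + i)%N) x - sf (s n) x - (sf (s (n + i)%N) y - sf (s n) y)) by ring.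
apply: (le_trans (nmD _ _)); apply: (le_trans (lerD h IH)).
rewrite -mulrDl ler_wpM2r ?nm_ge0//; have := e2 (n + i)%N; lra.
Qed.

Lemma f_lip n x y : nm x < 2 -> nm y < 2 ->
  nm ((f x - sf (s n) x) - (f y - sf (s n) y)) <= 2 * e n * nm (x - y).
Proof.
move=> x2 y2; apply/ler_addgt0Pl => d d0; have d4 : 0 < d / 4 by lra.
have [N hN] := e_small d4; have em := hN (n + N)%N (leq_addl _ _).
have [hx _] := flim x2 (n + N); have [hy _] := flim y2 (n + N).
have h := tele_lip n N x2 y2.
have -> : f x - sf (s n) x - (f y - sf (s n) y) =
  (f x - sf (s (n + N)%N) x) - (f y - sf (s (n + N)%N) y) +
  (sf (s (n + N)%N) x - sf (s n) x - (sf (s (n + N)%N) y - sf (s n) y)) by ring.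
apply: (le_trans (nmD _ _)); apply: lerD; first by apply: (le_trans (nmB _ _)); lra.
apply: (le_trans h); rewrite ler_wpM2r ?nm_ge0// gerBl mulr_ge0// ltW//.
Qed.

Lemma f_hasd z : nm z < 2 -> hasd f z (f1 z).
Proof.
move=> z2 d d0; have d8 : 0 < d / 8 by lra.
have [N hN] := e_small d8; have {}hN := hN N (leqnn N).
have d2 : 0 < d / 2 by lra.
have [r r0 hr] := sf_hasd N z2 d2.
have z2' : 0 < 2 - nm z by lra.
exists (Num.min r (2 - nm z)); first by rewrite lt_min r0.
move=> x; rewrite lt_min => /andP[/hr h1 xz].
have x2 : nm x < 2 by have := nmBge x z; lra.
have h2 := f_lip N x2 z2; have [_ h3] := flim z2 N.
have -> : f x - f z - f1 z * (x - z) =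
  (f x - sf (s N) x - (f z - sf (s N) z)) +
  ((sf (s N) x - sf (s N) z - sf1 (s N) z * (x - z)) - (f1 z - sf1 (s N) z) * (x - z)) by ring.
apply: (le_trans (nmD _ _)); apply: (le_trans (lerD h2 (nmB _ _))).
rewrite nmM; have p0 := nm_ge0 (x - z).
have h4 := ler_wpM2r p0 h3; have h5 := ler_wpM2r p0 hN.
by move: h1 h4 h5; set u := nm (x - z); lra.
Qed.

(** Stage [0] is the identity, and [2 * e 0 = 1/8]. *)
Lemma f_near_id x y : nm x < 2 -> nm y < 2 -> nm ((f x - x) - (f y - y)) <= 1 / 8 * nm (x - y).
Proof.
move=> x2 y2; have := f_lip 0 x2 y2; rewrite s_0 e_0 /=.
by have -> : 2 * (1 / 16) = 1 / 8 :> R by field.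
Qed.

Lemma f_zero : f 0 = 0.
Proof.
have n0 : nm 0 < 2 :> R by rewrite nm0.
apply: nm_small => d d0; have d2 : 0 < d / 2 by lra.
have [N hN] := e_small d2; have {}hN := hN N (leqnn N).
have [h _] := flim n0 N; have [_ [_ hPsi P0]] := sg N.
have n1 : nm 0 <= 1 :> R by rewrite nm0.
have [_ _] := hPsi 0 n1; rewrite P0 mulr0 P0 => fN.
by move: h; rewrite fN subr0; lra.
Qed.

(** At the common fixed point [0] the differentiated lift identity has the same nonzero factor on
    both sides, which cancels. *)
Lemma f1_zero (a : R) : (forall n, sa (s n) < a /\ a - sa (s n) <= 2 * e n) -> f1 0 = rotc a.
Proof.
move=> ha; have n0 : nm 0 < 2 :> R by rewrite nm0.
have pp := pi_gt0 R.
apply/eqP; rewrite -subr_eq0; apply/eqP; apply: nm_small => d d0.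
pose c : R := 2 + 4 * pi * 2.
have c0 : 0 < c by rewrite addr_gt0// !mulr_gt0.
have [N hN] := e_small (divr_gt0 d0 c0); have {}hN := hN N (leqnn N).
rewrite (ler_pdivlMr _ _ c0) in hN.
have [_ h] := flim n0 N; have [[_ [m m0 hm] hl _] [_ hPsi P0]] := sg N.
have n1 : nm 0 <= 1 :> R by rewrite nm0.
have [_ _] := hPsi 0 n1; rewrite P0 mulr0 P0 => fN.
have [_ _] := hl 0 n0; rewrite fN => E.
have D0 : (deriv (sh (s N))).[0] != 0.
  by apply: nm_neq0; apply: lt_le_trans (hm 0 _) => //; rewrite nm0.
have f1N : sf1 (s N) 0 = rotc (sa (s N)) by apply: (mulIf D0).
rewrite f1N in h.
apply: (le_trans (nm_tri (rotc (sa (s N))) _ _)).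
have h2 := rotc_lip (sa (s N)) a; have [h3 h4] := ha N.
rewrite distrC ger0_norm in h2; last lra.
have p4 : 0 <= 4 * pi :> R by rewrite mulr_ge0// ltW.
have h5 := ler_wpM2l p4 h4.
apply: le_trans hN; rewrite /c; lra.
Qed.

Definition Kinf : set C := \bigcap_n sK (s n).

Lemma sK_sub n : sK (s n.+1) `<=` sK (s n).
Proof. by have [] := snext n. Qed.

Lemma sK_mono n m : (n <= m)%N -> sK (s m) `<=` sK (s n).
Proof.
move=> /subnK <-; elim: (m - n)%N => // i IH; rewrite addSn.
exact: subset_trans (@sK_sub _) IH.
Qed.

Lemma Kinf_disc z : Kinf z -> nm z <= 1.
Proof. by move=> /(_ 0%N I); rewrite s_0 => -[y y1 <-]. Qed.

Lemma Kinf_compact : compact Kinf.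
Proof.
apply: (@compact_nm _ _ 1); last exact: Kinf_disc.
by apply: closed_bigI => n _; apply: compact_closed_nm; apply: sK_compact.
Qed.

Lemma Kinf_connected : connected Kinf.
Proof.
apply: nested_connected => n; [exact: sK_compact|exact: sK_sub|exact: sK_connected].
Qed.

Lemma Kinf0 : Kinf 0.
Proof.
move=> n _; have [_ [_ _ P0]] := sg n; exists 0 => //.
by rewrite /disc /= nm0.
Qed.

Lemma sK_nm n z : sK (s n) z -> nm z <= 1.
Proof. by move=> /(sK_mono (leq0n n)); rewrite s_0 => -[y y1 <-]. Qed.

Lemma sf_sK n z : sK (s n) z -> sK (s n) (sf (s n) z).
Proof.
move=> [y y1 <-]; have [_ [_ h _]] := sg n; have [_ _ ->] := h y y1.
exists (rotc (sa (s n)) * y) => //.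
by rewrite /disc /= nmM nm_rotc mul1r.
Qed.

Lemma sf_sK_surj n z : sK (s n) z -> exists2 w, sK (s n) w & sf (s n) w = z.
Proof.
move=> [y y1 <-]; have [_ [_ h _]] := sg n.
have r0 : rotc (sa (s n)) != 0 by apply: nm_neq0; rewrite nm_rotc.
have y1' : nm ((rotc (sa (s n)))^-1 * y) <= 1 by rewrite nmM nmV nm_rotc invr1 mul1r.
exists (sPsi (s n) ((rotc (sa (s n)))^-1 * y)); first by exists ((rotc (sa (s n)))^-1 * y).
by have [_ _ ->] := h _ y1'; rewrite mulVKf.
Qed.

(** For [m >= n] the points [sf (s m) z] lie in the closed set [sK (s n)] and tend to [f z]. *)
Lemma f_Kinf z : Kinf z -> Kinf (f z).
Proof.
move=> Kz n _.
have z2 : nm z < 2 by have := Kinf_disc Kz; lra.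
have := compact_closed_nm (sK_compact (sg n)); rewrite closed_nmP; apply => d d0.
have d4 : 0 < d / 4 by lra.
have [N hN] := e_small d4; have {}hN := hN (n + N)%N (leq_addl _ _).
exists (sf (s (n + N)%N) z).
  by apply: (sK_mono (leq_addr N n)); apply: sf_sK; exact: Kz.
by have [h _] := flim z2 (n + N); rewrite nmBC; lra.
Qed.

Lemma f_lip98 x y : nm x < 2 -> nm y < 2 -> nm (f x - f y) <= 9 / 8 * nm (x - y).
Proof.
move=> x2 y2; have h := f_near_id x2 y2.
have -> : f x - f y = (f x - x - (f y - y)) + (x - y) by ring.
apply: (le_trans (nmD _ _)); lra.
Qed.

Lemma f_exp78 x y : nm x < 2 -> nm y < 2 -> 7 / 8 * nm (x - y) <= nm (f x - f y).
Proof.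
move=> x2 y2; have h := f_near_id x2 y2.
have := nmBge (x - y) (f x - f y); rewrite (nmBC (x - y)).
have -> : f x - f y - (x - y) = f x - x - (f y - y) by ring.
lra.
Qed.

Lemma f_inj x y : nm x < 2 -> nm y < 2 -> f x = f y -> x = y.
Proof.
move=> x2 y2 xy; have := f_exp78 x2 y2; rewrite xy subrr nm0 => h.
apply/eqP; rewrite -subr_eq0; apply/eqP/nm_eq0/eqP; rewrite eq_le nm_ge0 andbT; lra.
Qed.

(** Preimages of [z] under the maps [sf (s n)] accumulate at a point of [Kinf]. *)
Lemma f_Kinf_surj z : Kinf z -> exists2 w, Kinf w & f w = z.
Proof.
move=> Kz.
have ex n : exists w, sK (s n) w /\ sf (s n) w = z.
  by have [w h1 h2] := sf_sK_surj (Kz n I); exists w.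
have [w hw] := choice ex.
have [p [Kp hp]] := cluster_seq (fun n => sK_compact (sg n)) sK_sub (fun n => proj1 (hw n)).
have Kp' : Kinf p by move=> n _; exact: Kp.
have p2 : nm p < 2 by have := Kinf_disc Kp'; lra.
exists p => //; apply/eqP; rewrite -subr_eq0; apply/eqP; apply: nm_small => d d0.
have d8 : 0 < d / 8 by lra.
have [N hN] := e_small d8.
have [n Nn hn] := hp (d / 8) N d8; have {}hN := hN n Nn.
have [Kw wz] := hw n.
have w2 : nm (w n) < 2 by have := sK_nm Kw; lra.
have [h _] := flim w2 n; rewrite wz in h.
have h2 := f_lip98 p2 w2; rewrite (nmBC p) in h2.
apply: (le_trans (nm_tri (f (w n)) _ _)); lra.
Qed.

(** [1/8 - 2 * e n] bounds the errors spent before stage [n], out of a total of [2 * e 0 = 1/8]. *)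
Lemma sK_area n : ((1 - (1 / 8 - 2 * e n))%:E <= area (sK (s n)))%E.
Proof.
elim: n => [|n IH].
  have -> : 1 - (1 / 8 - 2 * e 0%N) = 1 :> R by rewrite e_0; field.
  have -> : sK (s 0%N) = disc 1.
    by rewrite s_0 /sK /= image_id.
  exact: area_disc1.
have [_ h _ _ _] := snext n.
have := le_trans IH h; rewrite -leeBlDr//; apply: le_trans.
rewrite -EFinB lee_fin; have := e2 n; lra.
Qed.

Lemma Kinf_area : ((7 / 8)%:E <= area Kinf)%E.
Proof.
apply: (@area_nested R _ 1) => //.
- by move=> n; exact: sK_compact.
- by move=> n; exact: sK_sub.
- by move=> z; exact: sK_nm.
move=> n; apply: le_trans (sK_area n); rewrite lee_fin; have := e_gt0 n; lra.
Qed.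

Lemma sPsi1 n : 1 - (1 / 8 - 2 * e n) <= nm (sPsi (s n) 1).
Proof.
elim: n => [|n IH]; first by rewrite s_0 /= nm1 e_0; lra.
have [_ _ h _ _] := snext n.
have := nmBge (sPsi (s n) 1) (sPsi (s n.+1) 1); rewrite nmBC; have := e2 n; lra.
Qed.

Lemma iter_sf_sK n i z : sK (s n) z -> sK (s n) (iter i (sf (s n)) z).
Proof. by move=> Kz; elim: i => // i IH; exact: sf_sK. Qed.

(** Each step at most doubles the deviation and adds [2 * e n]; the hypothesis keeps the orbit of
    [f] in the disc [2]. *)
Lemma iter_close n i z : sK (s n) z -> 2 ^+ i * (2 * e n) <= 1 / 2 ->
  nm (iter i f z - iter i (sf (s n)) z) <= (2 ^+ i - 1) * (2 * e n).
Proof.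
move=> Kz; elim: i => [|i IH] hi; first by rewrite /= !subrr nm0 mul0r.
have e0 := e_gt0 n.
have p1 : 1 <= 2 ^+ i :> R by rewrite exprn_ege1// ler1n.
rewrite exprS in hi *.
have {}IH := IH ltac:(nra).
have Ki := sK_nm (iter_sf_sK i Kz).
have x2 : nm (iter i (sf (s n)) z) < 2 by lra.
have y2 : nm (iter i f z) < 2.
  by have := nmBge (iter i f z) (iter i (sf (s n)) z); move: IH hi; nra.
rewrite !iterS; apply: (le_trans (nm_tri (f (iter i (sf (s n)) z)) _ _)).
have [h1 _] := flim x2 n; have h2 := f_lip98 y2 x2.
have := nm_ge0 (iter i f z - iter i (sf (s n)) z).
move: IH h1 h2; nra.
Qed.

(** Over [k N] steps [f] deviates by at most [2 ^ k N * 2 * e N.+1 <= e N <= 1/16] from the orbit of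
    stage [N.+1], which goes from modulus at most [e N] to modulus at least [7/8]. *)
Lemma f_unstable (d : R) : 0 < d -> exists z i, nm z <= d /\ 1 / 2 <= nm (iter i f z).
Proof.
move=> d0; have [N hN] := e_small d0.
have [z [Kz zd zk]] := sorb N.
exists z, (k N); split; first by apply: le_trans zd (hN N (leqnn N)).
have eN : 2 ^+ k N * (2 * e N.+1) <= e N.
  rewrite -(eSE N); have := sq_ge2 (s N.+1).
  have : 0 <= e N.+1 * 2 ^+ k N by rewrite mulr_ge0// ltW//.
  nra.
have e16 : e N <= 1 / 16.
  rewrite -e_0; elim: (N) => // i IH; apply: le_trans IH.
  by have := e2 i; have := e_gt0 i.+1; lra.
have h1 := @iter_close N.+1 (k N) z Kz ltac:(lra).
have h2 := sPsi1 N.+1.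
rewrite -zk in h2.
have := nmBge (iter (k N) (sf (s N.+1)) z) (iter (k N) f z); rewrite nmBC.
have := e_gt0 N.+1; rewrite mulrBl in h1; lra.
Qed.

End Limit.

(** * Linearizability and the hedgehog *)

Section Final.
Variable R : realType.
Local Notation C := (Cx R).

Lemma derivable_cont (f : C -> C) (z : C) : derivable f z 1 -> forall e : R, 0 < e ->
  exists2 d : R, 0 < d & forall y, nm (y - z) < d -> nm (f y - f z) < e.
Proof.
move=> /derivable1_diffP /differentiable_continuous h e e0.
have := h [set y | nm (y - f z) < e]; rewrite nbhs_simpl /= => H.
have /nbhs_nmP[d d0 hd] : nbhs z (f @^-1` [set y | nm (y - f z) < e]).
  by apply: H; apply/nbhs_nmP; exists e.
by exists d.
Qed.

(* An invariant neighbourhood of [0] is cut out by a sublevel set of [phi] that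
   avoids an annulus which no single step of [f] can jump over. *)
Lemma unstable_nonlinearizable (f : C -> C) (a : R) : f 0 = 0 ->
  (forall x y, nm x < 2 -> nm y < 2 -> nm (f x - f y) <= 9 / 8 * nm (x - y)) ->
  (forall d : R, 0 < d -> exists z i, nm z <= d /\ 1 / 2 <= nm (iter i f z)) ->
  ~ linearizable f a.
Proof.
move=> f0 flip fun_ [V [phi [[oV V0 hphi iphi] [phi0 /nbhs_nmP[r1 r10 hr1]]]]].
have [r2 r20 hr2] := (open_nmP V).1 oV 0 V0.
pose r := Num.min (Num.min r1 r2) (1 / 2) / 4.
have r0 : 0 < r by rewrite divr_gt0// !lt_min r10 r20/=; lra.
have [rr1 rr2 rr3] : [/\ r * 4 <= r1, r * 4 <= r2 & r * 4 <= 1 / 2].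
  by rewrite /r !divfK ?pnatr_eq0// !ge_min !lexx ?orbT.
have inV z : nm z < r2 -> V z by move=> h; apply: hr2; rewrite subr0.
pose A : set C := [set z | r <= nm z <= 2 * r].
have cA : compact A.
  apply: (@compact_nm _ _ (2 * r)); last by move=> z /andP[].
  apply/closed_nmP => z h; apply/andP; split; apply/ler_addgt0Pl => d d0; have [y /andP[y1 y2] yz] := h d d0.
    by have := nmBge y z; lra.
  by have := nmBge z y; rewrite nmBC; lra.
(* Otherwise compactness gives a zero of [phi] in the annulus, against injectivity and
   [phi 0 = 0]. *)
have [m m0 hm] : exists2 m : R, 0 < m & forall z, A z -> m <= nm (phi z).
  apply: contrapT => H.
  have ex (n : nat) : exists z, A z /\ nm (phi z) < n.+1%:R^-1.
    apply: contrapT => h; apply: H; exists (n.+1%:R^-1); first by rewrite invr_gt0.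
    by move=> z Az; rewrite leNgt; apply/negP => lt; apply: h; exists z.
  have [z hz] := choice ex.
  have [||p [Ap hp]] := @cluster_seq R (fun=> A) z (fun=> cA).
  - by move=> n x.
  - by move=> n; case: (hz n).
  have {}Ap := Ap 0%N; have [p1 p2] := andP Ap.
  have Vp : V p by apply: inV; lra.
  have pp : phi p = 0.
    apply: nm_small => d d0; have d2 : 0 < d / 2 by lra.
    have [r' r'0 hr'] := derivable_cont (hphi p Vp) d2.
    have [N N0 hN] := nat_big (2 / d).
    have [n Nn hn] := hp r' N r'0.
    have [_ h1] := hz n; have h2 := hr' _ hn.
    have h3 : (n.+1%:R : R)^-1 <= d / 2.
      rewrite -[d / 2]invrK lef_pV2 ?posrE ?invr_gt0// invf_div.
      by apply: (le_trans hN); rewrite ler_nat; apply: leqW.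
    have := nmBge (phi p) (phi (z n)); rewrite nmBC; move: h1 h2 h3.
    by set u := n.+1%:R^-1; clear; lra.
  have p0 : p = 0 by apply: iphi => //; rewrite pp phi0.
  by move: p1; rewrite p0 nm0; apply/negP; rewrite -ltNge.
have [d d0 hd] := derivable_cont (hphi 0 V0) m0.
have dr : 0 < Num.min (d / 2) (r / 2) by rewrite lt_min; apply/andP; split; lra.
have [z [i [zd zi]]] := fun_ _ dr.
move: zd; rewrite le_min => /andP[zd zr].
have inv j : nm (iter j f z) < r /\ nm (phi (iter j f z)) < m.
  elim: j => [|j [h1 h2]] /=.
    split; first lra.
    by have := hd z; rewrite subr0 phi0 subr0; apply; lra.
  set x := iter j f z in h1 h2 *.
  have E : nm (phi (f x)) = nm (phi x).
    rewrite hr1; last by rewrite subr0; lra.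
    by rewrite nmM nm_rotc mul1r.
  split; last by rewrite E.
  rewrite ltNge; apply/negP => h3.
  have h4 : nm (f x) <= 2 * r.
    have := flip x 0; rewrite f0 !subr0 nm0 => /(_ ltac:(lra) ltac:(clear; lra)); lra.
  have := hm (f x); rewrite /A /= h3 h4 E => /(_ isT); apply/negP; rewrite -ltNge//.
have [h _] := inv i; move: zi; apply/negP; rewrite -ltNge; lra.
Qed.

(* On [nm z < 2] the displacement [f z - z] is a contraction, so [f] is open and
   has a Lipschitz inverse; both [f] and its inverse then preserve the filling. *)
Lemma fill_invariant (f : C -> C) (K : set C) : compact K -> connected K ->
  (forall z, K z -> nm z <= 1) -> K 0 -> f 0 = 0 ->
  (forall x y, nm x < 2 -> nm y < 2 -> nm ((f x - x) - (f y - y)) <= 1 / 8 * nm (x - y)) ->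
  (forall z, K z -> K (f z)) -> (forall z, K z -> exists2 w, K w & f w = z) ->
  f @` fill K = fill K.
Proof.
move=> cK kK K1 K0 f0 near_id fK Kf.
have flip x y : nm x < 2 -> nm y < 2 -> nm (f x - f y) <= 9 / 8 * nm (x - y).
  move=> x2 y2; have h := near_id x y x2 y2.
  have -> : f x - f y = (f x - x - (f y - y)) + (x - y) by ring.
  apply: (le_trans (nmD _ _)); lra.
have fexp x y : nm x < 2 -> nm y < 2 -> nm (x - y) <= 8 / 7 * nm (f x - f y).
  move=> x2 y2; have h := near_id x y x2 y2.
  have := nmBge (x - y) (f x - f y); rewrite (nmBC (x - y)).
  have -> : f x - f y - (x - y) = f x - x - (f y - y) by ring.
  lra.
have finj x y : nm x < 2 -> nm y < 2 -> f x = f y -> x = y.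
  move=> x2 y2 xy; have := fexp x y x2 y2; rewrite xy subrr nm0 mulr0 => h.
  by apply/eqP; rewrite -subr_eq0; apply/eqP/nm_eq0/eqP; rewrite eq_le h nm_ge0.
(* A solution of [f x = w] is a fixed point of [w - (f x - x)], which contracts by [1/8]. *)
have solve w c (r : R) : 0 <= r -> nm c + r < 2 -> nm (w - f c) <= r / 2 ->
    exists2 x, nm (x - c) <= r & f x = w.
  move=> r0 cr hw.
  have in2 x : nm (x - c) <= r -> nm x < 2 by have := nmBge x c; lra.
  have c2 : nm (c - c) <= r by rewrite subrr nm0.
  have [||x [h1 h2]] := @half_fixpoint R (fun x => w - (f x - x)) c r r0.
  - move=> x hx; have h := near_id x c (in2 _ hx) (in2 _ c2).
    have -> : w - (f x - x) - c = (w - f c) - (f x - x - (f c - c)) by ring.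
    apply: (le_trans (nmB _ _)); lra.
  - move=> x y hx hy; have h := near_id x y (in2 _ hx) (in2 _ hy).
    have -> : w - (f x - x) - (w - (f y - y)) = - (f x - x - (f y - y)) by ring.
    rewrite nmN; have := nm_ge0 (x - y); lra.
  exists x => //.
  have e1 : f x = w - ((w - (f x - x)) - x) by ring.
  by rewrite e1 [w - (f x - x)]h2 subrr subr0.
have F2 z : fill K z -> nm z < 2 by move=> /(fill_nm K1); lra.
have n0 : nm 0 < 2 :> R by rewrite nm0.
(* [f] moves [w] by at most [1/8 * 3/2 = 3/16], half of the radius [3/8], and [3/2 + 3/8 < 2]. *)
have exg w : exists x, nm w <= 3 / 2 -> nm x < 2 /\ f x = w.
  have [hw|] := boolP (nm w <= 3 / 2); last by exists 0.
  have [|||x h1 h2] := solve w w (3 / 8).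
  - by [].
  - lra.
  - have := near_id w 0 ltac:(lra) n0; rewrite f0 !subr0 nmBC; lra.
  by exists x => _; split=> //; have := nmBge x w; lra.
have [g hg] := choice exg.
have Fg z : fill K z -> nm (g z) < 2 /\ f (g z) = z.
  by move=> /(fill_nm K1) h; apply: hg; lra.
have sub1 : f @` fill K `<=` fill K.
  apply: (@fill_inv R K cK K1 K0 f (9 / 8)) => //.
  - by move=> x y /F2 x2 /F2 y2; exact: flip.
  - move=> z r /F2 z2 r0; pose r' := Num.min (r / 2) ((2 - nm z) / 2).
    have r'0 : 0 < r' by rewrite lt_min; apply/andP; split; lra.
    have [r'1 r'2] : r' <= r / 2 /\ r' <= (2 - nm z) / 2 by rewrite /r' !ge_min !lexx ?orbT.
    exists (r' / 2); first lra.
    move=> w hw; have [||x h1 h2] := solve w z r' _ _ (ltW hw).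
    + exact: ltW.
    + lra.
    + by exists x => //; lra.
have sub2 : g @` fill K `<=` fill K.
  apply: (@fill_inv R K cK K1 K0 g (8 / 7)) => //.
  - move=> x y /Fg[x2 gx] /Fg[y2 gy]; have := fexp (g x) (g y) x2 y2.
    by rewrite gx gy.
  - move=> z r fz r0; have [g2 gz] := Fg z fz; have z1 := fill_nm K1 fz.
    (* [1/40] ensures [nm (f w) <= 29/20 + 9/8 * 1/40 < 3/2], so that [g (f w) = w]. *)
    pose r' := Num.min (r / 2) (Num.min (1 / 40) (2 - nm (g z))).
    have r'0 : 0 < r'.
      rewrite !lt_min; apply/andP; split; first lra.
      by apply/andP; split; lra.
    have [r'1 r'2 r'3] : [/\ r' <= r / 2, r' <= 1 / 40 & r' <= 2 - nm (g z)].
      by rewrite /r' !ge_min !lexx ?orbT.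
    exists r' => // w hw.
    have w2 : nm w < 2 by have := nmBge w (g z); lra.
    have h := flip w (g z) w2 g2; rewrite gz in h.
    exists (f w); first lra.
    have fw : nm (f w) <= 3 / 2 by have := nmBge (f w) z; lra.
    by have [h1 h2] := hg (f w) fw; exact: finj.
  - move=> z Kz; have [w Kw fw] := Kf z Kz.
    have [h1 h2] := Fg z (K_fill Kz).
    have -> : g z = w; last by [].
    by apply: finj => //; [have := K1 w Kw; lra|rewrite h2].
rewrite eqEsubset; split=> // z fz; have [h1 h2] := Fg z fz.
by exists (g z) => //; apply: sub2; exists z.
Qed.

End Final.

Theorem theorem1p1 (R : realType) :
  exists (a : R) (f : Cx R -> Cx R) (W U K : set (Cx R)),
    [/\ (forall q : rat, a <> ratr q),
        [/\ open W, jordan_domain U, U 0 & closure U `<=` W],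
        [/\ holo_on f W, inj_on f W, f 0 = 0 &
            is_derive (0 : Cx R) (1 : Cx R) f (rotc a)],
        hedgehog f a W U K &
        measurable (realify K) /\ (0 < area K)%E].
Proof.
have [s [e [k [s_0 e_0 eS H]]]] := sequence_exists R.
have e_gt0 n : 0 < e n by case: (H n).
have sg n : good (s n) by case: (H n).
have snext n : refines (e n) (s n) (s n.+1) by case: (H n).
have sorb n : orbit_data (e n) (k n) (s n.+1) by case: (H n).
have [a ha] := alpha_exists e_0 eS e_gt0 snext.
have [f [f1 flim]] := f_limit eS e_gt0 snext.
pose K := Kinf s.
have fnear := f_near_id s_0 e_0 eS e_gt0 sg snext flim.
have f0 := f_zero e_0 eS e_gt0 sg flim.
have cK : compact K := Kinf_compact s_0 sg.
have kK : connected K := Kinf_connected sg snext.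
have K1 z : K z -> nm z <= 1 := @Kinf_disc R s s_0 z.
have K0 : K 0 := Kinf0 sg.
have fK z : K z -> K (f z).
  exact: (f_Kinf s_0 e_0 eS e_gt0 sg snext flim).
have Kf z : K z -> exists2 w, K w & f w = z.
  exact: (f_Kinf_surj s_0 e_0 eS e_gt0 sg snext flim).
have Finv := fill_invariant cK kK K1 K0 f0 fnear fK Kf.
(* The complement of [K] need not be connected, so the hedgehog is the filling. *)
pose F := fill K.
have cF : compact F by exact: (fill_compact cK K1).
have F0 : F 0 by exact: (K_fill K0).
have finj x y : nm x < 2 -> nm y < 2 -> f x = f y -> x = y by exact: (f_inj s_0 e_0 eS e_gt0 sg snext flim).
have areaK : ((7 / 8)%:E <= area K)%E by exact: (Kinf_area s_0 e_0 eS e_gt0 sg snext).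
have areaF : ((7 / 8)%:E <= area F)%E.
  apply: (le_trans areaK); apply: area_mono.
  - exact: compact_closed_nm.
  - exact: (fill_closed cK K1).
  exact: K_fill.
have areaF0 : (0 < area F)%E by apply: lt_le_trans areaF; rewrite lte_fin; lra.
(* A point of largest modulus fixes the radius of [U]: then [F] lies in the closed disc and touches
   its boundary. *)
have [z1 [Fz1 z1max]] : exists z1, F z1 /\ forall z, F z -> nm z <= nm z1.
  pose S := [set nm z | z in F].
  have hS : has_sup S.
    split; first by exists (nm 0), 0.
    by exists (29 / 20) => _ [z Fz <-]; exact: (fill_nm K1 Fz).
  have ex (n : nat) : exists z, F z /\ sup S - n.+1%:R^-1 < nm z.
    have n0 : 0 < (n.+1%:R : R)^-1 by rewrite invr_gt0.
    by have [_ [z Fz <-] h] := sup_adherent n0 hS; exists z.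
  have [z hz] := choice ex.
  have [||p [Fp hp]] := @cluster_seq R (fun=> F) z (fun=> cF).
  - by move=> n x.
  - by move=> n; case: (hz n).
  exists p; split; first exact: (Fp 0%N).
  move=> y Fy; have h1 : nm y <= sup S by apply: ub_le_sup; [case: hS|exists y].
  apply: (le_trans h1); apply/ler_addgt0Pl => d d0; have d2 : 0 < d / 2 by lra.
  have [N N0 hN] := nat_big (2 / d); have [n Nn hn] := hp (d / 2) N d2.
  have [_ h2] := hz n.
  have h3 : (n.+1%:R : R)^-1 <= d / 2.
    rewrite -[d / 2]invrK lef_pV2 ?posrE ?invr_gt0// invf_div.
    by apply: (le_trans hN); rewrite ler_nat; apply: leqW.
  have := nmBge (z n) p; move: h2 h3; set u := n.+1%:R^-1; lra.
pose r := nm z1.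
have r2 : r <= 29 / 20 by exact: (fill_nm K1 Fz1).
have r0 : 0 < r.
  rewrite lt_neqAle nm_ge0 andbT; apply/eqP => rz.
  have : (area F <= ((2 * 0) ^+ 2)%:E)%E.
    by apply: area_le_box => //; [exact: (fill_closed cK K1)|move=> z /z1max; rewrite -/r -rz].
  by rewrite mulr0 expr0n /= leNgt areaF0.
pose W : set (Cx R) := cball 0 2; pose U : set (Cx R) := cball 0 r.
have clU z : closure U z -> nm z <= r.
  move=> /closure_nmP h; apply/ler_addgt0Pl => d d0; have [y Uy yz] := h d d0.
  move: Uy; rewrite /U /cball /= subr0 => Uy.
  by have := nmBge z y; rewrite nmBC; lra.
have oU (c : R) : open (cball 0 c : set (Cx R)).
  apply/open_nmP => z; rewrite /cball /= subr0 => zc; exists (c - nm z); first by rewrite subr_gt0.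
  by move=> y hy; rewrite subr0; have := nmBge y z; lra.
have inU z : nm z <= r -> closure U z.
  move=> zr; apply/closure_nmP => d d0.
  have [zlt|zge] := ltP (nm z) r.
    by exists z; rewrite ?subrr ?nm0// /U /cball /= subr0.
  have zE : nm z = r by apply/eqP; rewrite eq_le zr zge.
  pose t : R := Num.min (1 / 2) (d / (2 * r)).
  have rr2 : 0 < 2 * r by lra.
  have t0 : 0 < t by rewrite lt_min; apply/andP; split; [lra|exact: divr_gt0].
  have [t1 t2] : t <= 1 / 2 /\ t <= d / (2 * r) by rewrite /t !ge_min !lexx ?orbT.
  exists (rc (1 - t) * z).
    rewrite /U /cball /= subr0 nmM nm_rc zE ger0_norm; last lra.
    by rewrite gtr_pMl//; lra.
  have -> : rc (1 - t) * z - z = - (rc t * z) by rewrite rcB rc1; ring.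
  rewrite nmN nmM nm_rc zE gtr0_norm//.
  by rewrite (ler_pdivlMr _ _ rr2) in t2; lra.
exists a, f, W, U, F; split.
- exact: (alpha_irrational e_0 eS e_gt0 sg ha).
- split; [exact: oU|exact: disc_jordan|by rewrite /U /cball /= subrr nm0|].
  by move=> z /clU h; rewrite /W /cball /= subr0; lra.
- split.
  + move=> z; rewrite /W /cball /= subr0 => z2.
    by have [] := is_derive_hasd (f_hasd e_0 eS e_gt0 sg snext flim z2).
  + by move=> x y; rewrite /W /cball /= !subr0; exact: finj.
  + exact: f0.
  + rewrite -(f1_zero e_0 eS e_gt0 sg flim ha); apply: is_derive_hasd.
    by apply: (f_hasd e_0 eS e_gt0 sg snext flim); rewrite nm0.
- split.
  + apply: unstable_nonlinearizable f0 _ _.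
      by move=> x y; exact: (f_lip98 s_0 e_0 eS e_gt0 sg snext flim).
    exact: (f_unstable s_0 e_0 eS e_gt0 sg snext sorb flim).
  + split; first by split=> //; [exact: fill_connected|exact: fillC_connected].
    split.
    * by move=> z /z1max; exact: inU.
    * exists z1; split=> //; split; first exact: inU.
      move=> /interior_subset; rewrite /U /cball /= subr0 ltxx//.
    * exact: Finv.
    (* A point of [W] sent into [F] shares its image with a point of [F], and [f] is injective on
       [W]. *)
    * rewrite eqEsubset; split=> z.
        move=> [Wz Ffz]; have : (f @` F) (f z) by rewrite Finv.
        move=> [y Fy yz]; have <- // : y = z.
        apply: finj => //; first by have := z1max y Fy; rewrite -/r; lra.
        by move: Wz; rewrite /W /cball /= subr0.
      move=> Fz; split; last by rewrite -[F]Finv; exists z.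
      by rewrite /W /cball /= subr0; have := z1max z Fz; rewrite -/r; lra.
  + move=> F00; have : (area F <= ((2 * 0) ^+ 2)%:E)%E.
      apply: area_le_box => //; first exact: (fill_closed cK K1).
      by rewrite F00 => z ->; rewrite nm0.
    by rewrite mulr0 expr0n /= leNgt areaF0.
- by split=> //; apply: realify_measurable; exact: (fill_closed cK K1).
Qed.
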